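(* Let $\mathcal{C}\subset\mathbb{R}^N$ be a nonempty compact convex set with Euclidean projection $\pi_{\mathcal{C}}:\mathbb{R}^N\to\mathcal{C}$, and let $\mathcal{D}$ be a distribution of convex functions $\hat f:\mathbb{R}^N\to\mathbb{R}$ whose mean is the convex function $f$ (i.e. $E[\hat f]=f$ and $E[\partial\hat f]=\partial f$ is a subgradient of $f$). Assume a uniform bound $G$ on the norms of the subgradients, $\|\partial\hat f\|\le G$ for all $\hat f$ in the support of $\mathcal{D}$ and $\|\partial f\|\le G$. Let $u_{\mathrm{opt}}$ be a minimizer of $f$ on $\mathcal{C}$. Run the algorithm SSGD (described in the context) with smoothing radius $\varepsilon_{\mathrm{sm}}=\varepsilon$ and learning rates $\varepsilon_s=\varepsilon/\sqrt{s}$, starting from $u_1\in\mathcal{C}$. Then, in the asymptotic regime $\varepsilon\searrow 0$, if $$T\ge\left\lceil\frac{3G\,\mathrm{diam}\,\mathcal{C}}{2\varepsilon^3}+1\right\rceil^2-1=O(\varepsilon^{-6}),$$ with probability $\ge 1-2\varepsilon$ the algorithm returns a final point $u_{\mathrm{end}}$ satisfying $$f(u_{\mathrm{end}})-f(u_{\mathrm{opt}})\lessapprox 128G^2\varepsilon\log(1/\varepsilon).$$ On the other hand, in the case in which $\partial f$ is $L$-Lipschitz, one can achieve the same conclusion for $$T\ge\left\lceil\frac{3G\,\mathrm{diam}\,\mathcal{C}}{2\varepsilon^2}+1\right\rceil^2-1=O(\varepsilon^{-4})$$ (using the same algorithm without the smoothing perturbation, i.e. working directly with $f+2G\psi_{\mathcal{C}}$,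 and learning rates $\varepsilon_s=1/\sqrt{s}$).
   Context: Penalization function: for $x\in\partial\mathcal{C}$ let $S(x)$ be the set of unit vectors $v$ with $\sup_{y\in\mathcal{C}}\langle v,y-x\rangle\le 0$ (support vectors), and set $\psi_{\mathcal{C}}(y)=\sup_{x\in\partial\mathcal{C},\,v\in S(x)\cup\{0\}}\langle v,y-x\rangle$; $\psi_{\mathcal{C}}$ is convex, vanishes on $\mathcal{C}$, and admits a subgradient selection $\partial\psi_{\mathcal{C}}$ of norm at most $1$. Let $\eta_{\varepsilon_{\mathrm{sm}}}$ denote the uniform distribution on the closed ball of radius $\varepsilon_{\mathrm{sm}}$ centered at $0$. Algorithm SSGD (Smoothed Stochastic Gradient Descent): given $u_1\in\mathcal{C}$ and learning rates $\varepsilon_1,\dots,\varepsilon_T>0$, for $t=1,\dots,T$: sample $f_{t+1/2}$ from $\mathcal{D}$ independently of everything before; sample $v$ from $\eta_{\varepsilon_{\mathrm{sm}}}$ independently of everything before; set $u_{t+1}=u_t-\varepsilon_t\big[\partial f_{t+1/2}(u_t-v)+2G\,\partial\psi_{\mathcal{C}}(u_t-v)\big]$. Output $u_{\mathrm{end}}=\pi_{\mathcal{C}}(u_{T+1})$. Asymptotic notation: for a parameter $\varepsilon$, $a(\varepsilon)\lessapprox b(\varepsilon)$ means $\lim_{\varepsilon\searrow 0}a(\varepsilon)/b(\varepsilon)\le 1$ (the probability bound is understood in the same asymptotic sense). $\mathrm{diam}\,\mathcal{C}$ is the diameter of $\mathcal{C}$. *)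

(* Defs.v *)
From HB Require Import structures.
From mathcomp Require Import all_boot all_order all_algebra.
From mathcomp Require Import all_classical all_reals all_analysis.
Set Implicit Arguments. Unset Strict Implicit. Unset Printing Implicit Defensive.
Import Order.TTheory GRing.Theory Num.Theory.
Import numFieldNormedType.Exports.
Local Open Scope classical_set_scope.
Local Open Scope ring_scope.

Section Defs.
Variable R : realType.

Definition dotv n (x y : 'rV[R]_n) : R := \sum_(i < n) x 0 i * y 0 i.
Definition enorm n (x : 'rV[R]_n) : R := Num.sqrt (dotv x x).

Definition convex_fun n (h : 'rV[R]_n -> R) : Prop :=
  forall x y (t : R), 0 <= t <= 1 ->
    h (t *: x + (1 - t) *: y) <= t * h x + (1 - t) * h y.

Definition subgrad n (h : 'rV[R]_n -> R) (g x : 'rV[R]_n) : Prop :=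
  forall z, h x + dotv g (z - x) <= h z.

Definition is_proj n (C : set 'rV[R]_n) (pi : 'rV[R]_n -> 'rV[R]_n) : Prop :=
  forall y, C (pi y) /\ forall z, C z -> enorm (y - pi y) <= enorm (y - z).

Definition diam n (C : set 'rV[R]_n) : R :=
  sup [set r | exists x y, [/\ C x, C y & r = enorm (x - y)]].

Definition bdry n (C : set 'rV[R]_n) : set 'rV[R]_n := closure C `\` interior C.

Definition support_vecs n (C : set 'rV[R]_n) (x : 'rV[R]_n) : set 'rV[R]_n :=
  [set v | enorm v = 1 /\ forall y, C y -> dotv v (y - x) <= 0].

Definition psiC n (C : set 'rV[R]_n) (y : 'rV[R]_n) : R :=
  sup [set r | exists x v, [/\ bdry C x, support_vecs C x v \/ v = 0
                             & r = dotv v (y - x)]].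

(* coordinates as a tuple (n.-tuple R carries the product sigma-algebra) *)
Definition rv2t n (x : 'rV[R]_n) : n.-tuple R := [tuple x 0 i | i < n].
Definition t2rv n (t : n.-tuple R) : 'rV[R]_n := \row_i tnth t i.

Fixpoint iint (n : nat) : (n.-tuple R -> \bar R) -> \bar R :=
  match n return (n.-tuple R -> \bar R) -> \bar R with
  | 0 => fun g => g [tuple]
  | m.+1 => fun g =>
      (\int[@lebesgue_measure R]_x iint (fun t : m.-tuple R => g [tuple of x :: t]))%E
  end.
Definition volN n (A : set (n.-tuple R)) : \bar R := iint (fun t => (\1_A t)%:E).

Definition ballT n (r : R) : set (n.-tuple R) := [set t | enorm (t2rv t) <= r].

Definition uniform_ball_law d (Om : measurableType d) (P : probability Om R)
    n (V : Om -> 'rV[R]_n) (r : R) : Prop :=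
  measurable_fun setT (fun w => rv2t (V w)) /\
  forall A : set (n.-tuple R), measurable A ->
    P ((fun w => rv2t (V w)) @^-1` A) =
      (volN (A `&` @ballT n r) * ((fine (volN (@ballT n r)))^-1)%:E)%E.

Definition has_law d (Om : measurableType d) (P : probability Om R)
    dX (X : measurableType dX) (PD : probability X R) (Y : Om -> X) : Prop :=
  measurable_fun setT Y /\ forall A, measurable A -> P (Y @^-1` A) = PD A.

Definition indep_family d (Om : measurableType d) (P : probability Om R)
    dX (X : measurableType dX) (Y : nat -> Om -> X) (T : nat) : Prop :=
  forall A : nat -> set X, (forall t, measurable (A t)) ->
    P (\bigcap_(t in `I_T) (Y t @^-1` A t)) =
      \big[*%E/1%E]_(t < T) P (Y t @^-1` A t).

Definition indep_family2 d (Om : measurableType d) (P : probability Om R)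
    dX (X : measurableType dX) dY (Yt : measurableType dY)
    (Y : nat -> Om -> X) (Z : nat -> Om -> Yt) (T : nat) : Prop :=
  forall (A : nat -> set X) (B : nat -> set Yt),
    (forall t, measurable (A t)) -> (forall t, measurable (B t)) ->
    P (\bigcap_(t in `I_T) (Y t @^-1` A t `&` Z t @^-1` B t)) =
      \big[*%E/1%E]_(t < T) (P (Y t @^-1` A t) * P (Z t @^-1` B t))%E.

(* iterates of (S)SGD: ssgd_iter ... 0 = u_1 and ssgd_iter ... t = u_(t+1);
   u_(s+1) = u_s - lr s * grad (s-1) (u_s - v (s-1)) for s >= 1. *)
Fixpoint ssgd_iter n (u1 : 'rV[R]_n) (lr : nat -> R)
    (grad : nat -> 'rV[R]_n -> 'rV[R]_n) (v : nat -> 'rV[R]_n) (t : nat) : 'rV[R]_n :=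
  match t with
  | 0 => u1
  | s.+1 => let u := ssgd_iter u1 lr grad v s in u - lr s.+1 *: grad s (u - v s)
  end.

End Defs.

(* Main.v *)
(* The selections [dF] and [dpsi] of subgradients need not be measurable, so the iterates
   are not random variables and no martingale argument is available. Instead, Hoeffding's
   inequality and a union bound give a measurable event, of probability at least [1 - 1/T],
   on which the noise, i.e. the difference between the sampled objectives and their mean,
   has small sums over all time windows along a finite family of deterministic reference
   paths: the points of a fine net (constant paths) and the gradient descents on the mean
   objective started at these points at any time. On this event the argument is pathwise.
   Over a short window the iterates stay near the reference path started at a net point
   next to them, so the noise they meet is that of the reference path up to a Lipschitz
   error; cutting longer windows into short ones and repeating this at a few scales bounds
   the noise over every window. This gives the regret on all suffixes of the run, hence a
   bound on the last iterate. The penalty [2 G psiC] confines the iterates to a bounded set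
   and dominates [G] times the distance to [C], so that the final projection is free. All
   error terms are [o(eps ln (1/eps))]; the constant 128 is not sharp. *)
Require Import Defs.
From HB Require Import structures.
From mathcomp Require Import all_boot all_order all_algebra.
From mathcomp Require Import all_classical all_reals all_analysis measurable_realfun.
From mathcomp Require Import ring lra zify.
Import Order.TTheory GRing.Theory Num.Theory.
Import numFieldNormedType.Exports.
Local Open Scope classical_set_scope.
Local Open Scope ring_scope.

(** The exponents decide the shape of the proof. With [x = 1/p] and [p] the integer part of the
    tenth root of [T], passing to the last iterate leaves a term of order
    [sqrt (ln T) * sqrt (x^5)], that is [T^(-1/4)] up to the logarithm. For [T] of order [eps^-4]
    this is [eps * sqrt (ln (1/eps))], so only half a logarithm is to spare and the remaining terms
    must be smaller than [T^(-1/4)]. Constant reference paths leave an error of order [c * x], where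
    [c / sqrt s] are the learning rates. With [c = eps] and [T] of order [eps^-6] this is
    negligible, and smoothing then costs only a bias of order [eps]; no subgradient of the smoothed
    mean is ever constructed. With [c = 1] and [T] of order [eps^-4] it is [eps^(2/5)], far too
    much. Descents along the mean subgradient cure this: subgradients are monotone, so up to
    second-order terms only the noise drives the iterates away from such a descent, and three scales
    bring the error down to [x^3], about [eps^(6/5)], up to logarithms. The last-iterate argument
    runs on the second half of the run only, where all step sizes agree up to a constant factor. *)

Ltac natlia :=
  repeat match goal with
  | H : ?P |- _ =>
    match type of P with Prop =>
      lazymatch P with
      | is_true (leq _ _) => fail
      | is_true (andb (leq _ _) (leq _ _)) => fail
      | is_true (negb (@eq_op _ _ _)) => fail
      | @eq nat _ _ => fail
      | _ => clear H
      end
    end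
  end; lia.
(** * Euclidean vectors *)

Section Euclidean.
Context {R : realType} {n : nat}.
Implicit Types x y z : 'rV[R]_n.

Lemma dotvC x y : dotv x y = dotv y x.
Proof. by apply: eq_bigr => i _; rewrite mulrC. Qed.

Lemma dotvDl x y z : dotv (x + y) z = dotv x z + dotv y z.
Proof. by rewrite -big_split; apply: eq_bigr => i _; rewrite mxE mulrDl. Qed.

Lemma dotvZl a x y : dotv (a *: x) y = a * dotv x y.
Proof. by rewrite mulr_sumr; apply: eq_bigr => i _; rewrite mxE mulrA. Qed.

Lemma dotvNl x y : dotv (- x) y = - dotv x y.
Proof. by rewrite -scaleN1r dotvZl mulN1r. Qed.

Lemma dotvBl x y z : dotv (x - y) z = dotv x z - dotv y z.
Proof. by rewrite dotvDl dotvNl. Qed.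

Lemma dotvDr x y z : dotv x (y + z) = dotv x y + dotv x z.
Proof. by rewrite dotvC dotvDl !(dotvC x). Qed.

Lemma dotvZr a x y : dotv x (a *: y) = a * dotv x y.
Proof. by rewrite dotvC dotvZl dotvC. Qed.

Lemma dotvNr x y : dotv x (- y) = - dotv x y.
Proof. by rewrite dotvC dotvNl dotvC. Qed.

Definition dotvE := (dotvDl, dotvDr, dotvNl, dotvNr, dotvZl, dotvZr).

Lemma dotv_ge0 x : 0 <= dotv x x.
Proof. by apply: sumr_ge0 => i _; rewrite -expr2 sqr_ge0. Qed.

Lemma enorm_ge0 x : 0 <= enorm x.
Proof. exact: sqrtr_ge0. Qed.

Lemma sqr_enorm x : enorm x ^+ 2 = dotv x x.
Proof. by rewrite sqr_sqrtr // dotv_ge0. Qed.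

Lemma dotv0l x : dotv 0 x = 0.
Proof. by apply: big1 => i _; rewrite mxE mul0r. Qed.

Lemma enorm0 : enorm (0 : 'rV[R]_n) = 0.
Proof. by rewrite /enorm dotv0l sqrtr0. Qed.

Lemma enorm_eq0 x : enorm x = 0 -> x = 0.
Proof.
move=> x0; have : dotv x x = 0 by rewrite -sqr_enorm x0 expr0n.
move/eqP; rewrite psumr_eq0 => [/allP h|i _]; last by rewrite -expr2 sqr_ge0.
apply/rowP => i; rewrite mxE; apply/eqP.
by have := h i (mem_index_enum i); rewrite -expr2 sqrf_eq0.
Qed.

Lemma enormN x : enorm (- x) = enorm x.
Proof. by rewrite /enorm dotvNl dotvNr opprK. Qed.

Lemma enormZ a x : enorm (a *: x) = `|a| * enorm x.
Proof.
by rewrite /enorm dotvZl dotvZr mulrA -expr2 sqrtrM ?sqr_ge0 // sqrtr_sqr.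
Qed.

Lemma enorm_distC x y : enorm (x - y) = enorm (y - x).
Proof. by rewrite -enormN opprB. Qed.

Lemma cauchy_schwarz x y : dotv x y <= enorm x * enorm y.
Proof.
have [x0|xn0] := eqVneq (enorm x) 0.
  by rewrite (enorm_eq0 _ x0) dotv0l enorm0 mul0r.
have [y0|yn0] := eqVneq (enorm y) 0.
  by rewrite (enorm_eq0 _ y0) dotvC dotv0l enorm0 mulr0.
have px : 0 < enorm x by rewrite lt_neqAle eq_sym xn0 enorm_ge0.
have py : 0 < enorm y by rewrite lt_neqAle eq_sym yn0 enorm_ge0.
have := dotv_ge0 (enorm y *: x - enorm x *: y).
rewrite !dotvE -!sqr_enorm (dotvC y x) => h.
have : 0 <= 2 * (enorm x * enorm y) * (enorm x * enorm y - dotv x y).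
  by apply: le_trans h _; rewrite le_eqVlt; apply/orP; left; apply/eqP; ring.
by rewrite pmulr_rge0 ?subr_ge0 // !mulr_gt0.
Qed.

Lemma ler_enormD x y : enorm (x + y) <= enorm x + enorm y.
Proof.
rewrite -(@ler_pXn2r _ 2) ?nnegrE ?addr_ge0 ?enorm_ge0 //.
rewrite sqr_enorm !dotvE (dotvC y x) -!sqr_enorm.
by have := cauchy_schwarz x y; lra.
Qed.

Lemma ler_enormB x y : enorm (x - y) <= enorm x + enorm y.
Proof. by rewrite (le_trans (ler_enormD _ _)) // enormN. Qed.

Lemma ler_enorm_dist y x z : enorm (x - z) <= enorm (x - y) + enorm (y - z).
Proof. by rewrite (le_trans _ (ler_enormD _ _)) // addrA subrK. Qed.

Lemma cauchy_schwarz_abs x y : `|dotv x y| <= enorm x * enorm y.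
Proof.
rewrite ler_norml cauchy_schwarz andbT lerNl -dotvNl.
by rewrite (le_trans (cauchy_schwarz _ _)) // enormN.
Qed.

Lemma sqr_enormB x y :
  enorm (x - y) ^+ 2 = enorm x ^+ 2 - 2 * dotv x y + enorm y ^+ 2.
Proof. by rewrite !sqr_enorm !dotvE (dotvC y x); ring. Qed.

Lemma coord_le_enorm x i : `|x 0 i| <= enorm x.
Proof.
rewrite -(@ler_pXn2r _ 2) ?nnegrE ?enorm_ge0 // real_normK ?num_real //.
rewrite sqr_enorm /dotv (bigD1 i) //= -expr2 lerDl sumr_ge0 // => j _.
by rewrite -expr2 sqr_ge0.
Qed.

Lemma enorm_le_sum x : enorm x <= \sum_i `|x 0 i|.
Proof.
rewrite -(@ler_pXn2r _ 2) ?nnegrE ?enorm_ge0 ?sumr_ge0 //.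
rewrite sqr_enorm /dotv expr2 mulr_suml; apply: ler_sum => i _.
rewrite (le_trans (ler_norm _)) // normrM ler_wpM2l //.
by rewrite (bigD1 i) //= lerDl sumr_ge0.
Qed.

Lemma subgrad_lipschitz (h : 'rV[R]_n -> R) (g : 'rV[R]_n -> 'rV[R]_n) M x y :
  (forall z, subgrad h (g z) z) -> (forall z, enorm (g z) <= M) ->
  `|h x - h y| <= M * enorm (x - y).
Proof.
move=> hg gM.
have le1 a b : h a - h b <= M * enorm (a - b).
  have := hg a b; have := cauchy_schwarz (g a) (a - b).
  have := ler_wpM2r (enorm_ge0 (a - b)) (gM a).
  by rewrite -(opprB a b) dotvNr; lra.
by rewrite ler_norml le1 andbT lerNl opprB enorm_distC le1.
Qed.

End Euclidean.

(** * From suffix averages to the last iterate *)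

Section LastIterate.
Context {R : realType}.

(** The hypothesis is a regret bound on each suffix against the first point of that suffix. Since [S
    t.+1 / W t.+1 - S t / W t = w t * (S t - W t * phi t) / (W t * W t.+1)], dropping the first
    index raises the weighted average by at most the [t]-th summand of the correction; after all
    indices but one are dropped, the average is the last value. *)
Lemma last_iterate_le_average (w phi K : nat -> R) hi a : (a < hi)%N ->
  (forall s, (a <= s < hi)%N -> 0 < w s) ->
  let W t := \sum_(t <= s < hi) w s in
  let S t := \sum_(t <= s < hi) w s * phi s in
  (forall t, (a <= t < hi.-1)%N -> S t <= W t * phi t + K t) ->
  phi hi.-1 <= S a / W a + \sum_(a <= t < hi.-1) w t * K t / (W t * W t.+1).
Proof.
move=> ahi w0 W S.
have [m hm] : exists m, (hi = a + m.+1)%N by exists (hi - a).-1; lia.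
elim: m a ahi w0 hm => [|m IH] a ahi w0 hm hS.
  have e : hi = a.+1 by lia.
  rewrite /W /S e /= !big_nat1 big_geq // addr0.
  by rewrite mulrAC divff ?mul1r ?lexx // gt_eqF // w0 // e ltnSn leqnn.
have W0 t : (a <= t < hi)%N -> 0 < W t.
  move=> th; rewrite /W big_ltn; last lia.
  rewrite ltr_pwDl ?w0 //.
  by rewrite big_nat_cond sumr_ge0 // => s sn; rewrite ltW // w0 //; lia.
have ah : (a < hi.-1)%N by lia.
apply: (le_trans (IH a.+1 ltac:(lia) (fun s sn => w0 s ltac:(lia)) ltac:(lia)
  (fun s sn => hS s ltac:(lia)))).
rewrite [in leRHS]big_ltn // addrA lerD2r.
have WS : W a = w a + W a.+1 by rewrite /W big_ltn.
have SS : S a = w a * phi a + S a.+1 by rewrite /S big_ltn.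
have Wa := W0 a ltac:(lia); have Wa1 := W0 a.+1 ltac:(lia).
have wa := w0 a ltac:(lia).
have h := hS a ltac:(lia).
have -> : S a / W a + w a * K a / (W a * W a.+1) =
    (S a * W a.+1 + w a * K a) / (W a * W a.+1).
  by field; rewrite !gt_eqF.
rewrite ler_pdivlMr ?mulr_gt0 // (_ : S a.+1 / W a.+1 * (W a * W a.+1) = S a.+1 * W a); last first.
  by field; rewrite !gt_eqF.
have : w a * S a <= w a * (W a * phi a + K a) by rewrite ler_wpM2l // ltW.
have -> : W a.+1 = W a - w a by rewrite WS; ring.
have -> : S a.+1 = S a - w a * phi a by rewrite SS; ring.
lra.
Qed.

Lemma ler_harmonic J : (0 < J)%N -> \sum_(1 <= j < J) (j%:R : R)^-1 <= 1 + ln J%:R.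
Proof.
have succ n : \sum_(1 <= j < n.+2) (j%:R : R)^-1 <= 1 + ln n.+1%:R.
  elim: n => [|n IH]; first by rewrite big_nat1 invr1 lerDl ln_ge0.
  rewrite big_nat_recr //= (le_trans (lerD IH (lexx _))) // -addrA lerD2l.
  have p1 : 0 < n.+1%:R :> R by rewrite ltr0n.
  have p2 : 0 < n.+2%:R :> R by rewrite ltr0n.
  have e : 1 + - (n.+2%:R)^-1 = n.+1%:R / n.+2%:R :> R.
    by rewrite -[n.+2%:R]natr1 -[n.+1%:R]natr1; field; move: p2; rewrite -natr1 -natr1 => p2; rewrite gt_eqF.
  have : ln (n.+1%:R / n.+2%:R) <= - (n.+2%:R)^-1 :> R.
    by rewrite -e le_ln1Dx // ltrN2 invf_lt1 // ltr1n.
  by rewrite ln_div ?posrE // lerBlDr => h; rewrite -lerBrDr (le_trans h) // addrC.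
case: J => // -[|J] _; first by rewrite big_geq // addr_ge0 // ln_ge0.
rewrite (le_trans (succ J)) // lerD2l ler_ln ?posrE ?ltr0n // ler_nat //.
Qed.

Lemma sqrt_gt0_nat n : (0 < n)%N -> 0 < Num.sqrt n%:R :> R.
Proof. by move=> n0; rewrite sqrtr_gt0 ltr0n. Qed.

Lemma sqr_sqrt_nat n : Num.sqrt n%:R ^+ 2 = n%:R :> R.
Proof. by rewrite sqr_sqrtr ?ler0n. Qed.

Lemma ler_sum_inv_sqrt m : \sum_(1 <= j < m) (Num.sqrt j%:R)^-1 <= 2 * Num.sqrt m%:R :> R.
Proof.
have succ n : \sum_(1 <= j < n.+1) (Num.sqrt j%:R)^-1 <= 2 * Num.sqrt n%:R :> R.
  elim: n => [|n IH]; first by rewrite big_geq // mulr_ge0 ?sqrtr_ge0.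
  rewrite big_nat_recr //= (le_trans (lerD IH (lexx _))) // -lerBrDl -mulrBr.
  have b0 := @sqrt_gt0_nat n.+1 isT; have := sqr_sqrt_nat n.+1.
  have := sqr_sqrt_nat n; move: b0; rewrite -natr1; set a := Num.sqrt n%:R.
  set b := Num.sqrt _ => b0 ea eb.
  rewrite -(ler_pM2r b0) mulVf ?gt_eqF //.
  by have := sqr_ge0 (b - a); lra.
case: m => [|m]; first by rewrite big_geq // mulr_ge0 ?sqrtr_ge0.
by rewrite (le_trans (succ m)) // ler_wpM2l // ler_wsqrtr // ler_nat.
Qed.

Lemma ler_sum_inv_sqrt3 m J : (0 < m)%N ->
  \sum_(m <= j < J) (j%:R * Num.sqrt j%:R)^-1 <= 3 / Num.sqrt m%:R :> R.
Proof.
move=> m0; have sm0 := sqrt_gt0_nat m m0.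
(* The subtracted term follows the integral of [j^(-3/2)] and closes the induction; at [n = 0] the
   remaining [3 - 2 = 1] covers the first summand. *)
have succ n : \sum_(m <= j < (m + n).+1) (j%:R * Num.sqrt j%:R)^-1 <=
    3 / Num.sqrt m%:R - 2 / Num.sqrt (m + n)%:R :> R.
  elim: n => [|n IH].
    rewrite addn0 big_nat1 -mulrBl invfM ler_pM2r ?invr_gt0 //.
    have -> : 3 - 2 = 1 :> R by lra.
    by rewrite invf_le1 ?ltr0n // ler1n.
  rewrite addnS big_nat_recr //=; last by natlia.
  rewrite (le_trans (lerD IH (lexx _))) // -addrA lerD2l.
  have a0 := @sqrt_gt0_nat (m + n)%N ltac:(natlia).
  have b0 := @sqrt_gt0_nat (m + n).+1 isT.
  have := sqr_sqrt_nat (m + n).+1; have := sqr_sqrt_nat (m + n)%N.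
  move: a0 b0; rewrite -natr1; set a := Num.sqrt (m + n)%:R; set b := Num.sqrt (_ + 1).
  move=> a0 b0 ea; rewrite -ea => eb; rewrite -eb.
  have ab : a <= b.
    by rewrite -(@ler_pXn2r _ 2) ?nnegrE ?sqrtr_ge0 // eb lerDl.
  have h1 : 1 <= 2 * b * (b - a).
    have e : (b + a) * (b - a) = 1.
      by rewrite (_ : (b + a) * (b - a) = b ^+ 2 - a ^+ 2); [rewrite eb|]; ring.
    by rewrite -[leLHS]e ler_wpM2r ?subr_ge0 //; move: ab; lra.
  have h2 : a <= 2 * b ^+ 2 * (b - a).
    have : b * 1 <= b * (2 * b * (b - a)) by rewrite ler_wpM2l // ltW.
    by move: ab; lra.
  rewrite -subr_ge0 (_ : _ - _ = (2 * b ^+ 2 * (b - a) - a) / (a * b ^+ 3)); last first.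
    by field; rewrite !gt_eqF.
  by rewrite divr_ge0 ?subr_ge0 // mulr_ge0 ?exprn_ge0 // ltW.
have [mJ|Jm] := ltnP m J; last by rewrite big_geq // divr_ge0 // ltW.
have -> : J = (m + (J - m.+1)).+1 by natlia.
by rewrite (le_trans (succ _)) // gerBl divr_ge0 ?sqrtr_ge0.
Qed.

(** The sum is split at [m], the integer part of [1 / x]. Below [m] the linear branch of the minimum
    leaves a sum of [1 / sqrt j], above it the constant branch leaves the tail of [j^(-3/2)]; both
    have order [sqrt x]. With either branch alone the bound would not vanish with [x]. *)
Lemma sum_min_le (b c x : R) J : 0 <= b -> 0 <= c -> 0 < x <= 1 ->
  \sum_(1 <= j < J) Num.min b (c * x * j%:R) / (j%:R * Num.sqrt j%:R) <=
  (2 * c + 6 * b) * Num.sqrt x.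
Proof.
move=> b0 c0 /andP[x0 x1].
pose m := Num.trunc x^-1.
have xV : 1 <= x^-1 by rewrite invf_ge1.
have m0 : (0 < m)%N by rewrite truncn_gt0.
have /andP[mx xm] : m%:R <= x^-1 < m.+1%:R by rewrite truncn_itv // ltW // invr_gt0.
have sx0 : 0 < Num.sqrt x by rewrite sqrtr_gt0.
have sxx : Num.sqrt x ^+ 2 = x by rewrite sqr_sqrtr // ltW.
have sm0 := sqrt_gt0_nat m m0.
have mm := sqr_sqrt_nat m.
have min0 j : 0 <= Num.min b (c * x * j%:R) / (j%:R * Num.sqrt j%:R).
  by rewrite divr_ge0 ?mulr_ge0 ?sqrtr_ge0 // le_min b0 !mulr_ge0 // ltW.
have xm1 : Num.sqrt x * Num.sqrt m%:R <= 1.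
  rewrite -(@ler_pXn2r _ 2) ?nnegrE ?mulr_ge0 ?sqrtr_ge0 // exprMn sxx mm expr1n.
  by rewrite -ler_pdivlMl // mulr1.
have xm2 : 1 <= 2 * (Num.sqrt x * Num.sqrt m%:R).
  rewrite -(@ler_pXn2r _ 2) ?nnegrE ?mulr_ge0 ?sqrtr_ge0 // !exprMn sxx mm expr1n.
  have : m.+1%:R <= 2 * m%:R :> R by rewrite -natrM ler_nat; natlia.
  have := ler_wpM2l (ltW x0) (ltW xm); rewrite divff ?gt_eqF //.
  move=> h1 /(ler_wpM2l (ltW x0)); move: h1; lra.
have hlow n : (n <= m)%N -> \sum_(1 <= j < n) Num.min b (c * x * j%:R) / (j%:R * Num.sqrt j%:R) <=
    2 * c * Num.sqrt x.
  move=> nm; apply: (@le_trans _ _ (\sum_(1 <= j < n) c * x * (Num.sqrt j%:R)^-1)).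
    apply: ler_sum_nat => j jn; have j0 : (0 < j)%N by natlia.
    rewrite invfM mulrA ler_wpM2r ?invr_ge0 ?sqrtr_ge0 //.
    by rewrite ler_pdivrMr ?ltr0n // ge_min lexx orbT.
  rewrite -mulr_sumr.
  have h : \sum_(1 <= j < n) (Num.sqrt j%:R)^-1 <= 2 * Num.sqrt m%:R :> R.
    by rewrite (le_trans (ler_sum_inv_sqrt n)) // ler_wpM2l // ler_wsqrtr // ler_nat.
  rewrite (le_trans (ler_wpM2l _ h)) ?mulr_ge0 ?(ltW x0) //.
  rewrite -{1}sxx (_ : c * _ * _ = 2 * c * Num.sqrt x * (Num.sqrt x * Num.sqrt m%:R)); last ring.
  by rewrite ler_piMr // !mulr_ge0 // ltW.
have hhigh : \sum_(m <= j < J) Num.min b (c * x * j%:R) / (j%:R * Num.sqrt j%:R) <=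
    6 * b * Num.sqrt x.
  apply: (@le_trans _ _ (\sum_(m <= j < J) b * (j%:R * Num.sqrt j%:R)^-1)).
    apply: ler_sum_nat => j jn.
    by rewrite ler_wpM2r ?invr_ge0 ?mulr_ge0 ?sqrtr_ge0 // ge_min lexx.
  rewrite -mulr_sumr (le_trans (ler_wpM2l b0 (ler_sum_inv_sqrt3 m J m0))) //.
  rewrite mulrA ler_pdivrMr //.
  have : b * 1 <= b * (2 * (Num.sqrt x * Num.sqrt m%:R)) by rewrite ler_wpM2l.
  lra.
have low0 : 0 <= 2 * c * Num.sqrt x by rewrite !mulr_ge0 // ltW.
have high0 : 0 <= 6 * b * Num.sqrt x by rewrite !mulr_ge0 // ltW.
rewrite mulrDl; have [mJ|Jm] := leqP m J.
  by rewrite (big_cat_nat m0 mJ) /= lerD // hlow.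
by rewrite (le_trans (hlow J (ltnW Jm))) // lerDl.
Qed.

End LastIterate.

(** * Sums over time windows *)

Section NatSums.
Context {R : realType}.

(** The window is cut into blocks of length [k], each paying [c] once; the [+ 1] pays for the
    incomplete block. *)
Lemma ler_sum_blocks (F : nat -> R) (lo hi k : nat) (b c : R) :
  (0 < k)%N -> 0 <= c ->
  (forall t n, (lo <= t)%N -> (t + n <= hi)%N -> (n <= k)%N ->
     \sum_(t <= s < t + n) F s <= b * n%:R + c) ->
  forall t n, (lo <= t)%N -> (t + n <= hi)%N ->
     \sum_(t <= s < t + n) F s <= b * n%:R + (n%:R / k%:R + 1) * c.
Proof.
move=> k0 c0 hF t n; elim/ltn_ind: n t => n IH t lot tn.
have kR : 0 < k%:R :> R by rewrite ltr0n.
have [nk|kn] := leqP n k.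
  apply: (le_trans (hF _ _ lot tn nk)); rewrite lerD2l ler_peMl //.
  by rewrite lerDr divr_ge0.
have tk : (t + k <= t + n)%N by natlia.
rewrite (big_cat_nat _ tk) /=; last natlia.
have h1 := hF t k lot ltac:(natlia) (leqnn k).
have h2 := IH (n - k)%N ltac:(natlia) (t + k)%N ltac:(natlia) ltac:(natlia).
have e : (t + k + (n - k) = t + n)%N by natlia.
rewrite e in h2; apply: (le_trans (lerD h1 h2)).
rewrite natrB; last natlia.
by rewrite le_eqVlt; apply/orP; left; apply/eqP; field; lra.
Qed.

Lemma ler_sum_const (F : nat -> R) (t n : nat) (b : R) :
  (forall s, (t <= s < t + n)%N -> F s <= b) ->
  \sum_(t <= s < t + n) F s <= b * n%:R.
Proof.
move=> h; apply: (le_trans (ler_sum_nat h)).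
by rewrite sumr_const_nat addKn mulr_natr.
Qed.

End NatSums.

(** * Pathwise control of the noise by reference paths *)

Section Tracking.
Context {R : realType} {N : nat}.
Variables (w : nat -> R) (u h : nat -> 'rV[R]_N).
Variables (Phi : nat -> 'rV[R]_N -> R) (Phib : 'rV[R]_N -> R).
Variable hb : 'rV[R]_N -> 'rV[R]_N.
Variables (M eta lam zeta : R) (T0 T : nat) (Z : set 'rV[R]_N).

(** Two points are compared because the difference is Lipschitz in [x - y]: nearby points meet
    nearly the same noise. *)
Definition noise s x y : R := (Phi s x - Phib x) - (Phi s y - Phib y).

Fixpoint descent (z : 'rV[R]_N) (t0 k : nat) : 'rV[R]_N :=
  if k is k'.+1 then
    let x := descent z t0 k' in x - w (t0 + k')%N *: hb x
  else z.

(* [track None z] stays at [z]; [track (Some t0) z] stays at [z] up to time [t0]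
   and then follows the deterministic descent along [hb]. *)
Definition track (o : option nat) (z : 'rV[R]_N) (s : nat) : 'rV[R]_N :=
  if o is Some t0 then descent z t0 (s - t0) else z.

Definition admissible (o : option nat) := if o is Some t0 then (t0 <= T)%N else true.

(** This is the good event in deterministic form. The summand at time [s] is at most [2 * M] times
    the [s]-th term under the root, so the right-hand side is the threshold of Hoeffding's
    inequality at level [lam]. *)
Definition small_noise := forall o o' z z' t n, Z z -> Z z' ->
  admissible o -> admissible o' -> (T0 <= t)%N -> (t + n <= T)%N ->
  \sum_(t <= s < t + n) w s * noise s (track o z s) (track o' z' s) <=
  lam * (2 * M) *
    Num.sqrt (\sum_(t <= s < t + n) (w s * enorm (track o z s - track o' z' s)) ^+ 2).

Hypothesis M_ge0 : 0 <= M.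
Hypothesis eta_ge0 : 0 <= eta.
Hypothesis lam_ge0 : 0 <= lam.
Hypothesis zeta_ge0 : 0 <= zeta.
Hypothesis w_bnd : forall s, (T0 <= s < T)%N -> 0 <= w s <= eta.
Hypothesis uS : forall s, (T0 <= s < T)%N -> u s.+1 = u s - w s *: h s.
Hypothesis h_sub : forall s, (T0 <= s < T)%N -> subgrad (Phi s) (h s) (u s).
Hypothesis h_bnd : forall s, (T0 <= s < T)%N -> enorm (h s) <= M.
Hypothesis hb_bnd : forall x, enorm (hb x) <= M.
Hypothesis Phi_lip : forall s, (T0 <= s < T)%N -> forall x y,
  `|Phi s x - Phi s y| <= M * enorm (x - y).
Hypothesis Phib_lip : forall x y, `|Phib x - Phib y| <= M * enorm (x - y).
Hypothesis good : small_noise.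
Hypothesis net : forall s, (T0 <= s <= T)%N -> exists2 x, Z x & enorm (x - u s) <= zeta.

Lemma noiseC s x y : noise s x y = - noise s y x.
Proof. by rewrite /noise; ring. Qed.

Lemma noise_lip s x y : (T0 <= s < T)%N -> `|noise s x y| <= 2 * M * enorm (x - y).
Proof.
move=> sT; have := Phi_lip _ sT x y; have := Phib_lip x y.
rewrite /noise !ler_norml => /andP[a b] /andP[c d]; apply/andP; split; lra.
Qed.

Lemma weighted_noise_lip s x y (d : R) : (T0 <= s < T)%N -> enorm (x - y) <= d ->
  w s * noise s x y <= 2 * M * eta * d.
Proof.
move=> sT xyd; have /andP[w0 we] := w_bnd _ sT.
have d0 : 0 <= d := le_trans (enorm_ge0 _) xyd.
have /ler_normlW h1 := noise_lip _ x y sT.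
have h2 : 2 * M * enorm (x - y) <= 2 * M * d by rewrite ler_wpM2l ?mulr_ge0.
have h3 : w s * noise s x y <= w s * (2 * M * d).
  by rewrite ler_wpM2l // (le_trans h1).
apply: (le_trans h3); rewrite (_ : 2 * M * eta * d = eta * (2 * M * d)); last ring.
by rewrite ler_wpM2r // !mulr_ge0.
Qed.

(** Here concentration beats the Lipschitz estimate: the factor is [sqrt n] instead of [n]. *)
Lemma small_noise_unif o o' z z' t n (d : R) : Z z -> Z z' ->
  admissible o -> admissible o' -> (T0 <= t)%N -> (t + n <= T)%N ->
  (forall s, (t <= s < t + n)%N -> enorm (track o z s - track o' z' s) <= d) -> 0 <= d ->
  \sum_(t <= s < t + n) w s * noise s (track o z s) (track o' z' s) <=
  2 * lam * M * eta * Num.sqrt n%:R * d.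
Proof.
move=> Zz Zz' ao ao' lot tn hd d0.
apply: (le_trans (good _ _ _ _ _ _ Zz Zz' ao ao' lot tn)).
have -> : 2 * lam * M * eta * Num.sqrt n%:R * d =
   lam * (2 * M) * Num.sqrt ((eta * d) ^+ 2 * n%:R).
  by rewrite sqrtrM ?sqr_ge0 // sqrtr_sqr ger0_norm ?mulr_ge0 //; ring.
rewrite ler_wpM2l ?mulr_ge0 // ler_wsqrtr //.
apply: ler_sum_const => s /[dup] sn /hd hs.
have /andP[w0 we] : 0 <= w s <= eta by apply: w_bnd; natlia.
by rewrite ler_pXn2r ?nnegrE ?mulr_ge0 ?enorm_ge0 // ler_pM ?enorm_ge0.
Qed.

Lemma enorm_sub_le (p : nat -> 'rV[R]_N) c t n :
  (forall s, (t <= s < t + n)%N -> enorm (p s.+1 - p s) <= c) ->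
  enorm (p (t + n)%N - p t) <= c * n%:R.
Proof.
elim: n => [|n IH] hp; first by rewrite addn0 subrr enorm0 mulr0.
rewrite (le_trans (ler_enorm_dist (p (t + n)%N) _ _)) //.
rewrite -natr1 mulrDr mulr1 addrC lerD ?IH // ?addnS ?hp //; [|natlia].
by move=> s sn; apply: hp; natlia.
Qed.

Lemma iterate_speed t n : (T0 <= t)%N -> (t + n <= T)%N ->
  enorm (u (t + n)%N - u t) <= M * eta * n%:R.
Proof.
move=> lot tn; apply: enorm_sub_le => s sn.
have sT : (T0 <= s < T)%N by natlia.
rewrite uS // addrAC subrr sub0r enormN enormZ.
have /andP[w0 we] := w_bnd _ sT.
by rewrite ger0_norm // mulrC ler_pM ?enorm_ge0 // h_bnd.
Qed.

Lemma track_step o z s : (T0 <= s < T)%N -> enorm (track o z s.+1 - track o z s) <= M * eta.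
Proof.
move=> sT; have Me0 : 0 <= M * eta by rewrite mulr_ge0.
case: o => [t0|] /=; last by rewrite subrr enorm0.
have [st|ts] := ltnP s t0.
  rewrite (_ : (s.+1 - t0 = 0)%N); last natlia.
  by rewrite (_ : (s - t0 = 0)%N) ?subrr ?enorm0 //; natlia.
rewrite subSn //= subnKC // addrAC subrr sub0r enormN enormZ.
have /andP[w0 we] := w_bnd _ sT.
by rewrite ger0_norm // mulrC ler_pM ?enorm_ge0.
Qed.

Lemma track_speed o z t n : (T0 <= t)%N -> (t + n <= T)%N ->
  enorm (track o z (t + n)%N - track o z t) <= M * eta * n%:R.
Proof. by move=> lot tn; apply: enorm_sub_le => s sn; apply: track_step; natlia. Qed.

Lemma track_start o z t : (if o is Some t0 then t0 = t else True) -> track o z t = z.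
Proof. by case: o => [t0|] //= ->; rewrite subnn. Qed.

(* A reference path started within [zeta] of the iterate at any time [t] stays
   within [d] of it for [k] steps and accounts for all but [b * n] of the noise. *)
Definition level (det : bool) (k : nat) (b d : R) := forall t n x,
  (T0 <= t)%N -> (t + n <= T)%N -> (n <= k)%N -> Z x -> enorm (x - u t) <= zeta ->
  let p := track (if det then Some t else None) x in
  (forall s, (t <= s <= t + n)%N -> enorm (u s - p s) <= d) /\
  - (\sum_(t <= s < t + n) w s * noise s (u s) (p s)) <= b * n%:R.

(** The base scale uses no concentration. In [k] steps the iterate moves at most [M * eta * k] away
    from a constant path, and the noise is bounded by its Lipschitz constant. *)
Lemma level_const k :
  level false k (2 * M * eta * (zeta + M * eta * k%:R)) (zeta + M * eta * k%:R).
Proof.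
move=> t n x lot tn nk Zx xz /=.
have hd s : (t <= s <= t + n)%N -> enorm (u s - x) <= zeta + M * eta * k%:R.
  move=> sn; rewrite (le_trans (ler_enorm_dist (u t) _ _)) //.
  rewrite addrC lerD // 1?enorm_distC //.
  have := @iterate_speed t (s - t)%N lot ltac:(natlia).
  rewrite subnKC; last natlia.
  rewrite enorm_distC => /le_trans; apply; rewrite ler_wpM2l ?mulr_ge0 // ler_nat; natlia.
split => //; rewrite -sumrN; apply: ler_sum_const => s sn.
rewrite -mulrN -noiseC; apply: weighted_noise_lip; first natlia.
by rewrite enorm_distC hd //; natlia.
Qed.

Hypothesis hb_sub : forall x, subgrad Phib (hb x) x.

(** Expanding the square after one step, the inner product of [u s - p s] with the difference of the
    two subgradients is at least the noise: add the subgradient inequalities of [Phi s] at [u s] and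
    of [Phib] at [p s]. The mean objective thus never pushes the two paths apart; what remains is
    the noise and a second-order term. *)
Lemma descent_gap (p : nat -> 'rV[R]_N) t n : (T0 <= t)%N -> (t + n <= T)%N ->
  (forall s, (t <= s < t + n)%N -> p s.+1 = p s - w s *: hb (p s)) ->
  enorm (u (t + n)%N - p (t + n)%N) ^+ 2 <= enorm (u t - p t) ^+ 2
    - 2 * (\sum_(t <= s < t + n) w s * noise s (u s) (p s)) + 4 * (M * eta) ^+ 2 * n%:R.
Proof.
move=> lot; elim: n => [|n IH] tn pS.
  by rewrite addn0 big_geq // !mulr0 subr0 addr0.
rewrite addnS big_nat_recr /=; last natlia.
have sT : (T0 <= t + n < T)%N by natlia.
have {}IH := IH ltac:(natlia) (fun s sn => pS s ltac:(natlia)).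
have /andP[w0 we] := w_bnd _ sT.
rewrite uS // pS; last natlia.
set s := (t + n)%N in IH sT w0 we *.
have -> : u s - w s *: h s - (p s - w s *: hb (p s)) =
          (u s - p s) - w s *: (h s - hb (p s)).
  by apply/rowP => i; rewrite !mxE; ring.
rewrite (sqr_enormB (u s - p s)) enormZ exprMn ger0_norm // dotvZr.
have e1 : noise s (u s) (p s) <= dotv (u s - p s) (h s - hb (p s)).
  have := h_sub _ sT (p s); have := hb_sub (p s) (u s).
  rewrite (dotvC (u s - p s)) dotvBl -(opprB (u s) (p s)) dotvNr /noise; lra.
have e2 : w s * noise s (u s) (p s) <= w s * dotv (u s - p s) (h s - hb (p s)).
  by rewrite ler_wpM2l.
have e3 : w s ^+ 2 * enorm (h s - hb (p s)) ^+ 2 <= 4 * (M * eta) ^+ 2.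
  rewrite -exprMn (_ : 4 * (M * eta) ^+ 2 = (eta * (2 * M)) ^+ 2); last ring.
  rewrite ler_pXn2r ?nnegrE ?mulr_ge0 ?enorm_ge0 // ler_pM ?enorm_ge0 //.
  rewrite (le_trans (ler_enormB _ _)) //; have := h_bnd _ sT.
  by have := hb_bnd (p s); lra.
rewrite -natr1; lra.
Qed.

(** The reference path started at [t] need not be close to the iterate at [t'], so a fresh one is
    started there. The iterate against the fresh path is controlled by the level; the fresh path
    against the old one is a comparison of two deterministic paths, which [small_noise] covers. *)
Lemma window_noise det k (b d : R) t z t' n' (D : R) : level det k b d ->
  (T0 <= t)%N -> (t <= t')%N -> (t' + n' <= T)%N -> (n' <= k)%N -> Z z ->
  enorm (u t' - track (Some t) z t') <= D ->
  - (\sum_(t' <= s < t' + n') w s * noise s (u s) (track (Some t) z s)) <=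
  b * n'%:R + 2 * lam * M * eta * Num.sqrt n'%:R * (D + zeta + 2 * M * eta * n'%:R).
Proof.
move=> lev lot tt' tn nk Zz hD.
have [x Zx xz] := net t' ltac:(natlia).
have [_ hb1] := lev t' n' x ltac:(natlia) tn nk Zx xz.
set q := track _ x in hb1.
have Me n : 0 <= M * eta * n%:R by rewrite !mulr_ge0.
have D0 : 0 <= D := le_trans (enorm_ge0 _) hD.
have : \sum_(t' <= s < t' + n') w s * noise s (track (Some t) z s) (q s) <=
   2 * lam * M * eta * Num.sqrt n'%:R * (D + zeta + 2 * M * eta * n'%:R).
  apply: small_noise_unif => //; rewrite /admissible; [natlia | by case: (det) => //; natlia | natlia | | ]; last first.
    by have := zeta_ge0; have := Me n'; lra.
  move=> s sn.
  have qt : q t' = x by rewrite /q track_start //; case: (det).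
  have e1 := @track_speed (Some t) z t' (s - t')%N ltac:(natlia) ltac:(natlia).
  have e2 := @track_speed (if det then Some t' else None) x t' (s - t')%N ltac:(natlia) ltac:(natlia).
  rewrite -/q qt in e2; rewrite subnKC in e1 e2; [|natlia..].
  have e3 : M * eta * (s - t')%:R <= M * eta * n'%:R.
    by rewrite ler_wpM2l ?mulr_ge0 // ler_nat; natlia.
  rewrite enorm_distC in xz; rewrite enorm_distC in hD; rewrite enorm_distC in e2.
  have := ler_enorm_dist (track (Some t) z t') (track (Some t) z s) (q s).
  have := ler_enorm_dist (u t') (track (Some t) z t') (q s).
  have := ler_enorm_dist x (u t') (q s).
  lra.
have -> : \sum_(t' <= s < t' + n') w s * noise s (track (Some t) z s) (q s) =
   (\sum_(t' <= s < t' + n') w s * noise s (u s) (q s)) -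
   (\sum_(t' <= s < t' + n') w s * noise s (u s) (track (Some t) z s)).
  rewrite -sumrB; apply: eq_bigr => s _.
  by rewrite /noise; ring.
lra.
Qed.

(** Induction over [q] blocks of length [k]. At block ends the distance to the descent stays below
    [D]: the numerical hypothesis says that the energy gained in [q] blocks by [descent_gap], with
    the noise estimated by [window_noise], fits into [D ^+ 2]. Inside a block the two paths separate
    by at most [2 * M * eta * k]. *)
Lemma level_step det k q (b d D : R) : (0 < k)%N -> 0 <= D -> zeta <= M * eta -> 0 <= b ->
  level det k b d ->
  zeta ^+ 2 + q%:R * (2 * (b * k%:R + 2 * lam * M * eta * Num.sqrt k%:R *
     (D + zeta + 2 * M * eta * k%:R)) + 4 * (M * eta) ^+ 2 * k%:R) <= D ^+ 2 ->
  level true (q * k) (b + 4 * lam * M * eta * (D + zeta + 4 * M * eta * k%:R) / Num.sqrt k%:R)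
    (D + 2 * M * eta * k%:R).
Proof.
move=> k0 D0 zM b0 lev.
set inc := 2 * _ + _ => hinc t n x lot tn nk Zx xz p.
have lMe0 : 0 <= 2 * lam * M * eta by rewrite !mulr_ge0.
have Me n' : 0 <= M * eta * n'%:R by rewrite !mulr_ge0.
have inc0 : 0 <= inc.
  rewrite /inc !(addr_ge0, mulr_ge0) ?sqr_ge0 ?sqrtr_ge0 //; have := zeta_ge0; have := Me k; lra.
have pS s : (t <= s < t + n)%N -> p s.+1 = p s - w s *: hb (p s).
  by move=> sn; rewrite /p /= subSn /= ?subnKC //; natlia.
have pt : p t = x by rewrite /p track_start.
have boundary i : (i <= q)%N -> (i * k <= n)%N ->
    enorm (u (t + i * k)%N - p (t + i * k)%N) ^+ 2 <= zeta ^+ 2 + i%:R * inc.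
  elim: i => [|i IH] iq ik.
    rewrite addn0 pt mul0r addr0 ler_pXn2r ?nnegrE ?enorm_ge0 //.
    by rewrite enorm_distC.
  rewrite mulSn in ik; have {}IH := IH ltac:(natlia) ltac:(natlia).
  have dD : enorm (u (t + i * k)%N - p (t + i * k)%N) <= D.
    rewrite -(@ler_pXn2r _ 2) ?nnegrE ?enorm_ge0 // (le_trans IH) //.
    apply: le_trans hinc; rewrite lerD2l ler_wpM2r // ler_nat; natlia.
  have h1 := @window_noise _ _ _ _ t x (t + i * k)%N k D lev lot ltac:(natlia)
    ltac:(natlia) (leqnn k) Zx dD.
  have h2 := @descent_gap p (t + i * k)%N k ltac:(natlia) ltac:(natlia)
    (fun s sn => pS s ltac:(natlia)).
  rewrite mulSn (addnC k) addnA; apply: (le_trans h2).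
  rewrite -natr1; move: h1 IH; rewrite /inc; lra.
have near s : (t <= s <= t + n)%N -> enorm (u s - p s) <= D + 2 * M * eta * k%:R.
  move=> sn; pose i := ((s - t) %/ k)%N.
  have ik : (i * k <= s - t)%N by rewrite leq_divM.
  have iq : (i <= q)%N.
    by rewrite -(@leq_pmul2r k) //; natlia.
  have ski : (s - t < i * k + k)%N by rewrite addnC -mulSn ltn_ceil.
  have dD : enorm (u (t + i * k)%N - p (t + i * k)%N) <= D.
    rewrite -(@ler_pXn2r _ 2) ?nnegrE ?enorm_ge0 //.
    apply: le_trans (boundary i iq ltac:(natlia)) _.
    by apply: le_trans hinc; rewrite lerD2l ler_wpM2r // ler_nat.
  have e1 := @iterate_speed (t + i * k)%N (s - (t + i * k))%N ltac:(natlia) ltac:(natlia).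
  have e2 := @track_speed (Some t) x (t + i * k)%N (s - (t + i * k))%N ltac:(natlia) ltac:(natlia).
  rewrite subnKC in e1 e2; [|natlia..].
  have e3 : M * eta * (s - (t + i * k))%:R <= M * eta * k%:R.
    by rewrite ler_wpM2l ?mulr_ge0 // ler_nat; natlia.
  rewrite -/p in e2; rewrite enorm_distC in e2.
  have := ler_enorm_dist (u (t + i * k)%N) (u s) (p s).
  have := ler_enorm_dist (p (t + i * k)%N) (u (t + i * k)%N) (p s).
  lra.
split=> //; rewrite -sumrN.
set sk := Num.sqrt k%:R.
have kR : 0 < k%:R :> R by rewrite ltr0n.
have sk0 : 0 < sk by rewrite sqrtr_gt0.
have sk2 : sk * sk = k%:R by rewrite -expr2 sqr_sqrtr // ltW.
have ksk : k%:R / sk = sk by rewrite -sk2 mulfK // gt_eqF.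
(* A window within one block starts next to the net point itself, so [window_noise] is used with
   [zeta] as initial distance, and [sqrt n <= n] makes its cost linear in [n]. *)
have [nk'|kn] := leqP n k.
  have h1 := @window_noise _ _ _ _ t x t n zeta lev lot (leqnn _) tn nk' Zx.
  rewrite -/p pt enorm_distC in h1; have {}h1 := h1 xz.
  rewrite sumrN (le_trans h1) // [leRHS]mulrDl lerD2l.
  have sn : Num.sqrt n%:R <= sk by rewrite ler_wsqrtr // ler_nat.
  have [->|n0] := posnP n; first by rewrite sqrtr0 !mulr0 mul0r.
  have nR : 1 <= n%:R :> R by rewrite ler1n.
  have sn1 : Num.sqrt n%:R <= n%:R :> R.
    rewrite -(@ler_pXn2r _ 2) ?nnegrE ?sqrtr_ge0 ?ler0n // sqr_sqrtr ?ler0n //.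
    by rewrite expr2 ler_peMr ?ler0n.
  have sk1 : 1 <= sk by rewrite -(@sqrtr1 R) ler_wsqrtr // ler1n.
  rewrite (_ : 2 * lam * M * eta * Num.sqrt n%:R * _ =
    (2 * lam * M * eta) * (Num.sqrt n%:R * (zeta + zeta + 2 * M * eta * n%:R))); last ring.
  rewrite (_ : 4 * _ * _ * _ * _ / _ * _ =
    (2 * lam * M * eta) * (n%:R * (2 * ((D + zeta) / sk + 4 * (M * eta * (k%:R / sk)))))); last first.
    by field; rewrite gt_eqF.
  rewrite ler_wpM2l // ksk.
  have Me0 : 0 <= M * eta by rewrite mulr_ge0.
  have -> : Num.sqrt n%:R * (zeta + zeta + 2 * M * eta * n%:R) =
    Num.sqrt n%:R * (zeta + zeta) + n%:R * (2 * (M * eta) * Num.sqrt n%:R) by ring.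
  have a1 : Num.sqrt n%:R * (zeta + zeta) <= n%:R * (zeta + zeta) by rewrite ler_wpM2r // addr_ge0.
  rewrite (le_trans (lerD a1 (lexx _))) // -mulrDr ler_wpM2l ?ler0n //.
  have a2 : M * eta * Num.sqrt n%:R <= M * eta * sk by rewrite ler_wpM2l.
  have a3 : M * eta <= M * eta * sk by rewrite ler_peMr.
  have a4 : 0 <= (D + zeta) / sk by rewrite divr_ge0 ?addr_ge0 ?sqrtr_ge0.
  lra.
(* The cost of one block. The distance at its start is at most [D + 2 * M * eta * k], and
   [window_noise] adds the same drift again, hence the inner factor 4. The outer 4 of the statement
   comes from [n / k + 1 <= 2 * (n / k)]. *)
pose c := 2 * lam * M * eta * sk * (D + zeta + 4 * M * eta * k%:R).
have c0 : 0 <= c.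
  by rewrite /c mulr_ge0 ?mulr_ge0 ?sqrtr_ge0 //; have := zeta_ge0; have := Me k; lra.
have step t' n' : (t <= t')%N -> (t' + n' <= t + n)%N -> (n' <= k)%N ->
    \sum_(t' <= s < t' + n') - (w s * noise s (u s) (p s)) <= b * n'%:R + c.
  move=> tt' tn' nk'; rewrite sumrN.
  have := @window_noise _ _ _ _ t x t' n' _ lev lot tt' ltac:(natlia) nk' Zx (near t' ltac:(natlia)).
  move/le_trans; apply; rewrite lerD2l /c.
  have sn : Num.sqrt n'%:R <= sk by rewrite ler_wsqrtr // ler_nat.
  have nn : M * eta * n'%:R <= M * eta * k%:R by rewrite ler_wpM2l ?mulr_ge0 // ler_nat.
  apply: ler_pM; rewrite ?mulr_ge0 ?sqrtr_ge0 //; [by have := zeta_ge0; have := Me n'; have := Me k; lra| |lra].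
  by rewrite ler_wpM2l.
have := ler_sum_blocks _ _ _ _ _ _ k0 c0 step t n (leqnn t) (leqnn _).
move/le_trans; apply; rewrite [leRHS]mulrDl lerD2l.
have nk1 : 1 <= n%:R / k%:R :> R by rewrite ler_pdivlMr // mul1r ler_nat ltnW.
apply: (@le_trans _ _ (2 * (n%:R / k%:R) * c)).
  by rewrite ler_wpM2r //; lra.
rewrite /c le_eqVlt; apply/orP; left; apply/eqP.
by rewrite -sk2; field; rewrite gt_eqF.
Qed.

(** The comparator [z] is exchanged for a net point [z'] at the Lipschitz cost, after which [z'] and
    the reference path are both deterministic. *)
Lemma window_noise_fixed det k (b d : R) t n x z z' (c : R) : level det k b d ->
  (T0 <= t)%N -> (t + n <= T)%N -> (n <= k)%N -> Z x -> enorm (x - u t) <= zeta ->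
  Z z' -> enorm (z' - z) <= zeta -> 0 <= c ->
  (forall s, (t <= s < t + n)%N ->
     enorm (track (if det then Some t else None) x s - z') <= c) ->
  - (\sum_(t <= s < t + n) w s * noise s (u s) z) <=
  (b + 2 * M * eta * zeta) * n%:R + 2 * lam * M * eta * Num.sqrt n%:R * c.
Proof.
move=> lev lot tn nk Zx xz Zz' zz' c0 hc.
have [_] := lev t n x lot tn nk Zx xz; set p := track _ x in hc *.
have hd : \sum_(t <= s < t + n) w s * noise s (track None z' s) (p s) <=
    2 * lam * M * eta * Num.sqrt n%:R * c.
  apply: small_noise_unif => //; first by case: (det); rewrite /admissible //; natlia.
  by move=> s sn; rewrite enorm_distC hc.
have hz : \sum_(t <= s < t + n) w s * noise s z z' <= 2 * M * eta * zeta * n%:R.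
  apply: ler_sum_const => s sn; apply: weighted_noise_lip; first by natlia.
  by rewrite enorm_distC.
have -> : - (\sum_(t <= s < t + n) w s * noise s (u s) z) =
  - (\sum_(t <= s < t + n) w s * noise s (u s) (p s)) +
  ((\sum_(t <= s < t + n) w s * noise s (track None z' s) (p s)) +
  (\sum_(t <= s < t + n) w s * noise s z z')).
  rewrite -!sumrN -!big_split; apply: eq_bigr => s _ /=.
  by rewrite /noise; ring.
move: hd hz; lra.
Qed.

Lemma suffix_noise det k (b d B : R) z z' t n : level det k b d -> (0 < k)%N ->
  0 <= d -> (forall s, (T0 <= s <= T)%N -> enorm (u s - z) <= B) ->
  Z z' -> enorm (z' - z) <= zeta -> (T0 <= t)%N -> (t + n <= T)%N ->
  - (\sum_(t <= s < t + n) w s * noise s (u s) z) <=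
  (b + 2 * M * eta * zeta) * n%:R +
  (n%:R / k%:R + 1) * (2 * lam * M * eta * Num.sqrt k%:R * (d + B + zeta)).
Proof.
move=> lev k0 d0 hB Zz' zz' lot tn; rewrite -sumrN.
have B0 : 0 <= B by apply: le_trans (hB t ltac:(natlia)); exact: enorm_ge0.
have D0 : 0 <= d + B + zeta by rewrite !addr_ge0.
apply: (ler_sum_blocks _ T0 T) => //.
  by rewrite !mulr_ge0 ?sqrtr_ge0.
move=> t' n' lot' tn' nk; rewrite sumrN.
have [x Zx xz] := net t' ltac:(natlia).
have [hd _] := lev t' n' x lot' tn' nk Zx xz.
apply: (le_trans (window_noise_fixed _ _ _ _ _ _ _ z z' (d + B + zeta) lev
  lot' tn' nk Zx xz Zz' zz' D0 _)).
  move=> s sn; have := hd s ltac:(natlia); have := hB s ltac:(natlia).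
  set p := track _ _; rewrite (enorm_distC (u s) (p s)) (enorm_distC (u s)).
  rewrite enorm_distC in zz'.
  have := ler_enorm_dist (u s) (p s) z'; have := ler_enorm_dist z (u s) z'.
  by rewrite (enorm_distC z (u s)); move: zz'; lra.
rewrite lerD2l ler_wpM2r // ler_wpM2l ?mulr_ge0 // ler_wsqrtr // ler_nat //.
Qed.

(** The comparator is the first point of the window, so the net point near it is also the start of
    the reference path, which by then has moved at most [M * eta * n]. This second entry of the
    minimum is what makes the corrections of the last-iterate argument sum to order [sqrt eta]. For
    windows longer than [k] the cost per block is absorbed into the linear rate. *)
Lemma suffix_noise_self det k (b d B : R) t n : level det k b d -> (0 < k)%N ->
  0 <= d -> (forall s, (T0 <= s <= T)%N -> enorm (u s - u t) <= B) ->
  (T0 <= t)%N -> (t + n <= T)%N ->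
  - (\sum_(t <= s < t + n) w s * noise s (u s) (u t)) <=
  (b + 2 * M * eta * zeta + 4 * lam * M * eta * (d + B + zeta) / Num.sqrt k%:R) * n%:R +
  2 * lam * M * eta * Num.sqrt n%:R * Num.min (d + B + zeta) (M * eta * n%:R).
Proof.
move=> lev k0 d0 hB lot tn.
have [x Zx xz] := net t ltac:(natlia).
have B0 : 0 <= B by apply: le_trans (hB t ltac:(natlia)); exact: enorm_ge0.
have D0 : 0 <= d + B + zeta by rewrite !addr_ge0.
have lMe0 : 0 <= 2 * lam * M * eta by rewrite !mulr_ge0.
have kR : 0 < k%:R :> R by rewrite ltr0n.
have sk0 : 0 < Num.sqrt k%:R :> R by rewrite sqrtr_gt0.
have sk2 : Num.sqrt k%:R * Num.sqrt k%:R = k%:R :> R by rewrite -expr2 sqr_sqrtr // ltW.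
have m0 : 0 <= Num.min (d + B + zeta) (M * eta * n%:R).
  by rewrite le_min D0 !mulr_ge0.
have [nk|kn] := leqP n k.
  have [hd _] := lev t n x lot tn nk Zx xz.
  apply: (le_trans (window_noise_fixed _ _ _ _ _ _ _ (u t) x _ lev
    lot tn nk Zx xz Zx xz m0 _)).
    move=> s sn; rewrite le_min; apply/andP; split.
      have := hd s ltac:(natlia); have := hB s ltac:(natlia).
      set p := track _ _; rewrite (enorm_distC (u s) (p s)).
      rewrite enorm_distC in xz.
      have := ler_enorm_dist (u s) (p s) x; have := ler_enorm_dist (u t) (u s) x.
      by move: xz; lra.
    have e2 := @track_speed (if det then Some t else None) x t (s - t)%N ltac:(natlia) ltac:(natlia).
    rewrite (track_start _ _ t) in e2; last by case: (det).
    rewrite subnKC in e2; last by natlia.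
    by rewrite (le_trans e2) // ler_wpM2l ?mulr_ge0 // ler_nat; natlia.
  rewrite lerD2r ler_wpM2r ?ler0n // lerDl divr_ge0 ?sqrtr_ge0 //.
  by rewrite mulr_ge0 // !mulr_ge0.
apply: (le_trans (suffix_noise _ _ _ _ _ _ x t n lev k0 d0 hB Zx xz lot tn)).
rewrite (mulrDl (b + 2 * M * eta * zeta)) -[leRHS]addrA lerD2l.
apply: (@le_trans _ _ (4 * lam * M * eta * (d + B + zeta) / Num.sqrt k%:R * n%:R)); last first.
  by rewrite lerDl mulr_ge0 // mulr_ge0 ?sqrtr_ge0.
have nk1 : 1 <= n%:R / k%:R :> R by rewrite ler_pdivlMr // mul1r ler_nat ltnW.
apply: (@le_trans _ _ (2 * (n%:R / k%:R) *
    (2 * lam * M * eta * Num.sqrt k%:R * (d + B + zeta)))).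
  by rewrite ler_wpM2r //; [rewrite mulr_ge0 // mulr_ge0 ?sqrtr_ge0 | lra].
move: sk0 sk2; set sk := Num.sqrt k%:R => sk0 sk2.
rewrite le_eqVlt; apply/orP; left; apply/eqP.
by rewrite -sk2; field; rewrite gt_eqF.
Qed.

(** The telescoping estimate of subgradient descent, run with the sampled objectives; passing to the
    mean objective costs exactly the noise. *)
Lemma suffix_regret t n z : (T0 <= t)%N -> (t + n <= T)%N ->
  \sum_(t <= s < t + n) w s * (Phib (u s) - Phib z) <=
  enorm (u t - z) ^+ 2 / 2 + (M * eta) ^+ 2 * n%:R / 2 -
  \sum_(t <= s < t + n) w s * noise s (u s) z.
Proof.
move=> lot tn.
suff : 2 * (\sum_(t <= s < t + n) w s * (Phib (u s) - Phib z)) +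
    enorm (u (t + n)%N - z) ^+ 2 <= enorm (u t - z) ^+ 2 + (M * eta) ^+ 2 * n%:R -
    2 * \sum_(t <= s < t + n) w s * noise s (u s) z.
  by have := sqr_ge0 (enorm (u (t + n)%N - z)); lra.
elim: n tn => [|n IH] tn.
  by rewrite addn0 !big_geq // !mulr0 subr0 addr0 add0r.
have {}IH := IH ltac:(natlia).
rewrite addnS !big_nat_recr /=; [|natlia..].
set s := (t + n)%N in IH *.
have sT : (T0 <= s < T)%N by natlia.
have /andP[w0 we] := w_bnd _ sT.
rewrite uS // (_ : u s - w s *: h s - z = (u s - z) - w s *: h s); last first.
  by apply/rowP => i; rewrite !mxE; ring.
rewrite (sqr_enormB (u s - z)) enormZ exprMn ger0_norm // dotvZr.
have e2 : w s * (Phib (u s) - Phib z + noise s (u s) z) <= w s * dotv (u s - z) (h s).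
  rewrite ler_wpM2l //; have := h_sub _ sT z.
  by rewrite -(opprB (u s) z) dotvNr dotvC /noise; lra.
have e3 : w s ^+ 2 * enorm (h s) ^+ 2 <= (M * eta) ^+ 2.
  rewrite -exprMn mulrC ler_pXn2r ?nnegrE ?mulr_ge0 ?enorm_ge0 //.
  by rewrite ler_pM ?enorm_ge0 // h_bnd.
rewrite -natr1; move: IH e2 e3; lra.
Qed.


(** The constant [c] compares the largest with the smallest step. The corrections split into a
    harmonic sum, giving [1 + ln n], and a sum treated by [sum_min_le], giving [sqrt eta]. The rest
    of [4 + ln n] is one [P] for the average over the whole window and two for the final step. *)
Lemma last_iterate_error det k (b d B c : R) ustar zstar :
  level det k b d -> (0 < k)%N -> 0 <= b -> 0 <= d -> 0 < eta <= 1 -> 1 <= c ->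
  (T0 + k <= T)%N -> (forall s, (T0 <= s < T)%N -> eta <= c * w s) ->
  (forall s, (T0 <= s <= T)%N -> enorm (u s - ustar) <= B) ->
  Z zstar -> enorm (zstar - ustar) <= zeta ->
  forall n D P : R, n = (T - T0)%:R -> D = d + 2 * B + zeta ->
  P = M ^+ 2 * eta / 2 + b / eta + 2 * M * zeta + 4 * lam * M * D / Num.sqrt k%:R ->
  Phib (u T) - Phib ustar <= c ^+ 2 * (B ^+ 2 / (2 * eta * n) + P * (4 + ln n) +
     4 * lam * M * (2 * M + 6 * D) * Num.sqrt eta).
Proof.
move=> lev k0 b0 d0 /andP[e0 e1] c1 kT wlow hB Zz zz n D P nE DE PE.
have T0T : (T0 < T)%N by natlia.
have n0 : 0 < n by rewrite nE ltr0n; natlia.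
have c0 : 0 < c by apply: lt_le_trans c1.
have B0 : 0 <= B by apply: le_trans (hB T ltac:(natlia)); exact: enorm_ge0.
have D0 : 0 <= D by rewrite DE !addr_ge0 // mulr_ge0.
have lM0 : 0 <= lam * M by rewrite mulr_ge0.
have sk0 := @sqrt_gt0_nat R k k0.
have P1 : 0 <= M ^+ 2 * eta by rewrite mulr_ge0 // sqr_ge0.
have P2 : 0 <= b / eta by rewrite divr_ge0.
have P3 : 0 <= 2 * M * zeta by rewrite !mulr_ge0.
have P4 : 0 <= 4 * lam * M * D / Num.sqrt k%:R.
  by rewrite divr_ge0 ?sqrtr_ge0 // !mulr_ge0.
have P0 : 0 <= P by rewrite PE; lra.
pose phi s := Phib (u s) - Phib ustar.
pose W t := \sum_(t <= s < T) w s.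
pose S t := \sum_(t <= s < T) w s * phi s.
(* The sum of [suffix_regret] and [suffix_noise_self] for the comparator [u t], whose initial
   distance term vanishes. *)
pose K t := eta * (P * (T - t)%:R + 2 * lam * M * Num.sqrt (T - t)%:R *
  Num.min D (M * eta * (T - t)%:R)).
have w0 s : (T0 <= s < T)%N -> 0 < w s.
  by move=> sT; rewrite -(pmulr_rgt0 _ c0) (lt_le_trans e0) // wlow.
have Wlow t : (T0 <= t <= T)%N -> eta * (T - t)%:R <= c * W t.
  move=> tT; have -> : eta * (T - t)%:R = \sum_(t <= s < T) eta.
    by rewrite sumr_const_nat mulr_natr.
  by rewrite /W mulr_sumr; apply: ler_sum_nat => s sn; apply: wlow; natlia.
have hS t : (T0 <= t < T.-1)%N -> S t <= W t * phi t + K t.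
  move=> tT; have e : (t + (T - t) = T)%N by natlia.
  have := @suffix_regret t (T - t)%N (u t) ltac:(natlia) ltac:(natlia).
  have := suffix_noise_self _ _ _ _ (2 * B) t (T - t)%N lev k0 d0 _ ltac:(natlia) ltac:(natlia).
  rewrite e subrr enorm0 => hn hr.
  have {}hn := hn ltac:(move=> s sT; rewrite (le_trans (ler_enorm_dist ustar _ _)) //
     mulr_natl mulr2n lerD ?hB // 1?enorm_distC ?hB //; natlia).
  rewrite -DE in hn.
  have -> : S t = W t * phi t + \sum_(t <= s < T) w s * (Phib (u s) - Phib (u t)).
    rewrite /S /W mulr_suml -big_split; apply: eq_bigr => s _ /=.
    by rewrite /phi; ring.
  rewrite lerD2l; apply: (le_trans hr).
  rewrite (_ : K t = (M * eta) ^+ 2 * (T - t)%:R / 2 +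
    ((b + 2 * M * eta * zeta + 4 * lam * M * eta * D / Num.sqrt k%:R) * (T - t)%:R +
     2 * lam * M * eta * Num.sqrt (T - t)%:R * Num.min D (M * eta * (T - t)%:R))); last first.
    by rewrite /K PE; field; rewrite !gt_eqF.
  by rewrite expr0n /= mul0r add0r lerD2l.
have := last_iterate_le_average w phi K T T0 T0T w0 hS.
rewrite -/(S T0) -/(W T0) => havg.
have W0 t : (T0 <= t < T)%N -> 0 < W t.
  move=> tT; rewrite -(pmulr_rgt0 _ c0) (lt_le_trans _ (Wlow t _)) //; last natlia.
  by rewrite mulr_gt0 // ltr0n; natlia.
have hS0 : S T0 / W T0 <= c * (B ^+ 2 / (2 * eta * n) + P).
  have e : (T0 + (T - T0) = T)%N by natlia.
  have := @suffix_regret T0 (T - T0)%N ustar (leqnn _) ltac:(natlia).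
  have := suffix_noise _ _ _ _ B ustar zstar T0 (T - T0)%N lev k0 d0 hB Zz zz (leqnn _) ltac:(natlia).
  rewrite e -nE => hn hr.
  have hq : S T0 <= B ^+ 2 / 2 + eta * n * P.
    apply: (le_trans hr).
    have h1 : enorm (u T0 - ustar) ^+ 2 <= B ^+ 2.
      by rewrite ler_pXn2r ?nnegrE ?enorm_ge0 // hB //; natlia.
    have nk : 1 <= n / k%:R by rewrite nE ler_pdivlMr ?ltr0n // mul1r ler_nat; natlia.
    have lMe0 : 0 <= 2 * lam * M * eta by rewrite !mulr_ge0 // ltW.
    have h2 : (n / k%:R + 1) * (2 * lam * M * eta * Num.sqrt k%:R * (d + B + zeta)) <=
        2 * (n / k%:R) * (2 * lam * M * eta * Num.sqrt k%:R * D).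
      apply: ler_pM => //.
      - by lra.
      - by rewrite !mulr_ge0 // ?sqrtr_ge0 // ?(ltW e0) // !addr_ge0.
      - by lra.
      by rewrite ler_wpM2l ?mulr_ge0 ?sqrtr_ge0 // DE; lra.
    have -> : eta * n * P = (M * eta) ^+ 2 * n / 2 + (b + 2 * M * eta * zeta) * n +
       2 * (n / k%:R) * (2 * lam * M * eta * Num.sqrt k%:R * D).
      have kk := @sqr_sqrt_nat R k.
      rewrite PE; move: sk0 kk; set sk := Num.sqrt k%:R => sk0' kk; rewrite -kk.
      by field; rewrite !gt_eqF.
    move: h1 h2 hn; lra.
  rewrite ler_pdivrMr ?W0 //; last natlia.
  apply: (le_trans hq).
  rewrite (_ : B ^+ 2 / 2 + eta * n * P = (B ^+ 2 / (2 * eta * n) + P) * (eta * n)); last first.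
    by field; rewrite !gt_eqF.
  rewrite [leRHS](_ : _ = (B ^+ 2 / (2 * eta * n) + P) * (c * W T0)); last ring.
  apply: ler_wpM2l; last by rewrite nE; apply: Wlow; natlia.
  by rewrite addr_ge0 // divr_ge0 ?sqr_ge0 // ltW // !mulr_gt0.
pose F (j : nat) : R := P * j%:R^-1 + 4 * lam * M * (Num.min D (M * eta * j%:R) / (j%:R * Num.sqrt j%:R)).
have hterm t : (T0 <= t < T.-1)%N -> w t * K t / (W t * W t.+1) <= c ^+ 2 * F (T - t.+1)%N.
  move=> tT; set j := (T - t.+1)%N.
  have j0 : (0 < j)%N by natlia.
  have ej : (T - t = j.+1)%N by natlia.
  have jR : 0 < j%:R :> R by rewrite ltr0n.
  have j1R : 0 < j.+1%:R :> R by rewrite ltr0n.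
  have sj0 := @sqrt_gt0_nat R j j0; have sj10 := @sqrt_gt0_nat R j.+1 isT.
  have Wt := W0 t ltac:(natlia); have Wt1 := W0 t.+1 ltac:(natlia).
  have /andP[_ we] : 0 <= w t <= eta by apply: w_bnd; natlia.
  have wt := w0 t ltac:(natlia).
  have m0 x : 0 <= x -> 0 <= Num.min D (M * eta * x).
    by move=> x0; rewrite le_min D0 !mulr_ge0 // ltW.
  have K0 : 0 <= K t.
    by rewrite /K mulr_ge0 ?(ltW e0) // addr_ge0 ?mulr_ge0 ?sqrtr_ge0 ?m0.
  have hW : (eta * j.+1%:R) * (eta * j%:R) <= c ^+ 2 * (W t * W t.+1).
    have -> : c ^+ 2 * (W t * W t.+1) = (c * W t) * (c * W t.+1) by ring.
    apply: ler_pM; rewrite ?mulr_ge0 ?(ltW e0) //.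
      by rewrite -ej Wlow //; natlia.
    by rewrite Wlow //; natlia.
  rewrite ler_pdivrMr ?mulr_gt0 //.
  have hmin : Num.min D (M * eta * j.+1%:R) <= 2 * Num.min D (M * eta * j%:R).
    rewrite minr_pMr // le_min !ge_min; apply/andP; split.
      by apply/orP; left; rewrite ler_peMl //; lra.
    apply/orP; right; rewrite mulrCA ler_wpM2l ?mulr_ge0 ?(ltW e0) // -natrM ler_nat; natlia.
  apply: (@le_trans _ _ (eta * K t)); first by rewrite ler_wpM2r.
  have hKF : eta * K t <= F j * ((eta * j.+1%:R) * (eta * j%:R)).
    rewrite (_ : _ * (_ * _) = eta * (eta * (P * j.+1%:R + 4 * lam * M * (Num.min D (M * eta * j%:R) / Num.sqrt j%:R) * j.+1%:R))); last first.
      by rewrite /F; field; rewrite !gt_eqF.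
    rewrite /K ej !ler_wpM2l ?(ltW e0) // lerD2l.
    rewrite (_ : 4 * lam * M * _ * _ = 2 * (lam * M) * (2 * Num.min D (M * eta * j%:R)) * (j.+1%:R / Num.sqrt j%:R)); last first.
      by field; rewrite !gt_eqF.
    rewrite (_ : 2 * lam * M * _ * _ = 2 * (lam * M) * Num.min D (M * eta * j.+1%:R) * Num.sqrt j.+1%:R); last ring.
    apply: ler_pM; rewrite ?mulr_ge0 ?sqrtr_ge0 ?m0 //.
      by rewrite ler_wpM2l // mulr_ge0.
    rewrite ler_pdivlMr // -[leRHS](sqr_sqrt_nat j.+1) expr2.
    by rewrite ler_wpM2l ?sqrtr_ge0 // ler_wsqrtr // ler_nat.
  apply: (le_trans hKF); rewrite [leRHS](_ : _ = F j * (c ^+ 2 * (W t * W t.+1))); last ring.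
  rewrite ler_wpM2l //.
  apply: addr_ge0; first by rewrite mulr_ge0 // invr_ge0 ltW.
  apply: mulr_ge0; first by rewrite -mulrA mulr_ge0.
  by rewrite divr_ge0 ?m0 ?mulr_ge0 ?sqrtr_ge0 ?(ltW jR).
have hsum : \sum_(T0 <= t < T.-1) w t * K t / (W t * W t.+1) <=
    c ^+ 2 * (P * (1 + ln n) + 4 * lam * M * (2 * M + 6 * D) * Num.sqrt eta).
  apply: (le_trans (ler_sum_nat hterm)).
  rewrite -mulr_sumr ler_wpM2l ?sqr_ge0 //.
  have -> : \sum_(T0 <= t < T.-1) F (T - t.+1)%N = \sum_(1 <= j < T - T0) F j.
    rewrite -{1}[T0]add0n big_addn big_nat_rev -{1}[1%N]add0n big_addn.
    rewrite (_ : (T.-1 - T0 = T - T0 - 1)%N); last natlia.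
    by apply: eq_big_nat => i iT; congr F; natlia.
  rewrite big_split /= -!mulr_sumr lerD //.
    by rewrite nE ler_wpM2l // ler_harmonic //; natlia.
  rewrite -!mulrA !ler_wpM2l //.
  by apply: sum_min_le; rewrite ?e0.
(* The weighted averages stop at [u T.-1]; the last step moves the iterate by at most [M * eta]. *)
have hlast : Phib (u T) - Phib ustar <= phi T.-1 + M ^+ 2 * eta.
  have /ler_normlW h1 := Phib_lip (u T) (u T.-1).
  have h2 := @iterate_speed T.-1 1 ltac:(natlia) ltac:(natlia).
  rewrite addn1 prednK ?mulr1 in h2; last natlia.
  have := ler_wpM2l M_ge0 h2; rewrite /phi expr2; move: h1; lra.
have cc : c <= c ^+ 2 by rewrite expr2 ler_peMl // ltW.
have q0 : 0 <= B ^+ 2 / (2 * eta * n) by rewrite divr_ge0 ?sqr_ge0 // ltW // !mulr_gt0.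
have f1 := ler_wpM2r (addr_ge0 q0 P0) cc.
have f2 : 1 * (2 * P) <= c ^+ 2 * (2 * P).
  by rewrite ler_wpM2r ?mulr_ge0 // (le_trans c1).
have f3 : M ^+ 2 * eta <= 2 * P by rewrite PE; lra.
move: hlast havg hS0 hsum f1 f2 f3; lra.
Qed.
End Tracking.

(** * Expectations of products of independent factors *)

Section Independence.
Context {R : realType} {d} {Om : measurableType d} {P : probability Om R}.
Context {dX} {X : measurableType dX}.
Import HBNNSimple.

(** Simple functions increase to [phi]. On the right-hand side [G] enters only through its integrals
    over events of [Y], so two weights with the same such integrals can be exchanged. *)
Lemma integral_mul_comp_lim (Y : Om -> X) (G : Om -> R) (phi : X -> R)
    (mphi : measurable_fun setT (EFin \o phi : X -> \bar R)) :
  measurable_fun setT Y -> measurable_fun setT G -> (forall w, 0 <= G w) ->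
  (forall x, 0 <= phi x) ->
  (\int[P]_w (G w * phi (Y w))%:E =
  limn (fun n => \sum_(k \in range (nnsfun_approx measurableT mphi n))
    (k%:E * \int[P]_w (G w * \1_(nnsfun_approx measurableT mphi n @^-1` [set k]) (Y w))%:E)))%E.
Proof.
move=> mY mG G0 phi0; set f_ := nnsfun_approx measurableT mphi.
have mf n : measurable_fun setT (fun w => G w * f_ n (Y w)).
  by apply: measurable_funM => //; apply: measurableT_comp.
transitivity (limn (fun n => \int[P]_w (G w * f_ n (Y w))%:E)%E).
  rewrite -monotone_convergence//.
  - apply: eq_integral => w _; apply/esym/cvg_lim => //.
    under eq_fun do rewrite EFinM.
    rewrite EFinM; apply: cvgeZl => //.
    exact: (@cvg_nnsfun_approx _ _ _ _ measurableT _ mphi (fun x _ => phi0 x) (Y w)).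
  - by move=> n; exact/measurable_EFinP.
  - by move=> n w _; rewrite lee_fin mulr_ge0.
  - move=> w _ m n mn; rewrite lee_fin ler_wpM2l //.
    exact/lefP/nd_nnsfun_approx.
congr (limn _); apply/funext => n.
have mI k : measurable_fun setT (fun w => G w * \1_(f_ n @^-1` [set k]) (Y w)).
  by apply: measurable_funM => //; apply: measurableT_comp.
transitivity (\sum_(k \in range (f_ n))
    \int[P]_w (k%:E * (G w * \1_(f_ n @^-1` [set k]) (Y w))%:E))%E.
  rewrite -ge0_integral_fsum //; last 2 first.
  - by move=> k; apply/measurable_EFinP; apply: measurable_funM.
  - move=> k w _; rewrite -EFinM lee_fin mulrCA mulr_ge0 //.
    exact: nnfun_muleindic_ge0.
  apply: eq_integral => w _; rewrite fsumEFin //; congr EFin.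
  rewrite fimfunE mulrC fsbig_finite // fsbig_finite // mulr_suml /=.
  by apply: eq_bigr => k _; rewrite -mulrA (mulrC (\1_ _ _)).
apply: eq_fsbigr => k /[!inE] -[x _ <-].
rewrite ge0_integralZl_EFin //.
- by move=> w _; rewrite lee_fin mulr_ge0.
- exact/measurable_EFinP.
Qed.

Lemma integral_mul_comp_eq (Y : Om -> X) (G1 G2 : Om -> R) (phi : X -> R) :
  measurable_fun setT phi -> (forall x, 0 <= phi x) -> measurable_fun setT Y ->
  measurable_fun setT G1 -> (forall w, 0 <= G1 w) ->
  measurable_fun setT G2 -> (forall w, 0 <= G2 w) ->
  (forall B, measurable B ->
    \int[P]_w (G1 w * \1_B (Y w))%:E = \int[P]_w (G2 w * \1_B (Y w))%:E)%E ->
  (\int[P]_w (G1 w * phi (Y w))%:E = \int[P]_w (G2 w * phi (Y w))%:E)%E.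
Proof.
move=> mphi phi0 mY mG1 G10 mG2 G20 h.
have mphi' : measurable_fun setT (EFin \o phi : X -> \bar R) by exact/measurable_EFinP.
rewrite !(integral_mul_comp_lim _ _ _ mphi') //; congr (limn _); apply/funext => n.
apply: eq_fsbigr => k _; rewrite h //; exact: measurable_sfunP.
Qed.

(** Independence is known for events only. In the induction [j] counts the factors that may be
    arbitrary, the others being indicators; each step frees one more. *)
Lemma integral_prod_indep (Y : nat -> Om -> X) (T : nat) :
  (forall t, (t < T)%N -> measurable_fun setT (Y t)) -> indep_family P Y T ->
  forall (phi : nat -> X -> R) (m : nat -> R),
  (forall t, (t < T)%N -> measurable_fun setT (phi t)) ->
  (forall t x, (t < T)%N -> 0 <= phi t x) ->
  (forall t, (t < T)%N -> \int[P]_w (phi t (Y t w))%:E = (m t)%:E)%E ->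
  (\int[P]_w (\prod_(t < T) phi t (Y t w))%:E = (\prod_(t < T) m t)%:E)%E.
Proof.
move=> mY ind.
suff claim j : (j <= T)%N -> forall (phi : nat -> X -> R) (m : nat -> R),
    (forall t, (t < T)%N -> measurable_fun setT (phi t)) ->
    (forall t x, (t < T)%N -> 0 <= phi t x) ->
    (forall t, (t < T)%N -> \int[P]_w (phi t (Y t w))%:E = (m t)%:E)%E ->
    (forall t, (j <= t < T)%N -> exists2 A, measurable A & phi t = \1_A) ->
    (\int[P]_w (\prod_(t < T) phi t (Y t w))%:E = (\prod_(t < T) m t)%:E)%E.
  by move=> phi m mphi phi0 pm; apply: (claim T) => // t; natlia.
elim: j => [|j IH] jT phi m mphi phi0 pm pA.
  have {}pA t : exists A, measurable A /\ ((t < T)%N -> phi t = \1_A).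
    have [tT|_] := boolP (t < T)%N; last by exists set0; split.
    by have [A mA ->] := pA t tT; exists A.
  have [A hA] := choice pA.
  have mA t := (hA t).1.
  have e : (fun w => \prod_(t < T) phi t (Y t w)) =
      \1_(\bigcap_(t in `I_T) (Y t @^-1` A t)) :> (Om -> R).
    apply/funext => w; rewrite indicE; case: (boolP (w \in _)) => [|] /=.
      rewrite inE => hw; apply: big1 => t _.
      by rewrite (hA t).2 // indicE mem_set //; apply: hw => /=.
    rewrite notin_setE => hw.
    have [t tT nA] : exists2 t, (t < T)%N & ~ A t (Y t w).
      by apply: contrapT => h; apply: hw => t /= tT; apply: contrapT => nA; apply: h; exists t.
    rewrite (bigD1 (Ordinal tT)) //= (hA t).2 // indicE memNset ?mul0r //.
  have mYA t : (t < T)%N -> measurable (Y t @^-1` A t).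
    by move=> tT; rewrite -[X in measurable X]setTI; apply: mY.
  have mcap : measurable (\bigcap_(t in `I_T) (Y t @^-1` A t)).
    by apply: bigcap_measurableType => t /= tT; apply: mYA.
  rewrite (eq_integral (fun w => (\1_(\bigcap_(t in `I_T) (Y t @^-1` A t)) w)%:E)); last first.
    by move=> w _; rewrite -e.
  rewrite integral_indic // setIT -prodEFin; apply: (eq_trans (ind A mA)); apply: eq_bigr => t _.
  rewrite -pm // (eq_integral (fun w => (\1_(Y t @^-1` A t) w)%:E)).
    by rewrite integral_indic ?setIT //; exact: mYA.
  by move=> w _; rewrite (hA t).2 // !indicE.
pose jo := Ordinal jT.
pose G w := \prod_(t < T | t != jo) phi t (Y t w).
pose kap := \prod_(t < T | t != jo) m t.
have mG : measurable_fun setT G.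
  rewrite /G; under eq_fun do rewrite -big_filter.
  apply: measurable_prod => t _; apply: measurableT_comp; [exact: mphi|exact: mY].
have G0 w : 0 <= G w by apply: prodr_ge0 => t _; apply: phi0.
have m0 t : (t < T)%N -> 0 <= m t.
  move=> tT; rewrite -lee_fin -pm //; apply: integral_ge0 => w _.
  by rewrite lee_fin phi0.
have kap0 : 0 <= kap by apply: prodr_ge0 => t _; apply: m0.
(* With an indicator as factor [j] the induction hypothesis applies: on events of [Y j] the weight
   [G] acts like the constant [kap]. [integral_mul_comp_eq] extends this to [phi j]. *)
have upd (psi : X -> R) c : measurable_fun setT psi -> (forall x, 0 <= psi x) ->
    (\int[P]_w (psi (Y j w))%:E = c%:E)%E -> (exists2 A, measurable A & psi = \1_A) ->
    (\int[P]_w (G w * psi (Y j w))%:E = (kap * c)%:E)%E.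
  move=> mpsi psi0 hc hA.
  have := IH (ltnW jT) (fun t => if t == j then psi else phi t)
    (fun t => if t == j then c else m t).
  rewrite (bigD1 jo) //= eqxx mulrC.
  rewrite (eq_bigr (fun t : 'I_T => m t)); last by move=> t /negbTE tj; rewrite -val_eqE /= in tj; rewrite tj.
  move=> <-; last first.
  - move=> t tT; case: eqP => [_ //|/eqP tj]; apply: pA; natlia.
  - by move=> t tT; case: eqP => [->//|_]; apply: pm.
  - by move=> t x tT; case: eqP => [_ //|_]; apply: phi0.
  - by move=> t tT; case: eqP => [_ //|_]; apply: mphi.
  apply: eq_integral => w _; congr EFin; rewrite (bigD1 jo) //= eqxx mulrC; congr (_ * _).
  by apply: eq_bigr => t /negbTE tj; rewrite -val_eqE /= in tj; rewrite tj.
rewrite (eq_integral (fun w => (G w * phi j (Y j w))%:E)); last first.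
  by move=> w _; congr EFin; rewrite (bigD1 jo) //= mulrC.
rewrite (bigD1 jo) //= -/kap.
rewrite (integral_mul_comp_eq (Y j) G (cst kap)) //; last 4 first.
- exact: mphi.
- by move=> x; apply: phi0.
- exact: mY.
- move=> B mB.
  have mYB : measurable (Y j @^-1` B) by rewrite -[X in measurable X]setTI; apply: mY.
  have PB : (\int[P]_w (\1_B (Y j w))%:E = P (Y j @^-1` B))%E.
    rewrite (eq_integral (fun w => (\1_(Y j @^-1` B) w)%:E)).
      by rewrite integral_indic ?setIT.
    by move=> w _; rewrite !indicE.
  rewrite (upd \1_B (fine (P (Y j @^-1` B)))) //; last 2 first.
  - by rewrite PB fineK // fin_num_measure.
  - by exists B.
  under eq_integral do rewrite EFinM.
  rewrite ge0_integralZl_EFin //; last first.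
    by apply/measurable_EFinP; apply: measurableT_comp => //; exact: mY.
  by rewrite PB EFinM fineK // fin_num_measure.
under eq_integral do rewrite EFinM.
rewrite ge0_integralZl_EFin //; last 2 first.
- by move=> w _; rewrite lee_fin phi0.
- by apply/measurable_EFinP; apply: measurableT_comp; [exact: mphi|exact: mY].
by rewrite pm // -EFinM mulrC.
Qed.

End Independence.

(** * Hoeffding's inequality and the union bound *)

Section Tail.
Context {R : realType}.

(** The linear term vanishes under a centred expectation and leaves a sub-Gaussian bound. The 2 in
    the exponent is cruder than Hoeffding's [1/2], which is why the tail below is [lam ^+ 2 / 8]. *)
Lemma ler_expR_sqr (y : R) : expR y <= y + expR (2 * y ^+ 2).
Proof.
have h2 := expR_ge1Dx (2 * y ^+ 2).
have [y1|y1] := leP y (- (1 / 2)).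
  have e1 : expR y <= 1 by rewrite expR_le1; lra.
  have : 0 <= (- y) * (- y - 1 / 2) by rewrite mulr_ge0; lra.
  by move: h2 e1; lra.
have [y2|y2] := leP y (1 / 2); last first.
  have : expR y <= expR (2 * y ^+ 2).
    rewrite ler_expR; have : 0 <= y * (y - 1 / 2) by rewrite mulr_ge0; lra.
    lra.
  lra.
have h3 := expR_ge1Dx (- y).
have p : 0 < 1 - y by lra.
have e0 := expR_gt0 y.
have : expR y * (1 - y) <= 1.
  by rewrite -[leRHS](expRxMexpNx_1 y) ler_wpM2l ?expR_ge0.
rewrite -ler_pdivlMr // div1r => e1.
have e2 : (1 - y)^-1 <= 1 + y + 2 * y ^+ 2.
  rewrite -div1r ler_pdivrMr //.
  have : 0 <= y ^+ 2 * (1 - 2 * y) by rewrite mulr_ge0 ?sqr_ge0; lra.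
  lra.
lra.
Qed.

Context {d} {Om : measurableType d} {P : probability Om R}.

Lemma integral_expR_le (Z : Om -> R) (c th : R) :
  measurable_fun setT Z -> (forall w, `|Z w| <= c) -> (\int[P]_w (Z w)%:E = 0)%E ->
  (\int[P]_w (expR (th * Z w))%:E <= (expR (2 * th ^+ 2 * c ^+ 2))%:E)%E.
Proof.
move=> mZ Zc Z0.
have c0 : 0 <= c by apply: le_trans (Zc point).
have iZ : P.-integrable setT (EFin \o Z).
  apply: measurable_bounded_integrable => //; first by rewrite [X in (X < _)%E]probability_setT ltry.
  exists c; split; first exact: num_real.
  by move=> x cx w _; apply: (le_trans (Zc w)); exact: ltW.
pose C := expR (2 * th ^+ 2 * c ^+ 2).
have ic : P.-integrable setT (EFin \o cst C) by apply: finite_measure_integrable_cst.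
have -> : (C%:E = \int[P]_w (th%:E * (Z w)%:E + C%:E))%E.
  rewrite integralD //; last exact: integrableZl.
  rewrite integralZl // Z0 mule0 add0e integral_cst //.
  by rewrite [X in (_ * X)%E]probability_setT mule1.
apply: ge0_le_integral => //.
- by apply/measurable_EFinP; apply: measurableT_comp => //; apply: measurable_funM.
- apply: emeasurable_funD => //.
  by apply/measurable_EFinP; apply: measurable_funM.
move=> w _; rewrite -EFinM -EFinD lee_fin (le_trans (ler_expR_sqr _)) // lerD2l.
rewrite ler_expR exprMn mulrA ler_wpM2l //; first by rewrite pmulr_rge0 ?sqr_ge0.
by rewrite -[leLHS]real_normK ?num_real // ler_pXn2r ?nnegrE.
Qed.

Context {dX} {X : measurableType dX}.

Lemma hoeffding (Y : nat -> Om -> X) (T : nat) (g : nat -> X -> R) (c : nat -> R) (lam : R) :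
  (forall t, (t < T)%N -> measurable_fun setT (Y t)) -> indep_family P Y T ->
  (forall t, (t < T)%N -> measurable_fun setT (g t)) ->
  (forall t x, (t < T)%N -> `|g t x| <= c t) ->
  (forall t, (t < T)%N -> \int[P]_w (g t (Y t w))%:E = 0)%E -> 0 <= lam ->
  (P [set w | (lam * Num.sqrt (\sum_(t < T) c t ^+ 2) < \sum_(t < T) g t (Y t w))%R] <=
   (expR (- (lam ^+ 2 / 8)))%:E)%E.
Proof.
move=> mY ind mg gc g0 lam0.
set V := \sum_(t < T) c t ^+ 2; set S := fun w => \sum_(t < T) g t (Y t w).
have V0 : 0 <= V by apply: sumr_ge0 => t _; rewrite sqr_ge0.
(* If [V] vanishes, so do all summands, and the exponent [th] below could not be formed. *)
have [V00|Vn0] := eqVneq V 0.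
  rewrite [X in P X](_ : _ = set0) ?measure0 ?lee_fin ?expR_ge0 //.
  apply/seteqP; split => // w /=.
  rewrite V00 sqrtr0 mulr0 ltNge => /negP; apply.
  rewrite /S big1 // => t _; apply/eqP; rewrite -normr_le0.
  rewrite (le_trans (gc _ _ (ltn_ord t))) //.
  have : c t ^+ 2 == 0.
    move: V00 => /eqP; rewrite psumr_eq0 => [/allP/(_ t)|i _]; last exact: sqr_ge0.
    by rewrite mem_index_enum => /(_ isT).
  by rewrite sqrf_eq0 => /eqP ->.
have Vp : 0 < V by rewrite lt_neqAle eq_sym Vn0.
have sV : 0 < Num.sqrt V by rewrite sqrtr_gt0.
have sVV : Num.sqrt V ^+ 2 = V by rewrite sqr_sqrtr.
(* The minimizer of [2 * th ^+ 2 * V - th * a], with minimum [- lam ^+ 2 / 8]. *)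
pose th := lam / (4 * Num.sqrt V).
have th0 : 0 <= th by rewrite divr_ge0 // mulr_ge0 // ltW.
pose a := lam * Num.sqrt V.
have mgY t : (t < T)%N -> measurable_fun setT (fun w => g t (Y t w)).
  by move=> tT; apply: measurableT_comp; [exact: mg|exact: mY].
have mS : measurable_fun setT S.
  by apply: measurable_sum => t; apply: mgY.
have mB : measurable [set w | a < S w].
  rewrite (_ : [set w | _] = S @^-1` `]a, +oo[).
    by rewrite -[X in measurable X]setTI; apply: mS.
  by apply/seteqP; split => w /=; rewrite in_itv /= andbT.
have hmgf t : (t < T)%N -> exists m : R,
    (\int[P]_w (expR (th * g t (Y t w)))%:E = m%:E)%E /\ 0 <= m <= expR (2 * th ^+ 2 * c t ^+ 2).
  move=> tT; have := integral_expR_le _ (c t) th (mgY t tT) (fun w => gc t (Y t w) tT) (g0 t tT).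
  have : (0 <= \int[P]_w (expR (th * g t (Y t w)))%:E)%E.
    by apply: integral_ge0 => w _; rewrite lee_fin expR_ge0.
  case: (\int[P]_w _)%E => [m| |] //.
  by rewrite !lee_fin => m0 m1; exists m; rewrite m0.
have hm t : exists m : R, (t < T)%N ->
    (\int[P]_w (expR (th * g t (Y t w)))%:E = m%:E)%E /\ 0 <= m <= expR (2 * th ^+ 2 * c t ^+ 2).
  have [tT|_] := boolP (t < T)%N; last by exists 0.
  by have [m hm] := hmgf t tT; exists m.
have [m {}hm] := choice hm.
have mgf : (\int[P]_w (expR (th * S w))%:E <= (expR (2 * th ^+ 2 * V))%:E)%E.
  rewrite (eq_integral (fun w => (\prod_(t < T) expR (th * g t (Y t w)))%:E)); last first.
    by move=> w _; rewrite -expR_sum -mulr_sumr.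
  rewrite (integral_prod_indep _ _ mY ind (fun t x => expR (th * g t x)) m).
  - rewrite lee_fin /V mulr_sumr expR_sum; apply: ler_prod => t _.
    by have [] := hm t (ltn_ord t).
  - move=> t tT; apply: measurableT_comp => //; apply: measurable_funM => //; exact: mg.
  - by move=> t x _; rewrite expR_ge0.
  - by move=> t tT; have [] := hm t tT.
have hle : ((expR (th * a))%:E * P [set w | (a < S w)%R] <= \int[P]_w (expR (th * S w))%:E)%E.
  rewrite -(setIT [set w | a < S w]) -integral_indic // -ge0_integralZl_EFin //; last first.
    exact/measurable_EFinP.
  apply: ge0_le_integral => //.
  - by apply/measurable_EFinP; apply: measurable_funM.
  - by apply/measurable_EFinP; apply: measurableT_comp => //; apply: measurable_funM.
  move=> w _; rewrite -EFinM lee_fin indicE.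
  case: (boolP (w \in _)) => [|_]; last by rewrite mulr0 expR_ge0.
  by rewrite inE /= => /ltW aS; rewrite mulr1 ler_expR ler_wpM2l.
have := le_trans hle mgf.
rewrite -lee_pdivlMl ?expR_gt0 // => /le_trans; apply.
rewrite -EFinM lee_fin -expRN -expRD ler_expR le_eqVlt; apply/orP; left; apply/eqP.
rewrite /th /a; move: (Num.sqrt V) sV sVV => sv sv0 <-.
by field; rewrite gt_eqF.
Qed.

Lemma measure_bigU_le (I : finType) (B : I -> set Om) (p : R) :
  (forall i, measurable (B i)) -> (forall i, P (B i) <= p%:E)%E ->
  exists2 A, measurable A /\ (forall w i, A w -> ~ B i w) &
    ((1 - #|I|%:R * p)%:E <= P A)%E.
Proof.
move=> mB hB; pose U := \big[setU/set0]_(i <- enum I) B i.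
have mU : measurable U by apply: bigsetU_measurable.
have PU : (P U <= (#|I|%:R * p)%:E)%E.
  rewrite /U cardE mulrC mulr_natr.
  elim: (enum I) => [|i s IH]; first by rewrite /= big_nil measure0 mulr0n.
  rewrite /= big_cons mulrS EFinD.
  have mS : measurable (\big[setU/set0]_(j <- s) B j) by apply: bigsetU_measurable.
  by apply: le_trans; [apply: measureU2|apply: leeD; [exact: hB|exact: IH]].
exists (~` U).
  split; first exact: measurableC.
  by move=> w i nU Bi; apply: nU; rewrite /U (bigD1_seq i) ?mem_enum ?enum_uniq //=; left.
rewrite probability_setC //.
have : P U \is a fin_num by rewrite fin_num_measure.
case: (P U) PU => [u| |] //; rewrite lee_fin => PU _.
by rewrite -EFinB lee_fin lerD2l lerN2.
Qed.

End Tail.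

(** * Concentration along reference paths *)

Section GoodEvent.
Context {R : realType} {N : nat} {d} {Om : measurableType d} {P : probability Om R}.
Context {dX} {X : measurableType dX}.

Lemma window_sumE (F : nat -> R) T t n : (t + n <= T)%N ->
  \sum_(t <= s < t + n) F s = \sum_(s < T) (if (t <= s < t + n)%N then F s else 0).
Proof.
move=> tn; rewrite (big_nat_widen _ _ _ _ _ tn) (big_nat_widenl _ 0%N) //.
rewrite big_mkord big_mkcond /=; apply: eq_bigr => s _.
by rewrite andbC.
Qed.

(** For fixed starting points, starting times and window both paths are deterministic, so the
    weighted noise is a sum of independent centred bounded terms. A path is given by a net point and
    one of [T.+2] options, a window by two numbers up to [T], which gives the square in the
    count. *)
Lemma good_event (Y : nat -> Om -> X) (T T0 : nat) (Phi : X -> 'rV[R]_N -> R)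
    (Phib : 'rV[R]_N -> R) (hb : 'rV[R]_N -> 'rV[R]_N) (M lam : R) (w : nat -> R)
    (K : finType) (zp : K -> 'rV[R]_N) :
  (forall t, (t < T)%N -> measurable_fun setT (Y t)) -> indep_family P Y T ->
  (forall x, measurable_fun setT (fun y => Phi y x)) ->
  (forall y x x', `|Phi y x - Phi y x'| <= M * enorm (x - x')) ->
  (forall x x', `|Phib x - Phib x'| <= M * enorm (x - x')) ->
  (forall t x, (t < T)%N -> P.-integrable setT (fun om => (Phi (Y t om) x)%:E) /\
     (\int[P]_om (Phi (Y t om) x)%:E = (Phib x)%:E)%E) ->
  (forall t, (t < T)%N -> 0 <= w t) -> 0 <= M -> 0 <= lam ->
  exists2 A, measurable A /\
    (forall om, A om ->
       small_noise w (fun t => Phi (Y t om)) Phib hb M lam T0 T (range zp)) &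
    ((1 - (((#|K| * T.+2) * T.+1) ^ 2)%:R * expR (- (lam ^+ 2 / 8)))%:E <= P A)%E.
Proof.
move=> mY ind mPhi lPhi lPhib iPhi w0 M0 lam0.
pose I : finType := ((option 'I_T.+1 * K) * (option 'I_T.+1 * K) * ('I_T.+1 * 'I_T.+1))%type.
pose pth (a : option 'I_T.+1 * K) (s : nat) : 'rV[R]_N :=
  track w hb (omap (fun i : 'I_T.+1 => i : nat) a.1) (zp a.2) s.
pose win (i : I) (s : nat) := (i.2.1 <= s < i.2.1 + i.2.2)%N.
pose pa (i : I) s := pth i.1.1 s.
pose pb (i : I) s := pth i.1.2 s.
pose g (i : I) s y : R := if win i s then w s *
  ((Phi y (pa i s) - Phib (pa i s)) - (Phi y (pb i s) - Phib (pb i s))) else 0.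
pose c (i : I) s : R := if win i s then 2 * M * (w s * enorm (pa i s - pb i s)) else 0.
pose B i := [set om | lam * Num.sqrt (\sum_(t < T) c i t ^+ 2) <
  \sum_(t < T) g i t (Y t om)].
have mg i t : measurable_fun setT (g i t).
  rewrite /g; case: (win i t); last exact: measurable_cst.
  by apply: measurable_funM => //; repeat apply: measurable_funB => //.
have gc i t y : (t < T)%N -> `|g i t y| <= c i t.
  rewrite /g /c; case: (win i t) => tT; last by rewrite normr0.
  rewrite normrM ger0_norm ?w0 // mulrCA ler_wpM2l ?w0 //.
  rewrite (_ : _ - _ - _ = (Phi y (pa i t) - Phi y (pb i t)) - (Phib (pa i t) - Phib (pb i t))); last ring.
  rewrite (le_trans (ler_normB _ _)) //.
  have := lPhi y (pa i t) (pb i t); have := lPhib (pa i t) (pb i t); lra.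
have g0 i t : (t < T)%N -> (\int[P]_om (g i t (Y t om))%:E = 0)%E.
  move=> tT; rewrite /g; case: (win i t); last by rewrite integral0.
  have [ia ea] := iPhi t (pa i t) tT; have [ib eb] := iPhi t (pb i t) tT.
  have icst (x : R) : P.-integrable setT (EFin \o cst x) by apply: finite_measure_integrable_cst.
  have icstE (x : R) : (\int[P]_om x%:E = x%:E)%E.
    by rewrite integral_cst // [X in (_ * X)%E]probability_setT mule1.
  under eq_integral do rewrite EFinM !EFinB.
  rewrite integralZl //; last first.
    by apply: integrableB => //; apply: integrableB => //; apply: icst.
  rewrite integralB //; last 2 first.
  - by apply: integrableB => //; apply: icst.
  - by apply: integrableB => //; apply: icst.
  rewrite !integralB //; try exact: icst.
  rewrite !icstE ea eb.
  by rewrite -!EFinB !subrr mule0.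
have mB i : measurable (B i).
  rewrite (_ : B i = (fun om => \sum_(t < T) g i t (Y t om)) @^-1`
     `]lam * Num.sqrt (\sum_(t < T) c i t ^+ 2), +oo[); last first.
    by apply/seteqP; split => om /=; rewrite in_itv /= andbT.
  rewrite -[X in measurable X]setTI; apply: measurable_sum => // t.
  by apply: measurableT_comp; [exact: mg|exact: mY].
have PB i : (P (B i) <= (expR (- (lam ^+ 2 / 8)))%:E)%E.
  by apply: hoeffding => //; [exact: gc|exact: g0].
have [A [mA hA] PA] := measure_bigU_le _ B _ mB PB.
exists A; last first.
  apply: le_trans PA; rewrite lee_fin lerD2l lerN2 ler_wpM2r ?expR_ge0 // ler_nat.
  rewrite !card_prod !card_option !card_ord; nia.
split => // om Aom o o' z z' t n [k _ <-] [k' _ <-] ao ao' lot tn.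
have lift q : admissible T q -> exists q' : option 'I_T.+1, q = omap (fun i : 'I_T.+1 => i : nat) q'.
  case: q => [t0|] /= qT; last by exists None.
  by exists (Some (inord t0)); rewrite /= inordK.
have [q eq] := lift o ao; have [q' eq'] := lift o' ao'.
pose i : I := ((q, k), (q', k'), (inord t, inord n)).
have it : (inord t : 'I_T.+1) = t :> nat by rewrite inordK //; lia.
have inn : (inord n : 'I_T.+1) = n :> nat by rewrite inordK //; lia.
have := hA om i Aom; rewrite /B /= => /negP; rewrite -leNgt.
rewrite eq eq' !(window_sumE _ _ _ _ tn).
have -> : \sum_(t < T) g i t (Y t om) = \sum_(s < T) (if (t <= s < t + n)%N then
   w s * noise (fun t => Phi (Y t om)) Phib s (pa i s) (pb i s) else 0).
  by apply: eq_bigr => s _; rewrite /g /win /= it inn.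
move=> h; apply: (le_trans h); rewrite -mulrA ler_wpM2l //.
rewrite -[X in _ <= X * _](@ger0_norm _ (2 * M)) ?mulr_ge0 // -sqrtr_sqr -sqrtrM ?sqr_ge0 //.
rewrite ler_wsqrtr // mulr_sumr ler_sum // => s _.
rewrite /c /win /= it inn; case: ifP => _; last by rewrite expr0n mulr0.
by rewrite exprMn.
Qed.

End GoodEvent.

(** * Choice of scales and the resulting rates *)

Section Rates.
Context {R : realType} {N : nat}.
Variables (w : nat -> R) (u h : nat -> 'rV[R]_N).
Variables (Phi : nat -> 'rV[R]_N -> R) (Phib : 'rV[R]_N -> R).
Variable hb : 'rV[R]_N -> 'rV[R]_N.
Variables (Q lam c : R) (T p : nat) (Z : set 'rV[R]_N) (ustar : 'rV[R]_N).

Hypothesis Q_ge1 : 1 <= Q.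
Hypothesis lam_ge1 : 1 <= lam.
Hypothesis c_bnd : 0 < c <= 1.
Hypothesis p_ge2 : (2 <= p)%N.
Hypothesis pT : (p ^ 10 <= T < p.+1 ^ 10)%N.
Hypothesis wE : forall s, w s = c / Num.sqrt s.+1%:R.
Hypothesis uS : forall s, (s < T)%N -> u s.+1 = u s - w s *: h s.
Hypothesis h_sub : forall s, (s < T)%N -> subgrad (Phi s) (h s) (u s).
Hypothesis h_bnd : forall s, (s < T)%N -> enorm (h s) <= Q.
Hypothesis hb_bnd : forall x, enorm (hb x) <= Q.
Hypothesis Phi_lip : forall s, (s < T)%N -> forall x y,
  `|Phi s x - Phi s y| <= Q * enorm (x - y).
Hypothesis Phib_lip : forall x y, `|Phib x - Phib y| <= Q * enorm (x - y).
Hypothesis good : small_noise w Phi Phib hb Q lam T./2 T Z.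
Hypothesis net : forall x, enorm (x - ustar) <= Q ->
  exists2 z, Z z & enorm (z - x) <= (p%:R^-1) ^+ 10.
Hypothesis u_bnd : forall s, (s <= T)%N -> enorm (u s - ustar) <= Q.

(** All scales are integer powers of [x]: steps of order [x^5], windows of length [p^(2i)] with
    square root [x^-i], net precision [x^10]. The tenth power in [pT] is chosen for this. *)
Let x : R := p%:R^-1.
Let eta : R := 2 * c * x ^+ 5.
Let zeta : R := x ^+ 10.

Lemma x_bnd : 0 < x <= 1.
Proof.
have p0 : (0 < p)%N by move: p_ge2; lia.
by rewrite /x invr_gt0 ltr0n invf_le1 ?ltr0n // ler1n p0.
Qed.

Lemma sqrt_natX k : Num.sqrt (p ^ k.*2)%:R = x ^- k :> R.
Proof.
rewrite -mul2n mulnC expnM natrX sqrtr_sqr ger0_norm // natrX /x.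
by rewrite exprVn invrK.
Qed.

Lemma steps_bnd s : (T./2 <= s < T)%N -> 0 <= w s <= eta.
Proof.
move=> sT; have /andP[c0 c1] := c_bnd; have /andP[x0 x1] := x_bnd.
rewrite wE divr_ge0 ?sqrtr_ge0 ?(ltW c0) //=.
rewrite ler_pdivrMr ?sqrt_gt0_nat //.
have h1 : (p ^ 10 <= 2 * s.+1)%N.
  have : (T <= 2 * s.+1)%N by have := odd_double_half T; move: sT; case: (odd T) => /=; lia.
  by move: pT; lia.
have h2 : x ^- 5 <= 2 * Num.sqrt s.+1%:R.
  rewrite -(@ler_pXn2r _ 2) ?nnegrE ?mulr_ge0 ?sqrtr_ge0 ?invr_ge0 ?exprn_ge0 ?(ltW x0) //.
  rewrite exprMn sqr_sqrt_nat /x -exprVn invrK -exprM -natrX.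
  by rewrite -natrX -natrM ler_nat; move: h1; lia.
have x5 : 0 < x ^+ 5 by rewrite exprn_gt0.
rewrite /eta (_ : _ * _ * _ * _ = c * (x ^+ 5 * (2 * Num.sqrt s.+1%:R))); last ring.
by rewrite ler_peMr ?(ltW c0) // -[leLHS](mulfV (lt0r_neq0 x5)) ler_wpM2l // ltW.
Qed.

(** From [s.+1 <= p.+1 ^ 10 <= (2 * p) ^ 10] comes a factor 32 after the square root, doubled by the
    2 in [eta]. *)
Lemma steps_lower s : (T./2 <= s < T)%N -> eta <= 64 * w s.
Proof.
move=> sT; have /andP[c0 c1] := c_bnd; have /andP[x0 x1] := x_bnd.
rewrite wE mulrA ler_pdivlMr ?sqrt_gt0_nat //.
have h1 : (s.+1 <= (2 * p) ^ 10)%N.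
  have : (p.+1 ^ 10 <= (2 * p) ^ 10)%N by rewrite leq_exp2r //; move: p_ge2; lia.
  by move: pT sT; lia.
have h2 : Num.sqrt s.+1%:R <= 32 * x ^- 5.
  rewrite -(@ler_pXn2r _ 2) ?nnegrE ?mulr_ge0 ?sqrtr_ge0 ?invr_ge0 ?exprn_ge0 ?(ltW x0) //.
  rewrite exprMn sqr_sqrt_nat /x -exprVn invrK -exprM -!natrX -natrM ler_nat.
  by rewrite (leq_trans h1) // expnMn.
have x5 : 0 < x ^+ 5 by rewrite exprn_gt0.
apply: (@le_trans _ _ (eta * (32 * x ^- 5))); first by rewrite ler_wpM2l // !mulr_ge0 // ltW.
by rewrite /eta le_eqVlt; apply/orP; left; apply/eqP; field; rewrite gt_eqF.
Qed.

Lemma eta_bnd : 0 < eta <= 1.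
Proof.
have /andP[c0 c1] := c_bnd; have /andP[x0 x1] := x_bnd.
have x5 : 0 < x ^+ 5 by rewrite exprn_gt0.
have x2 : 2 * x <= 1 by rewrite /x -ler_pdivlMr ?invr_gt0 ?ltr0n ?invrK ?mul1r ?ler_nat //; move: p_ge2; lia.
rewrite /eta !mulr_gt0 //=.
have x4 : x ^+ 4 <= 1 by rewrite exprn_ile1 // ltW.
have : c * (2 * x) * x ^+ 4 <= 1.
  by rewrite mulr_ile1 ?mulr_ge0 ?exprn_ge0 ?(ltW x0) ?(ltW c0) // mulr_ile1 ?mulr_ge0 ?(ltW x0) ?(ltW c0).
by rewrite (_ : c * (2 * x) * x ^+ 4 = 2 * c * x ^+ 5) //; ring.
Qed.


Let lvl := level w u Phi Phib hb zeta T./2 T Z.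

Let Q0 : 0 <= Q. Proof. exact: le_trans Q_ge1. Qed.
Let lam0 : 0 <= lam. Proof. exact: le_trans lam_ge1. Qed.
Let eta0 : 0 <= eta. Proof. by have /andP[/ltW] := eta_bnd. Qed.
Let zeta0 : 0 <= zeta.
Proof. by rewrite exprn_ge0 //; have /andP[/ltW] := x_bnd. Qed.
Let net_iterates s : (T./2 <= s <= T)%N -> exists2 z, Z z & enorm (z - u s) <= zeta.
Proof. by move=> sT; apply: net; apply: u_bnd; natlia. Qed.
Let natX i : (p ^ i.*2)%:R = x ^- i * x ^- i :> R.
Proof. by rewrite -sqrt_natX -expr2 sqr_sqrt_nat. Qed.

Lemma rate_level1 k : lvl false k (2 * Q * eta * (zeta + Q * eta * k%:R)) (zeta + Q * eta * k%:R).
Proof.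
apply: level_const Q0 eta0 steps_bnd _ _ _ Phib_lip k => s sT.
- by apply: uS; natlia.
- by apply: h_bnd; natlia.
- by apply: Phi_lip; natlia.
Qed.

Lemma rate_step det k q (b d D : R) : (forall y, subgrad Phib (hb y) y) ->
  (0 < k)%N -> 0 <= D -> zeta <= Q * eta -> 0 <= b -> lvl det k b d ->
  zeta ^+ 2 + q%:R * (2 * (b * k%:R + 2 * lam * Q * eta * Num.sqrt k%:R *
     (D + zeta + 2 * Q * eta * k%:R)) + 4 * (Q * eta) ^+ 2 * k%:R) <= D ^+ 2 ->
  lvl true (q * k) (b + 4 * lam * Q * eta * (D + zeta + 4 * Q * eta * k%:R) / Num.sqrt k%:R)
    (D + 2 * Q * eta * k%:R).
Proof.
move=> hb_sub; apply: level_step => //; move=> s sT.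
- by apply: steps_bnd.
- by apply: uS; natlia.
- by apply: h_sub; natlia.
- by apply: h_bnd; natlia.
Qed.

Lemma level_weaken det k (b d b' d' : R) : b <= b' -> d <= d' -> lvl det k b d -> lvl det k b' d'.
Proof.
move=> bb dd lev t n y lot tn nk Zy yz.
have [h1 h2] := lev t n y lot tn nk Zy yz; split.
  by move=> s sn; rewrite (le_trans (h1 s sn)).
by rewrite (le_trans h2) // ler_wpM2r.
Qed.

(** With [i <= 4] and [2 <= p] the window [p ^ i.*2] fits into the second half of the run. All
    distances are at most [D <= 4 * Q], whence [16 = 4 * 4] and [208 = 4 * (2 + 6 * 4) * 2], the
    last 2 bounding [sqrt eta] by [sqrt (x^5)]. *)
Lemma rate_final i det (b d P : R) : (i <= 4)%N -> lvl det (p ^ i.*2) b d ->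
  0 <= b -> 0 <= d -> d + zeta <= 2 * Q ->
  b / eta + Q ^+ 2 * eta / 2 + 2 * Q * zeta + 16 * lam * Q ^+ 2 * x ^+ i <= P ->
  Phib (u T) - Phib ustar <= 64 ^+ 2 * (Q ^+ 2 * x ^+ 5 / (2 * c) + P * (4 + ln T%:R) +
     208 * Q ^+ 2 * lam * Num.sqrt (x ^+ 5)).
Proof.
move=> i4 lev b0 d0 dQ hP.
have /andP[c0 c1] := c_bnd; have /andP[x0 x1] := x_bnd; have /andP[e0 e1] := eta_bnd.
have p0 : (0 < p)%N by move: p_ge2; natlia.
have [zs Zzs zsu] : exists2 z, Z z & enorm (z - ustar) <= zeta.
  by apply: net; rewrite subrr enorm0.
have pk : (p ^ i.*2 * 4 <= p ^ 10)%N.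
  have p8 : (p ^ i.*2 <= p ^ 8)%N by rewrite leq_pexp2l // -mul2n; natlia.
  have : (4 * p ^ 8 <= p ^ 10)%N by rewrite (expnD p 2 8) leq_mul2r (leq_sqr 2) p_ge2 orbT.
  natlia.
have p10 : (0 < p ^ 10)%N by rewrite expn_gt0 p0.
have T0 : (0 < T)%N by move: pT p10; natlia.
have hhalf : (T <= 2 * (T - T./2))%N /\ (T./2 <= T - T./2)%N.
  by have := odd_double_half T; case: (odd T) => /=; natlia.
have kT : (T./2 + p ^ i.*2 <= T)%N by move: pT hhalf pk T0; natlia.
set n : R := (T - T./2)%:R.
have := last_iterate_error w u h Phi Phib hb Q eta lam zeta T./2 T Z Q0 eta0 lam0 zeta0
  steps_bnd (fun s sT => uS s ltac:(natlia)) (fun s sT => h_sub s ltac:(natlia))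
  (fun s sT => h_bnd s ltac:(natlia)) hb_bnd (fun s sT => Phi_lip s ltac:(natlia))
  Phib_lip good net_iterates det (p ^ i.*2)%N b d Q 64 ustar zs lev
  ltac:(rewrite expn_gt0 p0; natlia) b0 d0 eta_bnd ltac:(lra) kT steps_lower
  (fun s sT => u_bnd s ltac:(natlia)) Zzs zsu n _ _ erefl erefl erefl.
set D := d + 2 * Q + zeta; rewrite sqrt_natX invrK.
set P' := _ + _ + _ + _ => h1.
have D4 : D <= 4 * Q by rewrite /D; lra.
have D0 : 0 <= D by rewrite /D; move: Q0 zeta0; lra.
have xi0 : 0 <= x ^+ i by rewrite exprn_ge0 // ltW.
have lQ0 : 0 <= lam * Q by rewrite mulr_ge0.
have PP : P' <= P.
  apply: le_trans hP; rewrite /P'.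
  have : 4 * (lam * Q) * D * x ^+ i <= 4 * (lam * Q) * (4 * Q) * x ^+ i.
    by rewrite ler_wpM2r // ler_wpM2l // mulr_ge0.
  lra.
have P'0 : 0 <= P'.
  have a1 : 0 <= Q ^+ 2 * eta by rewrite mulr_ge0 ?sqr_ge0.
  have a2 : 0 <= b / eta by rewrite divr_ge0.
  have a3 : 0 <= Q * zeta by rewrite mulr_ge0.
  have a4 : 0 <= lam * Q * D * x ^+ i by rewrite !mulr_ge0.
  by rewrite /P'; lra.
have n1 : 1 <= n by rewrite ler1n; move: hhalf T0; natlia.
have nT : n <= T%:R by rewrite ler_nat; natlia.
have Tn : T%:R <= 2 * n by rewrite -natrM ler_nat; move: hhalf; natlia.
have TR : 0 < T%:R :> R by rewrite ltr0n.
have ln1 : 0 <= ln n by apply: ln_ge0.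
have ln2 : ln n <= ln T%:R by rewrite ler_ln ?posrE // (lt_le_trans _ n1).
have x5 : 0 < x ^+ 5 by rewrite exprn_gt0.
have xT : x ^- 5 * x ^- 5 <= T%:R.
  by rewrite -natX ler_nat; move: pT; natlia.
have t1 : Q ^+ 2 / (2 * eta * n) <= Q ^+ 2 * x ^+ 5 / (2 * c).
  rewrite -[leRHS]mulrA ler_wpM2l ?sqr_ge0 //.
  have -> : x ^+ 5 * (2 * c)^-1 = (2 * c * x ^- 5)^-1 by field; rewrite !gt_eqF.
  have pos1 : 0 < 2 * c * x ^- 5 by apply: mulr_gt0; [apply: mulr_gt0|rewrite invr_gt0].
  have pos2 : 0 < 2 * eta * n.
    by apply: mulr_gt0; [apply: mulr_gt0|apply: lt_le_trans n1].
  rewrite lef_pV2 ?posrE //.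
  have : c * x ^+ 5 * (x ^- 5 * x ^- 5) <= c * x ^+ 5 * (2 * n).
    apply: ler_wpM2l; last exact: le_trans xT Tn.
    by rewrite mulr_ge0 // ltW.
  have -> : c * x ^+ 5 * (x ^- 5 * x ^- 5) = c * x ^- 5 by field; rewrite gt_eqF.
  rewrite /eta; lra.
have t2 : P' * (4 + ln n) <= P * (4 + ln T%:R) by apply: ler_pM => //; lra.
have t3 : 4 * lam * Q * (2 * Q + 6 * D) * Num.sqrt eta <=
    208 * Q ^+ 2 * lam * Num.sqrt (x ^+ 5).
  have s1 : Num.sqrt eta <= 2 * Num.sqrt (x ^+ 5).
    rewrite -(@ler_pXn2r _ 2) ?nnegrE ?mulr_ge0 ?sqrtr_ge0 // exprMn !sqr_sqrtr //; last exact: ltW.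
    by rewrite /eta; have : c * x ^+ 5 <= 1 * x ^+ 5; [rewrite ler_wpM2r // ltW|lra].
  have -> : 208 * Q ^+ 2 * lam * Num.sqrt (x ^+ 5) =
    4 * lam * Q * (2 * Q + 6 * (4 * Q)) * (2 * Num.sqrt (x ^+ 5)) by ring.
  have lQ4 : 0 <= 4 * lam * Q by rewrite !mulr_ge0.
  apply: ler_pM; rewrite ?sqrtr_ge0 //.
    by rewrite mulr_ge0 // addr_ge0 // mulr_ge0.
  by rewrite ler_wpM2l // lerD2l ler_wpM2l.
apply: (le_trans h1); rewrite ler_wpM2l ?sqr_ge0 //; move: t1 t2 t3; lra.
Qed.

(** Constant reference points on windows of length [p^4]: the iterate moves by [2 * Q * c * x] in
    such a window, and concentration over it contributes [lam * x^2]. The argument asks only for a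
    Lipschitz mean, without a subgradient, and so suits the smoothed objective. *)
Lemma rate_rough :
  Phib (u T) - Phib ustar <= 64 ^+ 2 * (Q ^+ 2 * x ^+ 5 / (2 * c) +
     20 * Q ^+ 2 * (c * x + lam * x ^+ 2) * (4 + ln T%:R) +
     208 * Q ^+ 2 * lam * Num.sqrt (x ^+ 5)).
Proof.
have /andP[c0 c1] := c_bnd; have /andP[x0 x1] := x_bnd.
have x2 : x <= 1 / 2.
  by rewrite /x div1r lef_pV2 ?posrE ?ltr0n ?ler_nat //; move: p_ge2; natlia.
have lev := rate_level1 (p ^ 2.*2).
have xn0 : x != 0 by rewrite gt_eqF.
have e1 : Q * eta * (p ^ 2.*2)%:R = 2 * (Q * (c * x)).
  by rewrite natX /eta; field.
rewrite e1 in lev.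
have cx0 : 0 <= c * x by rewrite mulr_ge0 // ltW.
have cx1 : c * x <= 1 / 2.
  by apply: le_trans x2; rewrite ler_piMl // ltW.
have Qcx : Q * (c * x) <= Q * (1 / 2) by rewrite ler_wpM2l.
have Qcx0 : 0 <= Q * (c * x) by rewrite mulr_ge0.
have z2 : zeta <= x ^+ 2.
  by rewrite /zeta ler_wiXn2l // ltW.
have x22 : x ^+ 2 <= 1 / 4.
  by have := sqr_ge0 x; have : x * x <= (1/2) * (1/2); [rewrite ler_pM // ltW|rewrite expr2; lra].
have dd : 0 <= zeta + 2 * (Q * (c * x)) by rewrite addr_ge0 // mulr_ge0.
apply: (@rate_final 2 _ _ _ _ _ lev) => //.
- by apply: mulr_ge0 => //; apply: mulr_ge0 => //; apply: mulr_ge0.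
- by move: Q_ge1; lra.
have e0 : 0 < eta by have /andP[] := eta_bnd.
rewrite (_ : _ / eta = 2 * Q * zeta + 4 * Q ^+ 2 * (c * x)); last by field; rewrite gt_eqF.
have QQ : Q <= Q ^+ 2 by rewrite expr2 ler_peMl.
have Q20 : 0 <= Q ^+ 2 by rewrite sqr_ge0.
have h1 : Q * zeta <= Q ^+ 2 * (lam * x ^+ 2).
  by apply: ler_pM => //; apply: (le_trans z2); rewrite ler_peMl // exprn_ge0 // ltW.
have h2 : Q ^+ 2 * eta <= Q ^+ 2 * (2 * (c * x)).
  rewrite ler_wpM2l // /eta -mulrA ler_wpM2l // ler_wpM2l ?(ltW c0) //.
  by rewrite -[leRHS]expr1 ler_wiXn2l // ltW.
have h3 : 0 <= Q ^+ 2 * (c * x) by rewrite mulr_ge0.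
lra.
Qed.

(** As [x <= 1] while [Q] and [lam] are at least 1, monomials compare by their exponents. The
    inequalities of [rate_fine] become linear in monomials. *)
Let mono_le a b e a' b' e' : (a <= a')%N -> (b <= b')%N -> (e' <= e)%N ->
  Q ^+ a * lam ^+ b * x ^+ e <= Q ^+ a' * lam ^+ b' * x ^+ e'.
Proof.
move=> aa bb ee; have /andP[x0 x1] := x_bnd.
apply: ler_pM.
- by apply: mulr_ge0; apply: exprn_ge0.
- by apply: exprn_ge0; apply: ltW.
- apply: ler_pM; try by apply: exprn_ge0.
    by rewrite ler_weXn2l.
  by rewrite ler_weXn2l.
by rewrite ler_wiXn2l // ltW.
Qed.

(* Three scales of windows: [p^2] with constant reference points, then [p^4] and
   [p^6] with deterministic descent. *)
Lemma rate_fine : (forall y, subgrad Phib (hb y) y) -> c = 1 -> 30 * lam * x <= 1 ->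
  Phib (u T) - Phib ustar <= 64 ^+ 2 * (Q ^+ 2 * x ^+ 5 / (2 * c) +
     257 * Q ^+ 2 * lam ^+ 2 * x ^+ 3 * (4 + ln T%:R) +
     208 * Q ^+ 2 * lam * Num.sqrt (x ^+ 5)).
Proof.
move=> hb_sub c1 lx.
have /andP[x0 x1] := x_bnd; have xn0 : x != 0 by rewrite gt_eqF.
have etaE : eta = 2 * x ^+ 5 by rewrite /eta c1; ring.
have p0 : (0 < p)%N by move: p_ge2; natlia.
have pos a b e : 0 <= Q ^+ a * lam ^+ b * x ^+ e.
  by rewrite !mulr_ge0 ?exprn_ge0 // ltW.
have zQ : zeta <= Q * eta.
  rewrite etaE /zeta; have := mono_le 0 0 10 1 0 5 isT isT isT.
  by have := pos 1%N 0%N 5%N; lra.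
have k1 := natX 1; have k2 := natX 2.
have lev1 : lvl false (p ^ 1.*2) (12 * Q ^+ 2 * x ^+ 8) (zeta + Q * eta * (p ^ 1.*2)%:R).
  apply: level_weaken (rate_level1 (p ^ 1.*2)); last exact: lexx.
  rewrite k1 etaE (_ : _ * (_ + _) = 4 * (Q * x ^+ 15) + 8 * (Q ^+ 2 * x ^+ 8)); last first.
    by rewrite /zeta; field.
  by have := mono_le 1 0 15 2 0 8 isT isT isT; lra.
(* [D] occurs on both sides of the condition of [level_step]. In units of the dominant monomial it
   reads [81 + 8 * 14 <= 14 ^ 2]. *)
have D2 : 0 <= 14 * Q * lam * x ^+ 2 by have := pos 1%N 1%N 2%N; lra.
have b1 : 0 <= 12 * Q ^+ 2 * x ^+ 8 by have := pos 2%N 0%N 8%N; lra.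
have := @rate_step false (p ^ 1.*2) (p ^ 1.*2) _ _ _ hb_sub
  ltac:(by rewrite expn_gt0 p0) D2 zQ b1 lev1.
rewrite sqrt_natX k1 etaE.
rewrite (_ : zeta ^+ 2 + _ = x ^+ 20 + 24 * Q ^+ 2 * x ^+ 4 + 112 * (Q ^+ 2 * lam ^+ 2 * x ^+ 4)
  + 8 * (Q * lam * x ^+ 12) + 32 * (Q ^+ 2 * lam * x ^+ 5) + 16 * Q ^+ 2 * x ^+ 6); last first.
  by rewrite /zeta; field.
move=> H; lapply H; clear H; last first.
  have := mono_le 0 0 20 2 2 4 isT isT isT; have := mono_le 2 0 4 2 2 4 isT isT isT.
  have := mono_le 1 1 12 2 2 4 isT isT isT; have := mono_le 2 1 5 2 2 4 isT isT isT.
  have := mono_le 2 0 6 2 2 4 isT isT isT; have := pos 2%N 2%N 4%N.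
  lra.
rewrite -expnD.
move=> lev2'; have H := fun hb => level_weaken _ _ _ _ (196 * Q ^+ 2 * lam ^+ 2 * x ^+ 8) _ hb (lexx _) lev2'.
lapply H; clear H lev2'; last first.
  rewrite (_ : _ + _ / _ = 12 * Q ^+ 2 * x ^+ 8 + 112 * (Q ^+ 2 * lam ^+ 2 * x ^+ 8) +
     8 * (Q * lam * x ^+ 16) + 64 * (Q ^+ 2 * lam * x ^+ 9)); last by rewrite /zeta; field.
  have := mono_le 2 0 8 2 2 8 isT isT isT; have := mono_le 1 1 16 2 2 8 isT isT isT.
  have := mono_le 2 1 9 2 2 8 isT isT isT; lra.
(* The same condition one scale up reads [449 + 8 * 26 <= 26 ^ 2]. *)
move=> lev2; have D3 : 0 <= 26 * Q * lam * x by have := pos 1%N 1%N 1%N; lra.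
have b2 : 0 <= 196 * Q ^+ 2 * lam ^+ 2 * x ^+ 8 by have := pos 2%N 2%N 8%N; lra.
have := @rate_step true (p ^ 2.*2) (p ^ 1.*2) _ _ _ hb_sub
  ltac:(by rewrite expn_gt0 p0) D3 zQ b2 lev2.
rewrite sqrt_natX k1 k2 etaE.
rewrite (_ : zeta ^+ 2 + _ = x ^+ 20 + 392 * (Q ^+ 2 * lam ^+ 2 * x ^+ 2)
  + 208 * (Q ^+ 2 * lam ^+ 2 * x ^+ 2)
  + 8 * (Q * lam * x ^+ 11) + 32 * (Q ^+ 2 * lam * x ^+ 2) + 16 * Q ^+ 2 * x ^+ 4); last first.
  by rewrite /zeta; field.
move=> H; lapply H; clear H; last first.
  have := mono_le 0 0 20 2 2 2 isT isT isT; have := mono_le 2 1 2 2 2 2 isT isT isT.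
  have := mono_le 1 1 11 2 2 2 isT isT isT.
  have := mono_le 2 0 4 2 2 2 isT isT isT; have := pos 2%N 2%N 2%N.
  lra.
rewrite -expnD (_ : (1.*2 + 2.*2)%N = 3.*2) //.
move=> lev3'; have H := fun hb => level_weaken _ _ _ _ (476 * Q ^+ 2 * lam ^+ 2 * x ^+ 8) _ hb (lexx _) lev3'.
lapply H; clear H lev3'; last first.
  rewrite (_ : _ + _ / _ = 196 * Q ^+ 2 * lam ^+ 2 * x ^+ 8 + 208 * (Q ^+ 2 * lam ^+ 2 * x ^+ 8) +
     8 * (Q * lam * x ^+ 17) + 64 * (Q ^+ 2 * lam * x ^+ 8)); last by rewrite /zeta; field.
  have := mono_le 1 1 17 2 2 8 isT isT isT.
  have := mono_le 2 1 8 2 2 8 isT isT isT; lra.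
set d3 := (X in lvl _ _ _ X) => lev3.
have d3E : d3 = 26 * (Q * lam * x) + 4 * (Q * x).
  by rewrite /d3; field.
(* The deviation [d3] is at most [30 * Q * lam * x]; the assumption on [lam * x] keeps it below [Q],
   as [rate_final] requires. *)
have Qlx : Q * lam * x <= Q * (1 / 30).
  by rewrite -mulrA ler_wpM2l //; move: lx; lra.
have z1 : zeta <= 1 by rewrite /zeta exprn_ile1 // ltW.
apply: (@rate_final 3 true _ _ _ isT lev3).
- by have := pos 2%N 2%N 8%N; lra.
- by rewrite d3E; have := pos 1%N 1%N 1%N; have := pos 1%N 0%N 1%N; lra.
- rewrite d3E; have := mono_le 1 0 1 1 1 1 isT isT isT; move: Qlx z1 Q_ge1; lra.
(* The constant 257 is [238 + 1 + 2 + 16]: noise rate, step size, net precision, block cost. *)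
rewrite etaE (_ : _ / _ = 238 * Q ^+ 2 * lam ^+ 2 * x ^+ 3); last by field.
have := mono_le 2 0 5 2 2 3 isT isT isT; have := mono_le 1 0 10 2 2 3 isT isT isT.
have := mono_le 2 1 3 2 2 3 isT isT isT; rewrite /zeta; lra.
Qed.

End Rates.

(** * The penalty and the projection *)

Section Geometry.
Context {R : realType} {N : nat}.
Variable C : set 'rV[R]_N.
Hypothesis cptC : compact C.

Lemma compact_enorm_bounded : exists B, forall x, C x -> enorm x <= B.
Proof.
have [M [_ hM]] := compact_bounded cptC.
exists (\sum_(i < N) (M + 1)) => x Cx.
apply: (le_trans (enorm_le_sum _)); apply: ler_sum => i _.
have h : `|x| <= M + 1 by apply: hM => //; rewrite ltrDl.
apply: le_trans h; rewrite [leRHS]/Num.norm /= mx_normrE.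
by apply/bigmax_geP; right; exists (0, i).
Qed.

Lemma enorm_le_diam x y : C x -> C y -> enorm (x - y) <= diam C.
Proof.
move=> Cx Cy; have [B hB] := compact_enorm_bounded.
apply: ub_le_sup; last by exists x, y.
exists (B + B) => _ [a [b [Ca Cb ->]]].
by rewrite (le_trans (ler_enormB _ _)) // lerD // hB.
Qed.

Lemma bdry_sub : bdry C `<=` C.
Proof.
have clC : closed C by apply: compact_closed => //; exact: norm_hausdorff.
by move=> x []; rewrite -((closure_id C).1 clC).
Qed.

Lemma psiC_ub y : has_ubound [set r | exists x v, [/\ bdry C x,
  support_vecs C x v \/ v = 0 & r = dotv v (y - x)]].
Proof.
have [B hB] := compact_enorm_bounded.
exists (enorm y + B) => _ [x [v [/bdry_sub Cx hv ->]]].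
have v1 : enorm v <= 1 by case: hv => [[->]|->] //; rewrite enorm0.
rewrite (le_trans (cauchy_schwarz _ _)) //.
apply: (@le_trans _ _ (1 * enorm (y - x))); first by rewrite ler_wpM2r ?enorm_ge0.
by rewrite mul1r (le_trans (ler_enormB _ _)) // lerD2l hB.
Qed.

Lemma psiC_le0 y : C y -> psiC C y <= 0.
Proof.
move=> Cy; rewrite /psiC; set S := [set r | _].
(* The boundary can be empty, as in dimension 0; [sup] is then 0. *)
have [[r Sr]|] := pselect (S !=set0); last first.
  by move/nonemptyPn => ->; rewrite sup0.
apply: ge_sup; first by exists r.
by move=> _ [x [v [_ [[_ hv]|->] ->]]]; [exact: hv|rewrite dotv0l].
Qed.

Lemma psiC_ge0 y : 0 <= psiC C y.
Proof.
rewrite /psiC; set S := [set r | _].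
have [[r [x [v [bx _ _]]]]|] := pselect (S !=set0); last first.
  by move/nonemptyPn => ->; rewrite sup0.
apply: ub_le_sup; first exact: psiC_ub.
by exists x, 0; split => //; [right|rewrite dotv0l].
Qed.

Variable proj : 'rV[R]_N -> 'rV[R]_N.
Hypothesis cvxC : convex_set C.
Hypothesis projP : is_proj C proj.

Lemma proj_obtuse y z : C z -> dotv (y - proj y) (z - proj y) <= 0.
Proof.
move=> Cz; have [Cx hx] := projP y; set x := proj y in Cx hx *.
rewrite leNgt; apply/negP => ab0.
set a := dotv _ _ in ab0; pose b := enorm (z - x) ^+ 2.
have b0 : 0 <= b by rewrite sqr_ge0.
(* A step [t] towards [z] lowers the squared distance by [2 * t * a - t ^+ 2 * b]. This [t] is at
   most 1 and satisfies [t * b < a], so the point obtained lies in [C] and is closer to [y]. *)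
pose t := a / (a + b).
have ab : 0 < a + b by rewrite ltr_pwDl.
have t0 : 0 < t by rewrite divr_gt0.
have t1 : t <= 1 by rewrite ler_pdivrMr // mul1r lerDl.
have Cxt : C (x + t *: (z - x)).
  have := cvxC z x (Itv01 (ltW t0) t1); rewrite !inE => /(_ Cz Cx).
  rewrite /conv /=; congr C; apply/rowP => i; rewrite !mxE /unstable.onem /=; ring.
have := hx _ Cxt.
rewrite -(@ler_pXn2r _ 2) ?nnegrE ?enorm_ge0 // opprD addrA (sqr_enormB (y - x)).
rewrite enormZ exprMn gtr0_norm // dotvZr -/a -/b => h.
have h2 : 2 * a <= t * b.
  by rewrite -(ler_pM2l t0); move: h; rewrite expr2; lra.
have : t * b < a by rewrite /t mulrAC ltr_pdivrMr // ltr_pM2l // ltrDr.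
by move: h2; lra.
Qed.

(** The unit vector from [proj y] to [y] is a support vector at [proj y] by [proj_obtuse], and it
    contributes exactly the distance to the supremum. *)
Lemma enorm_proj_le_psiC y : enorm (y - proj y) <= psiC C y.
Proof.
have [Cx hx] := projP y; set x := proj y in Cx hx *.
have [->|yx] := eqVneq (enorm (y - x)) 0; first exact: psiC_ge0.
have d0 : 0 < enorm (y - x) by rewrite lt_neqAle eq_sym yx enorm_ge0.
pose v := (enorm (y - x))^-1 *: (y - x).
have v1 : enorm v = 1 by rewrite enormZ gtr0_norm ?invr_gt0 // mulVf.
have sv : support_vecs C x v.
  split => // z Cz; rewrite dotvZl mulr_ge0_le0 ?invr_ge0 ?enorm_ge0 //.
  exact: proj_obtuse.
apply: ub_le_sup; first exact: psiC_ub.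
exists x, v; split; [|by left|]; last first.
  by rewrite dotvZl -sqr_enorm expr2 mulKf.
split; first exact: subset_closure.
(* If [x] were interior, a small step along [v] would remain in [C], against the support
   property. *)
move=> /nbhs_ballP[e /= e0 he].
pose t := e / (2 * (`|v| + 1)).
have nv : 0 < 2 * (`|v| + 1) by rewrite mulr_gt0 // ltr_wpDl.
have t0 : 0 < t by rewrite divr_gt0.
have : C (x + t *: v).
  apply: he; rewrite mx_norm_ball /ball_ /= opprD addNKr normrN normrZ gtr0_norm //.
  rewrite /t mulrAC ltr_pdivrMr // ltr_pM2l //.
  by have := normr_ge0 v; lra.
move/(sv.2 _); rewrite addrAC subrr add0r dotvZr -sqr_enorm v1 expr1n mulr1.
by move: t0; lra.
Qed.

End Geometry.

(** * Independence of the pairs of samples and shifts *)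

Section PairLaw.
Context {R : realType} {d d1 d2 : measure_display} {Om : measurableType d} {P : probability Om R}.
Context {X : measurableType d1} {S : measurableType d2}.

Lemma prod_measure_ext (m1 m2 : {measure set (X * S) -> \bar R}) :
  (m1 setT < +oo)%E ->
  (forall A B, measurable A -> measurable B -> m1 (A `*` B) = m2 (A `*` B)) ->
  forall D, measurable D -> m1 D = m2 D.
Proof.
move=> m1T m12 D mD.
pose G : set (set (X * S)) :=
  [set D | exists A B, [/\ measurable A, measurable B & D = A `*` B]].
apply: (measure_unique G (fun=> setT)) => //.
- rewrite measurable_prod_measurableType //; congr (<<s _ >>).
  rewrite predeqE => D'; split => [[A mA [B mB <-]]|[A [B [mA mB ->]]]].
    by exists A, B.
  by exists A => //; exists B.
- move=> _ _ [A [B [mA mB ->]]] [A' [B' [mA' mB' ->]]].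
  rewrite -setXI; exists (A `&` A'), (B `&` B').
  by split => //; exact: measurableI.
- by move=> _; exists setT, setT; rewrite setXTT.
- by rewrite bigcup_const //; exists 0%N.
- by move=> _ [A [B [mA mB ->]]]; apply: m12.
Qed.

(* The rectangles are replaced by arbitrary measurable sets one time index after the other,
   by uniqueness of measures on the product. *)
Lemma indep_family_pair (xi : nat -> Om -> X) (v : nat -> Om -> S) T :
  (forall t, (t < T)%N -> measurable_fun setT (xi t)) ->
  (forall t, (t < T)%N -> measurable_fun setT (v t)) ->
  indep_family2 P xi v T ->
  indep_family P (fun t w => (xi t w, v t w)) T /\
  (forall t A B, (t < T)%N -> measurable A -> measurable B ->
     P (xi t @^-1` A `&` v t @^-1` B) = (P (xi t @^-1` A) * P (v t @^-1` B))%E).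
Proof.
move=> mxi mv ind.
pose Y t w := (xi t w, v t w).
have mY t : (t < T)%N -> measurable_fun setT (Y t).
  by move=> tT; apply: measurable_fun_pair; [exact: mxi|exact: mv].
have mYA t A : (t < T)%N -> measurable A -> measurable (Y t @^-1` A).
  by move=> tT mA; rewrite -[X in measurable X]setTI; apply: mY.
have rect t A B : (t < T)%N -> measurable A -> measurable B ->
    P (xi t @^-1` A `&` v t @^-1` B) = (P (xi t @^-1` A) * P (v t @^-1` B))%E.
  move=> tT mA mB.
  have := ind (fun s => if s == t then A else setT) (fun s => if s == t then B else setT).
  rewrite (bigD1 (Ordinal tT)) //= eqxx big1 ?mule1; last first.
    move=> i; rewrite -val_eqE /= => /negbTE ->.
    by rewrite !preimage_setT !probability_setT mule1.
  move=> <-; [|by move=> s; case: ifP|by move=> s; case: ifP].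
  congr (P _); apply/seteqP; split => [w [Aw Bw] s /= sT|w h].
    by case: eqP => [->|].
  by have := h t tT; rewrite eqxx.
split => //.
suff claim j : (j <= T)%N -> forall A : nat -> set (X * S), (forall t, measurable (A t)) ->
    (forall t, (j <= t < T)%N -> exists B D, [/\ measurable B, measurable D & A t = B `*` D]) ->
    P (\bigcap_(t in `I_T) (Y t @^-1` A t)) = \big[*%E/1%E]_(t < T) P (Y t @^-1` A t).
  by move=> A mA; apply: (claim T (leqnn T) A mA) => t tT; exfalso; natlia.
elim: j => [|j IH] jT A mA rA.
  have {}rA t : exists BD : set X * set S, [/\ measurable BD.1, measurable BD.2 &
      ((t < T)%N -> A t = BD.1 `*` BD.2)].
    have [tT|/negP nT] := boolP (t < T)%N; last by exists (set0, set0); split => //=; exact: measurable0.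
    by have [B [D [mB mD ->]]] := rA t tT; exists (B, D).
  have [BD hBD] := choice rA.
  have mB t : measurable (BD t).1 by have [] := hBD t.
  have mD t : measurable (BD t).2 by have [] := hBD t.
  have e t : (t < T)%N -> Y t @^-1` A t = xi t @^-1` (BD t).1 `&` v t @^-1` (BD t).2.
    by move=> tT; have [_ _ ->] := hBD t.
  rewrite (_ : \bigcap_(t in `I_T) _ =
    \bigcap_(t in `I_T) (xi t @^-1` (BD t).1 `&` v t @^-1` (BD t).2)); last first.
    by apply: eq_bigcapr => t /e.
  rewrite (ind (fun t => (BD t).1) (fun t => (BD t).2)) //; apply: eq_bigr => t _.
  by rewrite e // rect.
pose E := \bigcap_(t in [set t | (t < T)%N /\ t != j]) (Y t @^-1` A t).
have mE : measurable E.
  by apply: bigcap_measurableType => t [tT _]; apply: mYA.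
have upd B : measurable B ->
    (forall t, (j <= t < T)%N -> exists B' D, [/\ measurable B', measurable D &
       (if t == j then B else A t) = B' `*` D]) ->
    P (Y j @^-1` B `&` E) =
    (P (Y j @^-1` B) * \big[*%E/1%E]_(t < T | t != Ordinal jT) P (Y t @^-1` A t))%E.
  move=> mB rB; have := IH (ltnW jT) (fun t => if t == j then B else A t).
  rewrite (bigD1 (Ordinal jT)) //= eqxx.
  rewrite (eq_bigr (fun t : 'I_T => P (Y t @^-1` A t))); last first.
    by move=> t; rewrite -val_eqE /= => /negbTE ->.
  move=> <- //; last by move=> t; case: ifP.
  congr (P _); apply/seteqP; split => [w [Bw Ew] s /= sT|w h].
    by case: eqP => [->//|/eqP sj]; apply: Ew.
  split; first by have := h j jT; rewrite eqxx.
  by move=> s [sT /negbTE sj]; have := h s sT; rewrite sj.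
have kfin : \big[*%E/1%E]_(t < T | t != Ordinal jT) P (Y t @^-1` A t) \is a fin_num.
  apply: (big_ind (fun x : \bar R => x \is a fin_num)) => // [a b|t _]; first exact: fin_numM.
  by rewrite fin_num_measure //; exact: mYA.
have k0 : (0 <= \big[*%E/1%E]_(t < T | t != Ordinal jT) P (Y t @^-1` A t))%E.
  by apply: (big_ind (fun x : \bar R => (0 <= x)%E)) => // a b; exact: mule_ge0.
pose kap : {nonneg R} := NngNum (fine_ge0 k0).
(* The law of [Y j] on the event [E] against [kap] times the law of [Y j]. They agree on rectangles
   by the induction hypothesis, hence everywhere. *)
pose m1 : {measure set (X * S) -> \bar R} :=
  measure_function_pushforward__canonical__measure_function_Measure (mrestr P mE) (mY j jT).
pose m2 : {measure set (X * S) -> \bar R} := mscale kap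
  (measure_function_pushforward__canonical__measure_function_Measure P (mY j jT)).
have m12 : forall D, measurable D -> m1 D = m2 D.
  apply: (prod_measure_ext m1 m2).
    rewrite /m1 /= /pushforward preimage_setT /mrestr setTI.
    by rewrite -ge0_fin_numE // fin_num_measure.
  move=> A' B' mA' mB'; rewrite /m1 /m2 /= /mscale /pushforward /mrestr /=.
  rewrite upd //; last 2 first.
  - exact: measurableX.
  - by move=> t tT; case: eqP => [_|/eqP tj]; [exists A', B'|apply: rA; natlia].
  by rewrite fineK // muleC.
have -> : \bigcap_(t in `I_T) (Y t @^-1` A t) = Y j @^-1` A j `&` E.
  apply/seteqP; split => [w h|w [hj hE] s /= sT].
    by split; [exact: h|move=> s [sT _]; exact: h].
  by have [->|sj] := eqVneq s j; [|apply: hE].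
rewrite (bigD1 (Ordinal jT)) //=.
have := m12 _ (mA j); rewrite /m1 /m2 /= /mscale /pushforward /mrestr /= => ->.
by rewrite fineK // muleC.
Qed.

End PairLaw.

(** * A finite net of a ball *)

Section FiniteNet.
Context {R : realType} {N : nat}.

Definition grid (m : nat) (a : 'rV[R]_N) (h : R) (k : {ffun 'I_N -> 'I_m}) : 'rV[R]_N :=
  \row_i (a 0 i + (k i)%:R * h).

(** The norm is bounded by the sum over the coordinates, each off by at most the mesh [z / N.+1];
    using [N.+1] avoids a zero divisor in dimension 0. *)
Lemma grid_net (m : nat) (y : 'rV[R]_N) (Q z : R) : 0 <= Q -> 0 < z ->
  2 * Q * N.+1%:R < z * m%:R ->
  forall x, enorm (x - y) <= Q ->
  exists k, enorm (grid m (y - const_mx Q) (z / N.+1%:R) k - x) <= z.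
Proof.
move=> Q0 z0 hm x xy; set h := z / N.+1%:R.
have n0 : 0 < N.+1%:R :> R by rewrite ltr0n.
have h0 : 0 < h by rewrite divr_gt0.
have hc i : 0 <= x 0 i - y 0 i + Q <= 2 * Q.
  have := le_trans (coord_le_enorm (x - y) i) xy.
  by rewrite !mxE ler_norml => /andP[a b]; apply/andP; split; lra.
pose j i := Num.trunc ((x 0 i - y 0 i + Q) / h).
have hj i : (j i)%:R * h <= x 0 i - y 0 i + Q < (j i).+1%:R * h.
  have /andP[c0 _] := hc i.
  by rewrite -ler_pdivlMr // -ltr_pdivrMr // truncn_itv // divr_ge0 // ltW.
have jm i : (j i < m)%N.
  rewrite -(ltr_nat R) -(ltr_pM2r h0); have /andP[a _] := hj i.
  apply: (le_lt_trans a); have /andP[_ b] := hc i; apply: (le_lt_trans b).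
  by rewrite /h mulrA ltr_pdivlMr // (mulrC m%:R).
exists [ffun i => Ordinal (jm i)].
apply: (le_trans (enorm_le_sum _)).
apply: (@le_trans _ _ (\sum_(i < N) h)).
  apply: ler_sum => i _; rewrite !mxE ffunE /=.
  have := hj i; rewrite -natr1 mulrDl mul1r => /andP[a b].
  by rewrite ler_norml; apply/andP; split; lra.
rewrite sumr_const card_ord -[h *+ N]mulr_natr /h -mulrA ler_piMr ?(ltW z0) //.
by rewrite mulrC ler_pdivrMr // mul1r ler_nat.
Qed.

End FiniteNet.

(** * Boundedness of the iterates *)

Section Confinement.
Context {R : realType} {N : nat}.

(** Beyond radius [r] the drift lowers the squared distance by at least [w s * M ^+ 2], which pays
    for the second-order term because [w s <= 1]. Within radius [r] one step adds at most [M]. *)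
Lemma iterates_bounded (w : nat -> R) (u h : nat -> 'rV[R]_N) (a : 'rV[R]_N)
    (M r B : R) T : 0 <= M -> r + M <= B ->
  (forall s, (s < T)%N -> 0 <= w s <= 1) ->
  (forall s, (s < T)%N -> u s.+1 = u s - w s *: h s) ->
  (forall s, (s < T)%N -> enorm (h s) <= M) ->
  (forall s, (s < T)%N -> r <= enorm (u s - a) -> M ^+ 2 / 2 <= dotv (h s) (u s - a)) ->
  enorm (u 0%N - a) <= B -> forall s, (s <= T)%N -> enorm (u s - a) <= B.
Proof.
move=> M0 rB w01 uS hM drift u0; elim=> [|s IH] sT //.
have {}IH := IH (ltnW sT); have /andP[w0 w1] := w01 s sT.
have -> : u s.+1 - a = (u s - a) - w s *: h s.
  by rewrite uS //; apply/rowP => i; rewrite !mxE; ring.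
have wh : w s * enorm (h s) <= w s * M by rewrite ler_wpM2l // hM.
have wM : w s * M <= M by rewrite ler_piMl.
have [ur|ru] := ltP (enorm (u s - a)) r.
  rewrite (le_trans (ler_enormB _ _)) // enormZ ger0_norm //; move: ur rB wh wM; lra.
apply: le_trans IH; rewrite -(@ler_pXn2r _ 2) ?nnegrE ?enorm_ge0 //.
rewrite sqr_enormB enormZ ger0_norm // dotvZr (dotvC (u s - a)).
have d1 := ler_wpM2l w0 (drift s sT ru).
have d2 : (w s * enorm (h s)) ^+ 2 <= w s * M ^+ 2.
  apply: (@le_trans _ _ ((w s * M) ^+ 2)).
    by rewrite ler_pXn2r ?nnegrE ?mulr_ge0 ?enorm_ge0.
  rewrite exprMn ler_wpM2r ?sqr_ge0 // expr2 ler_piMl //.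
move: d1 d2; lra.
Qed.

End Confinement.

(** * Joint measurability of shifted objectives *)

Section Caratheodory.
Context {R : realType} {N : nat} {d : measure_display} {X : measurableType d}.

(* [H y (x - t)] is the infimum over rational points [q] of [H y q + L |x - t - q|]. *)
Lemma measurable_lipschitz_shift (H : X -> 'rV[R]_N -> R) (L : R) (x : 'rV[R]_N) :
  0 <= L -> (forall a, measurable_fun setT (fun y => H y a)) ->
  (forall y a b, `|H y a - H y b| <= L * enorm (a - b)) ->
  measurable_fun setT (fun y : X * N.-tuple R => H y.1 (x - t2rv y.2)).
Proof.
move=> L0 mH lH.
pose q (k : {ffun 'I_N -> rat}) : 'rV[R]_N := \row_i ratr (k i).
pose U (k : {ffun 'I_N -> rat}) (y : X * N.-tuple R) : R :=
  H y.1 (q k) + L * \sum_(i < N) `|x 0 i - tnth y.2 i - ratr (k i)|.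
have mU k : measurable_fun setT (U k).
  apply: measurable_funD.
    by apply: (measurableT_comp (mH (q k))); exact: measurable_fst.
  apply: measurable_funM => //; apply: measurable_sum => i.
  apply: measurableT_comp => //; apply: measurable_funB => //.
  apply: measurable_funB => //.
  by apply: (measurableT_comp (measurable_tnth i)); exact: measurable_snd.
have lU k y : H y.1 (x - t2rv y.2) <= U k y.
  have /ler_normlW h := lH y.1 (x - t2rv y.2) (q k).
  rewrite /U -lerBlDl (le_trans h) // ler_wpM2l // (le_trans (enorm_le_sum _)) //.
  by apply: ler_sum => i _; rewrite !mxE.
have aU y (e : R) : 0 < e -> exists k, U k y < H y.1 (x - t2rv y.2) + e.
  (* The error [L * N * del] arises twice, from moving [a] to [b] and from the added distance term,
     and must stay below [e]. The [+ 1] keeps the divisor positive. *)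
  move=> e0; pose del := e / (2 * L * N%:R + 1).
  have den : 0 < 2 * L * N%:R + 1 by rewrite ltr_wpDl // !mulr_ge0.
  have del0 : 0 < del by rewrite divr_gt0.
  have /choice[k hk] : forall i, exists r : rat, `|x 0 i - tnth y.2 i - ratr r| <= del.
    move=> i; have [r] := @rat_in_itvoo R (x 0 i - tnth y.2 i - del) (x 0 i - tnth y.2 i + del) ltac:(lra).
    by rewrite in_itv /= => /andP[r1 r2]; exists r; rewrite ler_norml; apply/andP; split; lra.
  exists [ffun i => k i]; rewrite /U.
  under eq_bigr do rewrite ffunE.
  set a := x - t2rv y.2; set b := q _.
  have s1 : \sum_(i < N) `|x 0 i - tnth y.2 i - ratr (k i)| <= del * N%:R.
    rewrite mulr_natr -[in leRHS](card_ord N) -sumr_const; exact: ler_sum.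
  have s2 : enorm (b - a) <= del * N%:R.
    apply: le_trans s1; apply: (le_trans (enorm_le_sum _)); apply: ler_sum => i _.
    by rewrite !mxE ffunE -normrN opprB.
  have /ler_normlW h := lH y.1 b a.
  have h1 := ler_wpM2l L0 s1; have h2 := ler_wpM2l L0 s2.
  have h3 : L * (del * N%:R) * 2 < e.
    rewrite (_ : _ * 2 = e * (2 * L * N%:R) / (2 * L * N%:R + 1)); last first.
      by rewrite /del; field; rewrite gt_eqF.
    by rewrite ltr_pdivrMr // ltr_pM2l // ltrDl.
  move: h h1 h2 h3; lra.
move=> mT; apply: (measurability _ (RGenInftyO.measurableE R)) => //.
move=> _ [_ [c ->] <-]; rewrite setTI.
rewrite [X in measurable X](_ : _ = \bigcup_(k : {ffun 'I_N -> rat}) [set y | U k y < c]).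
  apply: countable_bigcupT_measurable; first exact: countableP.
  move=> k; rewrite (_ : [set y | _] = U k @^-1` `]-oo, c[); last first.
    by apply/seteqP; split => y /=; rewrite in_itv.
  by rewrite -[X in measurable X]setTI; apply: mU.
apply/seteqP; split => y /=; rewrite in_itv /=.
  move=> hc; have [k hk] := aU y (c - H y.1 (x - t2rv y.2)) ltac:(lra).
  by exists k => //=; move: hk; lra.
by move=> [k _ /=]; apply: le_lt_trans.
Qed.

Lemma measurable_ballT (r : R) : 0 <= r ->
  measurable ([set t | enorm (t2rv t) <= r] : set (N.-tuple R)).
Proof.
move=> r0; rewrite (_ : [set t | _] = (fun t : N.-tuple R => \sum_(i < N) tnth t i ^+ 2) @^-1`
    `]-oo, r ^+ 2]).
  rewrite -[X in measurable X]setTI; apply: measurable_sum => // i.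
  by apply: measurable_funX; exact: measurable_tnth.
have e (t : N.-tuple R) : (enorm (t2rv t) <= r) = (\sum_(i < N) tnth t i ^+ 2 <= r ^+ 2).
  rewrite -(@ler_pXn2r _ 2) ?nnegrE ?enorm_ge0 // sqr_enorm; congr (_ <= _).
  by apply: eq_bigr => i _; rewrite !mxE -expr2.
by apply/seteqP; split => t /=; rewrite in_itv /= e.
Qed.

End Caratheodory.

(** * Asymptotic comparison of the error terms *)

Section Asymptotics.
Context {R : realType}.

(** By the choice of [m], [m * (1 + y) <= 1 + k * y / 2 <= expR (k * y / 2)]; then square. *)
Lemma sqr1D_le_expR (k : R) : 0 < k ->
  exists2 K, 0 < K & forall y, 0 <= y -> (1 + y) ^+ 2 * expR (- (k * y)) <= K.
Proof.
move=> k0; pose m := Num.min 1 (k / 2).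
have m0 : 0 < m by rewrite lt_min ltr01 divr_gt0.
exists (m ^- 2); first by rewrite invr_gt0 exprn_gt0.
move=> y y0; rewrite expRN ler_pdivrMr ?expR_gt0 // ler_pdivlMl ?exprn_gt0 //.
rewrite (_ : k * y = 2%:R * (k / 2 * y)); last by field.
rewrite expRM_natl -exprMn ler_pXn2r ?nnegrE ?mulr_ge0 ?expR_ge0 ?addr_ge0 ?(ltW m0) //.
apply: le_trans (expR_ge1Dx _); rewrite mulrDr mulr1 lerD //.
  by rewrite ge_min lexx.
by rewrite ler_wpM2r // ge_min lexx orbT.
Qed.

Lemma sqrt_le1D (y : R) : 0 <= y -> Num.sqrt y <= 1 + y.
Proof.
move=> y0; rewrite -(@ler_pXn2r _ 2) ?nnegrE ?sqrtr_ge0 ?addr_ge0 // sqr_sqrtr //.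
by have := sqr_ge0 y; lra.
Qed.

Lemma sqrt_pow5_le (x b : R) : 0 <= b -> 0 <= x -> x <= 2 * b ^+ 2 ->
  Num.sqrt (x ^+ 5) <= 6 * b ^+ 5.
Proof.
move=> b0 x0 xb.
rewrite -(@ler_pXn2r _ 2) ?nnegrE ?sqrtr_ge0 ?mulr_ge0 ?exprn_ge0 //.
rewrite sqr_sqrtr ?exprn_ge0 //.
have : x ^+ 5 <= (2 * b ^+ 2) ^+ 5 by rewrite ler_pXn2r ?nnegrE ?mulr_ge0 ?exprn_ge0.
have : 0 <= b ^+ 10 by rewrite exprn_ge0.
lra.
Qed.

(** To be read with [l = ln (1/eps)], [y = ln T] and [x = 1/p]; then [e] is [T^(-1/20)] and [e ^+ 5]
    is at most of order [eps]. The first two terms have a spare factor [e] against powers of [y].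
    The third has none: it leaves [sqrt y], which only the factor [l] on the right beats. *)
Lemma fine_rate_small (A1 A2 A3 b g : R) : 0 <= A1 -> 0 <= A2 -> 0 <= A3 -> 0 < g ->
  exists l0, forall l y x, l0 <= l -> 4 * l + b <= y -> 0 <= y ->
    0 <= x <= 2 * expR (- (y / 10)) ->
    A1 * x ^+ 5 + A2 * (y * (4 + y)) * x ^+ 3 + A3 * (Num.sqrt y * Num.sqrt (x ^+ 5)) <=
    g * expR (- l) * l.
Proof.
move=> A10 A20 A30 g0.
have [K K0 hK] := @sqr1D_le_expR (1 / 20) ltac:(lra).
pose K1 := 32 * A1 + 32 * K * A2 + 6 * A3.
have K10 : 0 <= K1 by rewrite /K1 !addr_ge0 ?mulr_ge0 // ltW.
have [K2 K2E] : exists r, r = K1 * expR (- (b / 4)) by exists (K1 * expR (- (b / 4))).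
have K20 : 0 <= K2 by rewrite K2E mulr_ge0 ?expR_ge0.
exists (1 + 2 * K2 ^+ 2 * (5 + `|b|) / g ^+ 2) => l y x ll yl y0 /andP[x0 xy].
have q0 : 0 <= 2 * K2 ^+ 2 * (5 + `|b|) / g ^+ 2.
  by rewrite divr_ge0 ?sqr_ge0 // mulr_ge0 ?addr_ge0 // mulr_ge0 ?sqr_ge0.
have l1 : 1 <= l by lra.
pose e := expR (- (y / 20)).
have e0 : 0 < e by rewrite expR_gt0.
have e1 : e <= 1 by rewrite expR_le1 oppr_le0 divr_ge0.
have xe : x <= 2 * e ^+ 2.
  rewrite /e -expRM_natl (_ : 2%:R * - (y / 20) = - (y / 10)) //; by field.
have hKy : (1 + y) ^+ 2 * e <= K.
  by have := hK y y0; rewrite (_ : 1 / 20 * y = y / 20) //; field.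
pose S := Num.sqrt (1 + y).
have y1 : 0 <= 1 + y by rewrite addr_ge0.
have SS : S ^+ 2 = 1 + y by rewrite sqr_sqrtr.
have S1 : 1 <= S by rewrite -(@sqrtr1 R) ler_wsqrtr // lerDl.
have e5 : 0 <= e ^+ 5 by rewrite exprn_ge0 // ltW.
have x5 : x ^+ 5 <= 32 * e ^+ 5.
  have h1 : x ^+ 5 <= (2 * e ^+ 2) ^+ 5.
    by rewrite ler_pXn2r ?nnegrE ?mulr_ge0 ?exprn_ge0 // ltW.
  have h2 : e ^+ 10 <= e ^+ 5 by rewrite ler_wiXn2l // ltW.
  move: h1 h2; lra.
have x3 : y * (4 + y) * x ^+ 3 <= 32 * K * e ^+ 5.
  have h1 : x ^+ 3 <= (2 * e ^+ 2) ^+ 3.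
    by rewrite ler_pXn2r ?nnegrE ?mulr_ge0 ?exprn_ge0 // ltW.
  have h2 : y * (4 + y) * x ^+ 3 <= (4 * (1 + y) ^+ 2) * (2 * e ^+ 2) ^+ 3.
    by apply: ler_pM; rewrite ?mulr_ge0 ?exprn_ge0 ?addr_ge0 //; have := sqr_ge0 y; lra.
  have h3 := ler_wpM2r e5 hKy; move: h2 h3; lra.
have xs : Num.sqrt y * Num.sqrt (x ^+ 5) <= S * (6 * e ^+ 5).
  apply: ler_pM; rewrite ?sqrtr_ge0 //; last by apply: sqrt_pow5_le => //; apply: ltW.
  by rewrite ler_wsqrtr // lerDr.
have main : A1 * x ^+ 5 + A2 * (y * (4 + y)) * x ^+ 3 +
    A3 * (Num.sqrt y * Num.sqrt (x ^+ 5)) <= K1 * (S * e ^+ 5).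
  have Se : e ^+ 5 <= S * e ^+ 5 by rewrite ler_peMl.
  have t1 := ler_wpM2l A10 (le_trans x5 (ler_wpM2l (ler0n R 32) Se)).
  have KK : 0 <= 32 * K by rewrite mulr_ge0 // ltW.
  have t2 := ler_wpM2l A20 (le_trans x3 (ler_wpM2l KK Se)).
  have t3 := ler_wpM2l A30 xs.
  by rewrite /K1; move: t1 t2 t3; lra.
apply: (le_trans main).
(* The excess of [ln T] over its guaranteed value. The factor [expR (- (s / 4))] offsets the growth
   of [S] in [T], so one threshold on [l] serves all horizons. *)
pose s := y - (4 * l + b).
have s0 : 0 <= s by rewrite subr_ge0.
have eE : e ^+ 5 = expR (- (b / 4)) * (expR (- l) * expR (- (s / 4))).
  by rewrite /e -expRM_natl -!expRD; congr expR; rewrite /s; field.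
have key : K2 * (S * expR (- (s / 4))) <= g * l.
  rewrite -(@ler_pXn2r _ 2) ?nnegrE ?mulr_ge0 ?sqrtr_ge0 ?expR_ge0 ?(ltW g0) //; last lra.
  rewrite !exprMn SS -expRM_natl.
  have h1 : (1 + y) * expR (2%:R * - (s / 4)) <= 2 * (1 + 4 * l + `|b|).
    rewrite (_ : 2%:R * - (s / 4) = - (s / 2)); last by field.
    rewrite expRN ler_pdivrMr ?expR_gt0 //.
    have h2 : 1 + s / 2 <= expR (s / 2) := expR_ge1Dx _.
    have bb : b <= `|b| by apply: ler_norm.
    have bn : 0 <= `|b| by [].
    have p1 : 0 <= 1 + 4 * l + `|b| by lra.
    have h3 := ler_wpM2l p1 h2.
    have h4 : 0 <= (4 * l + `|b|) * s by rewrite mulr_ge0 // addr_ge0 //; lra.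
    have yE : y = 4 * l + b + s by rewrite /s; ring.
    rewrite yE; move: h3 h4; lra.
  have h2 : K2 ^+ 2 * ((1 + y) * expR (2%:R * - (s / 4))) <= K2 ^+ 2 * (2 * (1 + 4 * l + `|b|)).
    by rewrite ler_wpM2l ?sqr_ge0.
  apply: (le_trans h2).
  have h3 : 2 * K2 ^+ 2 * (5 + `|b|) <= g ^+ 2 * l.
    by rewrite -ler_pdivrMl ?exprn_gt0 // mulrC; lra.
  have l0' : 0 <= l by lra.
  have h4 := ler_wpM2r l0' h3.
  have h5 : 1 + 4 * l + `|b| <= (5 + `|b|) * l.
    have : `|b| * 1 <= `|b| * l by rewrite ler_wpM2l.
    lra.
  have h6 := ler_wpM2l (sqr_ge0 K2) h5.
  move: h4 h6; lra.
rewrite eE (_ : K1 * _ = expR (- l) * (K2 * (S * expR (- (s / 4))))); last by rewrite K2E; ring.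
rewrite (_ : g * _ * _ = expR (- l) * (g * l)); last ring.
by rewrite ler_wpM2l ?expR_ge0.
Qed.

(** The same reading, with [e] now [T^(-1/60)], which makes every exponent an integer: [x] is of
    order [e ^+ 6] and [e ^+ 10] at most of order [eps]. Each term becomes a constant times [eps],
    spare powers of [e] absorbing [y], and the factor [l] finishes. [H] stands for the smoothing
    bias. *)
Lemma rough_rate_small (A1 A2 A3 H b g : R) :
  0 <= A1 -> 0 <= A2 -> 0 <= A3 -> 0 <= H -> 0 < g ->
  exists l0, forall l y x, l0 <= l -> 6 * l + b <= y -> 0 <= y ->
    0 <= x <= 2 * expR (- (y / 10)) ->
    A1 * (x ^+ 5 / expR (- l)) +
    A2 * ((expR (- l) * x + Num.sqrt y * x ^+ 2) * (4 + y)) +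
    A3 * (Num.sqrt y * Num.sqrt (x ^+ 5)) + H * expR (- l) <= g * expR (- l) * l.
Proof.
move=> A10 A20 A30 H0 g0.
have [K K0 hK] := @sqr1D_le_expR (1 / 60) ltac:(lra).
pose be := expR (- (b / 6)).
have be0 : 0 < be by rewrite expR_gt0.
pose K1 := A1 * (32 * be ^+ 3) + A2 * (8 * K + 16 * K * be) + A3 * (6 * K * be) + H.
have K10 : 0 <= K1.
  have k0 := ltW K0; have b0 := ltW be0.
  by rewrite /K1; do ?[apply: addr_ge0 | apply: mulr_ge0 | apply: exprn_ge0].
exists (K1 / g + 1) => l y x ll yl y0 /andP[x0 xy].
have q0 : 0 <= K1 / g by rewrite divr_ge0 // ltW.
have l0 : 0 <= l by lra.
pose e := expR (- (y / 60)); pose ep := expR (- l).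
have e0 : 0 < e by rewrite expR_gt0.
have e1 : e <= 1 by rewrite expR_le1 oppr_le0 divr_ge0.
have ep0 : 0 < ep by rewrite expR_gt0.
have ep1 : ep <= 1 by rewrite expR_le1 oppr_le0.
have xe : x <= 2 * e ^+ 6.
  rewrite /e -expRM_natl (_ : 6%:R * - (y / 60) = - (y / 10)) //; by field.
have hKy : (1 + y) ^+ 2 * e <= K.
  by have := hK y y0; rewrite (_ : 1 / 60 * y = y / 60) //; field.
have e10 : e ^+ 10 <= be * ep.
  rewrite /e /be /ep -expRM_natl -expRD ler_expR; move: yl; lra.
have en n : 0 <= e ^+ n by rewrite exprn_ge0 // ltW.
have sy := sqrt_le1D y y0; have sy0 := sqrtr_ge0 y.
have sq4 : (1 + y) * (4 + y) <= 4 * (1 + y) ^+ 2 by have := sqr_ge0 y; lra.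
have t1 : x ^+ 5 / ep <= 32 * be ^+ 3 * ep.
  rewrite ler_pdivrMr //.
  have h1 : x ^+ 5 <= (2 * e ^+ 6) ^+ 5 by rewrite ler_pXn2r ?nnegrE ?mulr_ge0 ?(ltW e0).
  have h2 : (e ^+ 10) ^+ 3 <= (be * ep) ^+ 3.
    by rewrite ler_pXn2r ?nnegrE ?mulr_ge0 ?(ltW be0) ?(ltW ep0) ?(ltW e0).
  have h3 : be ^+ 3 * ep ^+ 2 * ep <= be ^+ 3 * ep ^+ 2 * 1.
    by rewrite ler_wpM2l // mulr_ge0 ?exprn_ge0 // ltW.
  move: h1 h2 h3; lra.
have t2 : ep * x * (4 + y) <= 8 * K * ep.
  have h1 : x * (4 + y) <= 2 * e * (4 * (1 + y) ^+ 2).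
    apply: ler_pM => //; first by rewrite addr_ge0.
      by apply: (le_trans xe); rewrite ler_wpM2l // -[leRHS]expr1 ler_wiXn2l // ltW.
    by have := sqr_ge0 y; lra.
  have h2 : x * (4 + y) <= 8 * K by move: h1 hKy; lra.
  have := ler_wpM2l (ltW ep0) h2; lra.
have t3 : Num.sqrt y * x ^+ 2 * (4 + y) <= 16 * K * be * ep.
  have h1 : x ^+ 2 <= (2 * e ^+ 6) ^+ 2 by rewrite ler_pXn2r ?nnegrE ?mulr_ge0 ?(ltW e0).
  have h2 : e ^+ 12 <= e ^+ 11 by rewrite ler_wiXn2l // ltW.
  have h3 : Num.sqrt y * (4 + y) <= 4 * (1 + y) ^+ 2.
    by apply: le_trans sq4; rewrite ler_wpM2r // addr_ge0.
  have h4 : Num.sqrt y * (4 + y) * x ^+ 2 <= 4 * (1 + y) ^+ 2 * (4 * e ^+ 11).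
    apply: ler_pM => //; [by rewrite mulr_ge0 // addr_ge0|by rewrite sqr_ge0|].
    by move: h1 h2; lra.
  have h5 := ler_wpM2r (en 10%N) hKy; have h6 := ler_wpM2l (ltW K0) e10.
  move: h4 h5 h6; lra.
have t4 : Num.sqrt y * Num.sqrt (x ^+ 5) <= 6 * K * be * ep.
  have h1 : Num.sqrt (x ^+ 5) <= 6 * (e ^+ 3) ^+ 5.
    by apply: sqrt_pow5_le => //; rewrite -exprM.
  have h2 : e ^+ 15 <= e ^+ 11 by rewrite ler_wiXn2l // ltW.
  have h3 : Num.sqrt y <= (1 + y) ^+ 2 by apply: (le_trans sy); have := sqr_ge0 y; lra.
  have h4 : Num.sqrt y * Num.sqrt (x ^+ 5) <= (1 + y) ^+ 2 * (6 * e ^+ 11).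
    by apply: ler_pM; rewrite ?sqrtr_ge0 //; move: h1 h2; lra.
  have h5 := ler_wpM2r (en 10%N) hKy; have h6 := ler_wpM2l (ltW K0) e10.
  move: h4 h5 h6; lra.
have main : A1 * (x ^+ 5 / ep) + A2 * ((ep * x + Num.sqrt y * x ^+ 2) * (4 + y)) +
    A3 * (Num.sqrt y * Num.sqrt (x ^+ 5)) + H * ep <= K1 * ep.
  have a1 := ler_wpM2l A10 t1; have a2 := ler_wpM2l A20 (lerD t2 t3).
  by have a3 := ler_wpM2l A30 t4; rewrite /K1; move: a1 a2 a3; lra.
apply: (le_trans main).
have gl : K1 <= g * l by rewrite -ler_pdivrMl // mulrC; lra.
have := ler_wpM2r (ltW ep0) gl; rewrite -/ep; lra.
Qed.

End Asymptotics.

(** * Integrals depend only on the law *)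

Section Transfer.
Context {R : realType} {dX} {X : measurableType dX}.
Context {d1} {O1 : measurableType d1} {P1 : probability O1 R}.
Context {d2} {O2 : measurableType d2} {P2 : probability O2 R}.

Lemma eq_law_integral (Y1 : O1 -> X) (Y2 : O2 -> X) (g : X -> R) :
  measurable_fun setT Y1 -> measurable_fun setT Y2 -> measurable_fun setT g ->
  (forall A, measurable A -> P1 (Y1 @^-1` A) = P2 (Y2 @^-1` A)) ->
  P1.-integrable setT (fun w => (g (Y1 w))%:E) ->
  P2.-integrable setT (fun w => (g (Y2 w))%:E) /\
  (\int[P2]_w (g (Y2 w))%:E = \int[P1]_w (g (Y1 w))%:E)%E.
Proof.
move=> m1 m2 mg e i1.
pose L1 : {measure set X -> \bar R} :=
  measure_function_pushforward__canonical__measure_function_Measure P1 m1.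
pose L2 : {measure set X -> \bar R} :=
  measure_function_pushforward__canonical__measure_function_Measure P2 m2.
have eL (k : X -> \bar R) : (\int[L1]_x k x = \int[L2]_x k x)%E.
  by apply: (eq_measure_integral L2) => A mA _; exact: e.
have mgE : measurable_fun setT (fun x => (g x)%:E) by exact/measurable_EFinP.
have mgA : measurable_fun setT (fun x => `|(g x)%:E|%E) by exact: measurableT_comp.
have i2 : P2.-integrable setT (fun w => (g (Y2 w))%:E).
  apply/integrableP; split; first exact: (measurableT_comp mgE).
  have [_] := integrableP _ _ _ i1; apply: le_lt_trans.
  have := eL (fun x => `|(g x)%:E|%E).
  rewrite !(ge0_integral_pushforward _ _ _ (D := setT)) //=.
  by rewrite !preimage_setT => ->.
split => //.
have := eL (fun x => (g x)%:E).
by rewrite (integral_pushforward m1 mgE i1) // (integral_pushforward m2 mgE i2) //= !preimage_setT.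
Qed.

End Transfer.

(** * Comparison of means and intersection of likely events *)

Section Mean.
Context {R : realType} {d} {Om : measurableType d} {P : probability Om R}.

Lemma integral_dist_le (a b : Om -> R) (al be k : R) :
  P.-integrable setT (EFin \o a) -> P.-integrable setT (EFin \o b) ->
  (\int[P]_w (a w)%:E = al%:E)%E -> (\int[P]_w (b w)%:E = be%:E)%E ->
  (forall w, `|a w - b w| <= k) -> `|al - be| <= k.
Proof.
move=> ia ib ea eb h.
have eab : (\int[P]_w (a w - b w)%:E = (al - be)%:E)%E.
  by under eq_integral do rewrite EFinB; rewrite integralB // ea eb.
have iab : P.-integrable setT (fun w => (a w - b w)%:E).
  by exact: (integrableB measurableT ia ib).
have := le_abse_integral P measurableT (measurable_int _ iab).
rewrite eab => h1; rewrite -lee_fin; apply: (le_trans h1).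
apply: (@le_trans _ _ (\int[P]_w (cst k%:E w))%E).
  apply: ge0_le_integral => //.
  - by apply: measurableT_comp => //; exact: measurable_int iab.
  - by move=> w _; rewrite lee_fin.
by rewrite integral_cst // [X in (_ * X)%E]probability_setT mule1.
Qed.

Lemma probability_setI_ge (A B : set Om) (a b : R) : measurable A -> measurable B ->
  ((1 - a)%:E <= P A)%E -> ((1 - b)%:E <= P B)%E -> ((1 - (a + b))%:E <= P (A `&` B))%E.
Proof.
move=> mA mB hA hB; have mAB := measurableI _ _ mA mB.
have : (P (~` (A `&` B)) <= P (~` A) + P (~` B))%E.
  by rewrite setCI; apply: measureU2; exact: measurableC.
rewrite !probability_setC //.
rewrite -(fineK (fin_num_measure P _ mA)) -(fineK (fin_num_measure P _ mB)) in hA hB *.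
rewrite -(fineK (fin_num_measure P _ mAB)).
by move: hA hB; rewrite -!EFinB -EFinD !lee_fin => *; lra.
Qed.

End Mean.

(** * From the horizon to the integer scale *)

Section Scale.
Context {R : realType}.

Lemma tenth_root T : (2 ^ 10 <= T)%N -> exists2 p, (1 < p)%N & (p ^ 10 <= T < p.+1 ^ 10)%N.
Proof.
move=> T2.
have bnd i : (i ^ 10 <= T)%N -> (i <= T)%N.
  by move=> h; apply: leq_trans h; case: i => // i; rewrite -{1}(expn1 i.+1) leq_pexp2l.
have ex0 : exists i, (i ^ 10 <= T)%N by exists 2%N.
case: (ex_maxnP ex0 bnd) => p pT pmax; exists p; first exact: pmax.
rewrite pT /= ltnNge; apply/negP => /pmax; by rewrite ltnn.
Qed.

Lemma inv_tenth_root_le (T p : nat) : (0 < p)%N -> (p ^ 10 <= T < p.+1 ^ 10)%N ->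
  (p%:R^-1 : R) <= 2 * expR (- (ln T%:R / 10)).
Proof.
move=> p0 /andP[pT Tp].
have T0 : 0 < T%:R :> R by rewrite ltr0n (leq_trans _ pT) // expn_gt0 p0.
have pR : 0 < p%:R :> R by rewrite ltr0n.
have h : expR (ln T%:R / 10) <= 2 * p%:R :> R.
  rewrite -(@ler_pXn2r _ 10) ?nnegrE ?expR_ge0 ?mulr_ge0 ?(ltW pR) //.
  rewrite -expRM_natl (_ : 10%:R * (ln T%:R / 10) = ln T%:R); last by field.
  rewrite lnK ?posrE // -natrM -natrX ler_nat (leq_trans (ltnW Tp)) // leq_exp2r //.
  by rewrite mul2n -addnn -addn1 leq_add2l.
by rewrite expRN ler_pdivlMr ?expR_gt0 // mulrC ler_pdivrMr.
Qed.

Lemma sqr_le_ceil (a : R) (T : nat) : 0 <= a ->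
  (Num.ceil (a + 1))%:~R ^+ 2 - 1 <= (T%:R : R) -> a ^+ 2 <= T%:R.
Proof.
move=> a0 h; have c := ceil_ge (a + 1).
have : (a + 1) ^+ 2 <= (Num.ceil (a + 1))%:~R ^+ 2 :> R.
  by rewrite ler_pXn2r ?nnegrE ?(le_trans _ c) // addr_ge0.
by move: h; lra.
Qed.

(** At this level each tail is [T^-(4N+9)], and there are at most [T^(4N+8)] events when the net has
    [T^(2N)] points, so [1/T] is left. *)
Lemma union_bound_tail (T N : nat) : (2 <= T)%N ->
  (((T ^ (2 * N) * T.+2) * T.+1) ^ 2)%:R *
    expR (- (Num.sqrt (8 * (4 * N%:R + 9) * ln T%:R) ^+ 2 / 8)) <= T%:R^-1 :> R.
Proof.
move=> T2.
have T0 : 0 < T%:R :> R by rewrite ltr0n (leq_trans _ T2).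
have lT0 : 0 <= ln T%:R :> R by rewrite ln_ge0 // ler1n (leq_trans _ T2).
rewrite sqr_sqrtr; last by rewrite mulr_ge0 // mulr_ge0 // addr_ge0 // mulr_ge0.
rewrite (_ : 8 * (4 * N%:R + 9) * ln T%:R / 8 = (4 * N + 9)%:R * ln T%:R); last first.
  by rewrite natrD natrM; field.
rewrite expRN expRM_natl lnK ?posrE //.
rewrite ler_pdivrMr ?exprn_gt0 // ler_pdivlMl // -natrX -natrM ler_nat.
have h1 : (T.+2 <= T * T)%N by nia.
have h2 : (T.+1 <= T * T)%N by nia.
apply: (@leq_trans (T * ((T ^ (2 * N) * (T * T)) * (T * T)) ^ 2)).
  by rewrite leq_mul2l leq_exp2r // leq_mul ?orbT // leq_mul.
by rewrite !mulnn -!expnD -expnM -expnS; apply: eq_leq; congr (_ ^ _)%N; lia.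
Qed.

End Scale.

(** * The good event for a concrete net *)

Section GridEvent.
Context {R : realType} {N : nat} {d} {Om : measurableType d} {P : probability Om R}.
Context {dX} {X : measurableType dX}.

(** With [T ^ 2] grid values per coordinate precision [p^-10] is reached: since [p ^ 10 <= T], the
    product of [T ^ 2] and this precision is at least [T], which exceeds [2 * Q * N.+1]. *)
Lemma grid_good_event (Y : nat -> Om -> X) (T T0 p : nat) (Phi : X -> 'rV[R]_N -> R)
    (Phib : 'rV[R]_N -> R) (hb : 'rV[R]_N -> 'rV[R]_N) (Q : R) (w : nat -> R) (x0 : 'rV[R]_N) :
  (forall t, (t < T)%N -> measurable_fun setT (Y t)) -> indep_family P Y T ->
  (forall x, measurable_fun setT (fun y => Phi y x)) ->
  (forall y x x', `|Phi y x - Phi y x'| <= Q * enorm (x - x')) ->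
  (forall x x', `|Phib x - Phib x'| <= Q * enorm (x - x')) ->
  (forall t x, (t < T)%N -> P.-integrable setT (fun om => (Phi (Y t om) x)%:E) /\
     (\int[P]_om (Phi (Y t om) x)%:E = (Phib x)%:E)%E) ->
  (forall t, (t < T)%N -> 0 <= w t) -> 0 <= Q -> (2 <= T)%N ->
  2 * Q * N.+1%:R < T%:R -> (0 < p)%N -> (p ^ 10 <= T)%N ->
  exists A Z, [/\ measurable A, ((1 - T%:R^-1)%:E <= P A)%E,
    (forall om, A om -> small_noise w (fun t => Phi (Y t om)) Phib hb Q
       (Num.sqrt (8 * (4 * N%:R + 9) * ln T%:R)) T0 T Z) &
    (forall x, enorm (x - x0) <= Q -> exists2 z, Z z & enorm (z - x) <= p%:R^-1 ^+ 10)].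
Proof.
move=> mY ind mPhi lPhi lPhib iPhi w0 Q0 T2 QT p0 pT.
pose zp := grid (T ^ 2) (x0 - const_mx Q) (p%:R^-1 ^+ 10 / N.+1%:R : R).
have [A [mA hA] PA] := @good_event _ _ _ _ _ _ _ Y T T0 Phi Phib hb Q
  (Num.sqrt (8 * (4 * N%:R + 9) * ln T%:R)) w _ zp
  mY ind mPhi lPhi lPhib iPhi w0 Q0 (sqrtr_ge0 _).
exists A, (range zp); split => //.
  apply: le_trans PA; rewrite lee_fin lerD2l lerN2 card_ffun !card_ord -expnM.
  exact: union_bound_tail.
move=> x xQ; have p10 : 0 < p%:R^-1 ^+ 10 :> R by rewrite exprn_gt0 // invr_gt0 ltr0n.
have [|k hk] := @grid_net _ _ (T ^ 2) x0 Q (p%:R^-1 ^+ 10) Q0 p10 _ x xQ.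
  apply: (lt_le_trans QT); rewrite exprVn -natrX mulrC ler_pdivlMr ?ltr0n ?expn_gt0 ?p0 //.
  by rewrite -natrM ler_nat -mulnn leq_mul2l pT orbT.
by exists (zp k) => //; exists k.
Qed.

End GridEvent.

(** * Penalized objectives *)

Section Penalty.
Context {R : realType} {N : nat}.
Variables (C : set 'rV[R]_N) (proj : 'rV[R]_N -> 'rV[R]_N) (dpsi : 'rV[R]_N -> 'rV[R]_N).
Variables (G : R) (uopt : 'rV[R]_N).
Hypothesis cptC : compact C.
Hypothesis cvxC : convex_set C.
Hypothesis projP : is_proj C proj.
Hypothesis dpsiP : forall y, subgrad (psiC C) (dpsi y) y /\ enorm (dpsi y) <= 1.
Hypothesis Copt : C uopt.
Hypothesis G0 : 0 <= G.

Definition penalized (g : 'rV[R]_N -> R) (x : 'rV[R]_N) : R := g x + 2 * G * psiC C x.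

Let psi_lip x y : `|psiC C x - psiC C y| <= enorm (x - y).
Proof.
rewrite -[leRHS]mul1r; apply: (@subgrad_lipschitz _ _ _ dpsi).
  by move=> z; have [] := dpsiP z.
by move=> z; have [] := dpsiP z.
Qed.

Lemma penalized_lip (g : 'rV[R]_N -> R) (dg : 'rV[R]_N -> 'rV[R]_N) x y :
  (forall z, subgrad g (dg z) z) -> (forall z, enorm (dg z) <= G) ->
  `|penalized g x - penalized g y| <= 3 * G * enorm (x - y).
Proof.
move=> hg hG; have := subgrad_lipschitz g dg G x y hg hG.
have G2 : 0 <= 2 * G by rewrite mulr_ge0.
have := ler_wpM2l G2 (psi_lip x y).
rewrite /penalized !ler_norml -[X in X * `|_|]ger0_norm // -normrM ler_norml.
move=> /andP[a b] /andP[c e]; apply/andP; split; lra.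
Qed.

Lemma penalized_subgrad (g : 'rV[R]_N -> R) gx x :
  subgrad g gx x -> subgrad (penalized g) (gx + (2 * G) *: dpsi x) x.
Proof.
move=> hg z; have := hg z; have [h _] := dpsiP x; have := h z.
have G2 : 0 <= 2 * G by rewrite mulr_ge0.
move=> /(ler_wpM2l G2); rewrite dotvDl dotvZl /penalized; lra.
Qed.

Lemma penalized_grad_le gx x : enorm gx <= G -> enorm (gx + (2 * G) *: dpsi x) <= 3 * G.
Proof.
move=> hg; rewrite (le_trans (ler_enormD _ _)) // enormZ ger0_norm ?mulr_ge0 //.
have G2 : 0 <= 2 * G by rewrite mulr_ge0.
by have [_ /(ler_wpM2l G2)] := dpsiP x; move: hg; lra.
Qed.

Lemma diam_ge0 : 0 <= diam C.
Proof. by apply: le_trans (enorm_le_diam C cptC uopt uopt Copt Copt); exact: enorm_ge0. Qed.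

(** The penalty grows at least like the distance to [C], so it pulls with strength [2 * G] while
    [gx] pushes with at most [G]. The subgradients are taken at a shifted point [x], at distance at
    most 1 from [u], which enters the constant. *)
Lemma penalized_drift gx x u : enorm gx <= G -> enorm (u - x) <= 1 ->
  G * (enorm (u - uopt) - 2 * diam C - 4) <= dotv (gx + (2 * G) *: dpsi x) (u - uopt).
Proof.
move=> hg ux; have D0 := diam_ge0.
have a1 := cauchy_schwarz_abs gx (u - uopt); have := a1; rewrite ler_norml => /andP[{}a1 _].
have a2 := ler_wpM2r (enorm_ge0 (u - uopt)) hg.
have [sx nx] := dpsiP x.
have b1 : psiC C x - psiC C uopt <= dotv (dpsi x) (x - uopt).
  by have := sx uopt; rewrite -(opprB x uopt) dotvNr; lra.
have b2 := psiC_le0 C uopt Copt.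
have b3 := enorm_proj_le_psiC C cptC proj cvxC projP x.
have b4 := ler_enorm_dist (proj x) x uopt.
have b5 : enorm (proj x - uopt) <= diam C.
  by apply: enorm_le_diam => //; have [] := projP x.
have b6 := ler_enorm_dist x u uopt.
have c1 := cauchy_schwarz_abs (dpsi x) (u - x); have := c1; rewrite ler_norml => /andP[{}c1 _].
have c2 : enorm (dpsi x) * enorm (u - x) <= 1 by rewrite mulr_ile1 ?enorm_ge0.
have e : dotv (dpsi x) (u - uopt) = dotv (dpsi x) (x - uopt) + dotv (dpsi x) (u - x).
  by rewrite -dotvDr; congr dotv; apply/rowP => i; rewrite !mxE; ring.
have lb : enorm (u - uopt) - diam C - 2 <= dotv (dpsi x) (u - uopt).
  by rewrite e; move: b1 b2 b3 b4 b5 b6 c1 c2 ux; lra.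
have G2 : 0 <= 2 * G by rewrite mulr_ge0.
have := ler_wpM2l G2 lb; rewrite dotvDl dotvZl; move: a1 a2 D0; lra.
Qed.

(** Projecting [y] raises [g] by at most [G] times the distance to [C], and the penalty at [y] is at
    least twice that. *)
Lemma penalized_gap (g : 'rV[R]_N -> R) (dg : 'rV[R]_N -> 'rV[R]_N) y :
  (forall z, subgrad g (dg z) z) -> (forall z, enorm (dg z) <= G) ->
  g (proj y) - g uopt <= penalized g y - penalized g uopt.
Proof.
move=> hg hG; have := subgrad_lipschitz g dg G (proj y) y hg hG.
rewrite ler_norml enorm_distC => /andP[_ a].
have b := ler_wpM2l G0 (enorm_proj_le_psiC C cptC proj cvxC projP y).
have c := mulr_ge0 G0 (psiC_ge0 C cptC y).
have G2 : 0 <= 2 * G by rewrite mulr_ge0.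
have e := ler_wpM2l G2 (psiC_le0 C uopt Copt).
by rewrite /penalized; move: a b c e; lra.
Qed.

Lemma degenerate_gap (g : 'rV[R]_N -> R) (dg : 'rV[R]_N -> 'rV[R]_N) y :
  (forall z, subgrad g (dg z) z) -> (forall z, enorm (dg z) <= G) ->
  G * diam C = 0 -> g (proj y) - g uopt <= 0.
Proof.
move=> hg hG GD; have := subgrad_lipschitz g dg G (proj y) uopt hg hG.
rewrite ler_norml => /andP[_ a]; have [Cy _] := projP y.
have := ler_wpM2l G0 (enorm_le_diam C cptC _ _ Cy Copt); move: a; lra.
Qed.

(** With step bound [3 * G] the drift suffices beyond [2 * diam C + 4 + 9/2 * G], and one step adds
    [3 * G]. Rounded up, the same number is at least 1 and bounds all subgradients, so a single [Q]
    serves as radius and Lipschitz constant. *)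
Definition confinement_radius : R := 2 * diam C + 5 + 8 * G.

Lemma confinement_radius_ge1 : 1 <= confinement_radius.
Proof. by have := diam_ge0; rewrite /confinement_radius; have := G0; lra. Qed.

Lemma penalized_confined (w : nat -> R) (u x gx : nat -> 'rV[R]_N) T :
  C (u 0%N) -> (forall s, (s < T)%N -> 0 <= w s <= 1) ->
  (forall s, (s < T)%N -> u s.+1 = u s - w s *: (gx s + (2 * G) *: dpsi (x s))) ->
  (forall s, (s < T)%N -> enorm (gx s) <= G) ->
  (forall s, (s < T)%N -> enorm (u s - x s) <= 1) ->
  forall s, (s <= T)%N -> enorm (u s - uopt) <= confinement_radius.
Proof.
move=> Cu w01 uS hg ux; have D0 := diam_ge0; have g0 := G0.
apply: (@iterates_bounded _ _ w u (fun s => gx s + (2 * G) *: dpsi (x s)) uopt (3 * G)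
  (2 * diam C + 4 + 9 / 2 * G)) => //.
- by rewrite mulr_ge0.
- by rewrite /confinement_radius; lra.
- by move=> s sT; apply: penalized_grad_le; exact: hg.
- move=> s sT ru; apply: le_trans (penalized_drift _ _ _ (hg s sT) (ux s sT)).
  have r0 : 9 / 2 * G <= enorm (u s - uopt) - 2 * diam C - 4 by move: ru; lra.
  by have := ler_wpM2l G0 r0; lra.
- by have := enorm_le_diam C cptC _ _ Cu Copt; rewrite /confinement_radius; lra.
Qed.

End Penalty.

(** * Last-iterate bounds for the algorithm with and without smoothing *)

Section Unsmoothed.
Context {R : realType} {N : nat}.
Variables (C : set 'rV[R]_N) (proj : 'rV[R]_N -> 'rV[R]_N) (dpsi : 'rV[R]_N -> 'rV[R]_N).
Context {dD} {Xi : measurableType dD} {PD : probability Xi R}.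
Variables (F : Xi -> 'rV[R]_N -> R) (dF : Xi -> 'rV[R]_N -> 'rV[R]_N).
Variables (f : 'rV[R]_N -> R) (df : 'rV[R]_N -> 'rV[R]_N).
Variables (G : R) (uopt u1 : 'rV[R]_N).
Hypothesis cptC : compact C.
Hypothesis cvxC : convex_set C.
Hypothesis projP : is_proj C proj.
Hypothesis dFP : forall xi x, subgrad (F xi) (dF xi x) x.
Hypothesis F_int : forall x, PD.-integrable setT (fun xi => (F xi x)%:E).
Hypothesis f_mean : forall x, (f x)%:E = (\int[PD]_xi (F xi x)%:E)%E.
Hypothesis dfP : forall x, subgrad f (df x) x.
Hypothesis dF_le : forall xi x, enorm (dF xi x) <= G.
Hypothesis df_le : forall x, enorm (df x) <= G.
Hypothesis Copt : C uopt.
Hypothesis Cu1 : C u1.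
Hypothesis dpsiP : forall y, subgrad (psiC C) (dpsi y) y /\ enorm (dpsi y) <= 1.

Let G0 : 0 <= G.
Proof. exact: le_trans (enorm_ge0 _) (df_le 0). Qed.

Let Q := confinement_radius C G.
Let Q1 : 1 <= Q. Proof. by apply: confinement_radius_ge1 => //; exact: Copt. Qed.
Let G3Q : 3 * G <= Q.
Proof. by rewrite /Q /confinement_radius; have := G0; have := diam_ge0 C _ cptC Copt; lra. Qed.

Let lip_le (a b : R) : `|a| <= 3 * G * b -> 0 <= b -> `|a| <= Q * b.
Proof. by move=> h b0; apply: (le_trans h); rewrite ler_wpM2r. Qed.

Lemma penalized_measurable x : measurable_fun setT (fun xi => penalized C G (F xi) x).
Proof.
apply: measurable_funD => //.
by apply/measurable_EFinP; exact: (measurable_int _ (F_int x)).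
Qed.

Lemma penalized_integrable x : PD.-integrable setT (fun xi => (penalized C G (F xi) x)%:E).
Proof.
rewrite /penalized; under eq_fun do rewrite EFinD.
apply: integrableD => //.
exact: (finite_measure_integrable_cst PD (2 * G * psiC C x)).
Qed.

Lemma penalized_mean x : (\int[PD]_xi (penalized C G (F xi) x)%:E = (penalized C G f x)%:E)%E.
Proof.
under eq_integral do rewrite /penalized EFinD.
rewrite integralD //; last by exact: (finite_measure_integrable_cst PD (2 * G * psiC C x)).
by rewrite -f_mean integral_cst // [X in (_ * X)%E]probability_setT mule1.
Qed.

Lemma penalized_law x d (Om : measurableType d) (P : probability Om R) (Y : Om -> Xi) :
  has_law P PD Y -> P.-integrable setT (fun om => (penalized C G (F (Y om)) x)%:E) /\
    (\int[P]_om (penalized C G (F (Y om)) x)%:E = (penalized C G f x)%:E)%E.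
Proof.
move=> [mY lY]; rewrite -penalized_mean.
apply: (@eq_law_integral _ _ _ _ _ PD _ _ P id Y (fun y => penalized C G (F y) x)) => //.
- exact: penalized_measurable.
- by move=> B mB; rewrite lY.
- exact: penalized_integrable.
Qed.

Lemma learning_rate01 (c : R) s : 0 <= c <= 1 -> 0 <= c / Num.sqrt s.+1%:R <= 1.
Proof.
move=> /andP[c0 c1].
have s1 : 1 <= Num.sqrt s.+1%:R :> R by rewrite -[leLHS]sqrtr1 ler_wsqrtr // ler1n.
have s0 : 0 < Num.sqrt s.+1%:R :> R := lt_le_trans ltr01 s1.
by rewrite divr_ge0 ?(ltW s0) // ler_pdivrMr // mul1r (le_trans c1).
Qed.

(** The mean objective has the explicit subgradient [df x + (2 * G) *: dpsi x], so its descents are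
    available as reference paths and [rate_fine] applies. *)
Lemma unsmoothed_bound (T p : nat) d (Om : measurableType d) (P : probability Om R)
    (xi : nat -> Om -> Xi) (lam := Num.sqrt (8 * (4 * N%:R + 9) * ln T%:R) : R) :
  (forall t, (t < T)%N -> has_law P PD (xi t)) -> indep_family P xi T ->
  (2 <= T)%N -> 2 * Q * N.+1%:R < T%:R -> (1 < p)%N -> (p ^ 10 <= T < p.+1 ^ 10)%N ->
  1 <= lam -> 30 * lam / p%:R <= 1 ->
  exists A : set Om, [/\ measurable A, ((1 - T%:R^-1)%:E <= P A)%E &
    forall w, A w ->
      f (proj (ssgd_iter u1 (fun s => 1 / Num.sqrt s%:R)
                 (fun t x => dF (xi t w) x + (2 * G) *: dpsi x) (fun _ => 0) T)) - f uopt <=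
      64 ^+ 2 * (Q ^+ 2 * p%:R^-1 ^+ 5 / (2 * 1) +
        257 * Q ^+ 2 * lam ^+ 2 * p%:R^-1 ^+ 3 * (4 + ln T%:R) +
        208 * Q ^+ 2 * lam * Num.sqrt (p%:R^-1 ^+ 5))].
Proof.
move=> law ind T2 QT p2 pT lam1 lamp.
pose wt s : R := 1 / Num.sqrt s.+1%:R.
have w01 s : 0 <= wt s <= 1 by apply: learning_rate01; rewrite ler01 lexx.
have Q0 : 0 <= Q := le_trans ler01 Q1.
have p0 : (0 < p)%N := ltnW p2.
have /andP[pT1 _] := pT.
pose H xi := penalized C G (F xi).
have Hl y x x' : `|H y x - H y x'| <= Q * enorm (x - x').
  by apply: lip_le; [apply: (penalized_lip _ dpsi _ dpsiP G0 _ (dF y)) => //|exact: enorm_ge0].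
have fl x x' : `|penalized C G f x - penalized C G f x'| <= Q * enorm (x - x').
  by apply: lip_le; [apply: (penalized_lip _ dpsi _ dpsiP G0 _ df) => //|exact: enorm_ge0].
have iH t x : (t < T)%N -> P.-integrable setT (fun om => (H (xi t om) x)%:E) /\
    (\int[P]_om (H (xi t om) x)%:E = (penalized C G f x)%:E)%E.
  by move=> tT; exact: penalized_law (law t tT).
have [A [Z [mA PA hA net]]] := grid_good_event xi T T./2 p H (penalized C G f)
  (fun x => df x + (2 * G) *: dpsi x) Q wt uopt (fun t tT => (law t tT).1) ind
  penalized_measurable Hl fl iH (fun t _ => (andP (w01 t)).1) Q0 T2 QT p0 pT1.
exists A; split => // om Aom.
pose u := ssgd_iter u1 (fun s => 1 / Num.sqrt s%:R)
  (fun t x => dF (xi t om) x + (2 * G) *: dpsi x) (fun _ => 0).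
pose gx s := dF (xi s om) (u s).
have uS s : u s.+1 = u s - wt s *: (gx s + (2 * G) *: dpsi (u s)).
  by rewrite /u /= subr0.
apply: le_trans (penalized_gap C proj G uopt cptC cvxC projP Copt G0 f df _ dfP df_le) _.
apply: (@rate_fine _ _ wt u (fun s => gx s + (2 * G) *: dpsi (u s)) (fun s => H (xi s om))
  (penalized C G f) (fun x => df x + (2 * G) *: dpsi x) Q _ 1 T p Z uopt) => //.
- by rewrite ltr01 lexx.
- by move=> s sT; exact: (penalized_subgrad _ _ _ dpsiP G0 _ _ _ (dFP _ _)).
- move=> s sT; apply: le_trans G3Q.
  by exact: (penalized_grad_le _ _ _ dpsiP G0 _ _ (dF_le _ _)).
- by move=> x; apply: le_trans G3Q; exact: (penalized_grad_le _ _ _ dpsiP G0 _ _ (df_le _)).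
- exact: hA.
- move=> s sT; apply: (penalized_confined C proj dpsi G uopt cptC cvxC projP dpsiP Copt G0
    wt u u gx T) => // s' _; first exact: dF_le.
  by rewrite subrr enorm0.
- by move=> y; exact: (penalized_subgrad _ _ _ dpsiP G0 _ _ _ (dfP _)).
Qed.

(* Outside the ball, an event of probability zero, the shift is dropped: the distance to
   the unsmoothed objective is then bounded everywhere. *)
Definition smoothed (r : R) (y : Xi * N.-tuple R) (x : 'rV[R]_N) : R :=
  penalized C G (F y.1) (if enorm (t2rv y.2) <= r then x - t2rv y.2 else x).

Lemma smoothed_lip r y x x' : `|smoothed r y x - smoothed r y x'| <= 3 * G * enorm (x - x').
Proof.
rewrite /smoothed; case: ifP => _; last exact: (penalized_lip _ dpsi _ dpsiP G0 _ (dF y.1)).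
apply: le_trans (penalized_lip _ dpsi _ dpsiP G0 _ (dF y.1) _ _ _ _) _ => //.
by rewrite (_ : _ - _ - _ = x - x') //; apply/rowP => i; rewrite !mxE; ring.
Qed.

Lemma smoothed_near r y x : 0 <= r ->
  `|smoothed r y x - penalized C G (F y.1) x| <= 3 * G * r.
Proof.
move=> r0; rewrite /smoothed; case: ifP => [yr|_]; last by rewrite subrr normr0 !mulr_ge0.
apply: le_trans (penalized_lip _ dpsi _ dpsiP G0 _ (dF y.1) _ _ _ _) _ => //.
rewrite ler_wpM2l ?mulr_ge0 // (_ : x - _ - x = - t2rv y.2) ?enormN //.
by rewrite addrAC subrr add0r.
Qed.

Lemma smoothed_measurable r x : 0 <= r -> measurable_fun setT (fun y => smoothed r y x).
Proof.
move=> r0.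
rewrite (_ : (fun y => _) = fun y : Xi * N.-tuple R => if enorm (t2rv y.2) <= r
  then penalized C G (F y.1) (x - t2rv y.2) else penalized C G (F y.1) x); last first.
  by apply/funext => y; rewrite /smoothed; case: ifP.
apply: measurable_fun_ifT.
- apply: (measurable_fun_bool true); rewrite setTI.
  rewrite (_ : _ @^-1` _ = setT `&` snd @^-1` [set t : N.-tuple R | enorm (t2rv t) <= r]).
    by apply: measurable_snd => //; exact: measurable_ballT.
  by rewrite setTI; apply/seteqP; split => y /=.
- apply: (@measurable_lipschitz_shift _ _ _ _ (fun xi => penalized C G (F xi)) (3 * G)).
  + by rewrite mulr_ge0.
  + exact: penalized_measurable.
  + by move=> y a b; exact: (penalized_lip _ dpsi _ dpsiP G0 _ (dF y)).
- by apply: (measurableT_comp (penalized_measurable x)); exact: measurable_fst.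
Qed.

Lemma rv2tK : cancel (@rv2t R N) (@t2rv R N).
Proof. by move=> V; apply/rowP => i; rewrite mxE tnth_mktuple. Qed.

Lemma smoothed_subgrad r (V x : 'rV[R]_N) xi : enorm V <= r ->
  subgrad (smoothed r (xi, rv2t V)) (dF xi (x - V) + (2 * G) *: dpsi (x - V)) x.
Proof.
move=> Vr z; rewrite /smoothed /= rv2tK Vr.
have := penalized_subgrad _ _ _ dpsiP G0 _ _ _ (dFP xi (x - V)) (z - V).
by rewrite (_ : z - V - (x - V) = z - x) //; apply/rowP => i; rewrite !mxE; ring.
Qed.

Lemma iint0 n : @iint R n (fun=> 0%E) = 0%E.
Proof. by elim: n => //= n ->; rewrite integral0. Qed.

Lemma uniform_ball_out d (Om : measurableType d) (P : probability Om R) (V : Om -> 'rV[R]_N) r :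
  0 <= r -> uniform_ball_law P V r ->
  measurable [set w | r < enorm (V w)] /\ P [set w | r < enorm (V w)] = 0%E.
Proof.
move=> r0 [mV lV]; have mB := @measurable_ballT R N r r0.
have e : [set w | r < enorm (V w)] = (fun w => rv2t (V w)) @^-1` (~` @ballT R N r).
  by apply/seteqP; split => w /=; rewrite /ballT /= rv2tK ltNge => /negP.
rewrite e; split.
  by rewrite -[X in measurable X]setTI; apply: mV => //; exact: measurableC.
rewrite lV; last exact: measurableC.
rewrite setICl /volN (_ : (fun t => _) = fun=> 0%E); last first.
  by apply/funext => t; rewrite indic0.
by rewrite iint0 mul0e.
Qed.

Section SmoothedNoise.
Context {d} {Om : measurableType d} {P : probability Om R}.
Variables (xi : nat -> Om -> Xi) (v : nat -> Om -> 'rV[R]_N) (T : nat) (r : R).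
Hypothesis r01 : 0 < r <= 1.
Hypothesis law : forall t, (t < T)%N -> has_law P PD (xi t).
Hypothesis lawv : forall t, (t < T)%N -> uniform_ball_law P (v t) r.
Hypothesis ind : indep_family2 P xi (fun t w => rv2t (v t w)) T.

Let r0 : 0 <= r. Proof. by have /andP[/ltW] := r01. Qed.

Let Y t w : Xi * N.-tuple R := (xi t w, rv2t (v t w)).

Let mY t : (t < T)%N -> measurable_fun setT (Y t).
Proof. by move=> tT; apply: measurable_fun_pair; [exact: (law _ tT).1|exact: (lawv _ tT).1]. Qed.

Let indep := indep_family_pair xi (fun t w => rv2t (v t w)) T
  (fun t tT => (law t tT).1) (fun t tT => (lawv t tT).1) ind.

(** On rectangles the law of a pair is the product of the prescribed marginals, the same at all
    times; one mean function therefore serves every step. *)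
Let Y_law s t : (s < T)%N -> (t < T)%N ->
  forall D, measurable D -> P (Y s @^-1` D) = P (Y t @^-1` D).
Proof.
move=> sT tT; have [_ rect] := indep.
pose L q (qT : (q < T)%N) : {measure set (Xi * N.-tuple R) -> \bar R} :=
  measure_function_pushforward__canonical__measure_function_Measure P (mY q qT).
apply: (prod_measure_ext (L s sT) (L t tT)).
  rewrite /= /pushforward preimage_setT.
  by rewrite -ge0_fin_numE // fin_num_measure.
move=> A B mA mB; rewrite /= /pushforward.
have e q : (q < T)%N -> P (Y q @^-1` (A `*` B)) =
    (PD A * (volN (B `&` @ballT R N r) * ((fine (volN (@ballT R N r)))^-1)%:E))%E.
  move=> qT; rewrite -[X in (X * _)%E](law q qT).2 // -(lawv q qT).2 //.
  exact: rect.
by rewrite !e.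
Qed.

Let near_int t x : (t < T)%N -> P.-integrable setT (fun om => (smoothed r (Y t om) x)%:E).
Proof.
move=> tT; have [iH _] := penalized_law x _ _ _ _ (law t tT).
have ib : P.-integrable setT (fun om => (`|penalized C G (F (xi t om)) x| + 3 * G * r)%:E).
  under eq_fun do rewrite EFinD.
  apply: integrableD => //; first exact: (integrable_abse iH).
  exact: (finite_measure_integrable_cst P (3 * G * r)).
apply: le_integrable ib => //.
  apply/measurable_EFinP; apply: (measurableT_comp (smoothed_measurable r x r0)).
  exact: mY.
move=> om _; rewrite lee_fin [leRHS]ger0_norm ?addr_ge0 ?mulr_ge0 //.
rewrite -lerBlDl (le_trans (lerB_dist _ _)) //; exact: smoothed_near.
Qed.

Lemma smoothed_mean : exists Phib : 'rV[R]_N -> R,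
  [/\ forall t x, (t < T)%N -> P.-integrable setT (fun om => (smoothed r (Y t om) x)%:E) /\
        (\int[P]_om (smoothed r (Y t om) x)%:E = (Phib x)%:E)%E,
      forall x x', `|Phib x - Phib x'| <= 3 * G * enorm (x - x') &
      forall x, `|Phib x - penalized C G f x| <= 3 * G * r].
Proof.
(* Without samples there is no expectation to take, and the penalized mean itself meets the
   bounds. *)
have [T0|T0] := posnP T.
  exists (penalized C G f); split => [t x|x x'|x]; first by rewrite T0.
    exact: (penalized_lip _ dpsi _ dpsiP G0 _ df).
  by rewrite subrr normr0 !mulr_ge0.
pose Phib x := fine (\int[P]_om (smoothed r (Y 0 om) x)%:E).
have mean0 x : (\int[P]_om (smoothed r (Y 0 om) x)%:E = (Phib x)%:E)%E.
  by rewrite fineK //; apply: integrable_fin_num => //; exact: near_int.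
exists Phib; split => [t x tT|x x'|x].
- rewrite -mean0; apply: (@eq_law_integral _ _ _ _ _ P _ _ P (Y 0) (Y t)
    (fun y => smoothed r y x)); try exact: mY.
  + exact: smoothed_measurable.
  + exact: Y_law.
  + exact: near_int.
- apply: (integral_dist_le (fun om => smoothed r (Y 0 om) x)
    (fun om => smoothed r (Y 0 om) x')) (mean0 x) (mean0 x') _; try exact: near_int.
  by move=> om; exact: smoothed_lip.
- have [iH eH] := penalized_law x _ _ _ _ (law 0%N T0).
  apply: (integral_dist_le (fun om => smoothed r (Y 0 om) x) _ _ _ _ _ iH (mean0 x) eH).
    exact: near_int.
  by move=> om; exact: smoothed_near.
Qed.

(** With the zero field in place of a mean subgradient all reference paths are constant, as
    [rate_rough] needs. The term [6 * G * r] is the bias [3 * G * r] of smoothing, paid at the last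
    iterate and at [uopt]. *)
Lemma smoothed_bound (p : nat) (lam := Num.sqrt (8 * (4 * N%:R + 9) * ln T%:R) : R) :
  (2 <= T)%N -> 2 * Q * N.+1%:R < T%:R -> (1 < p)%N -> (p ^ 10 <= T < p.+1 ^ 10)%N ->
  1 <= lam ->
  exists A : set Om, [/\ measurable A, ((1 - T%:R^-1)%:E <= P A)%E &
    forall w, A w ->
      f (proj (ssgd_iter u1 (fun s => r / Num.sqrt s%:R)
                 (fun t x => dF (xi t w) x + (2 * G) *: dpsi x) (fun t => v t w) T)) - f uopt <=
      64 ^+ 2 * (Q ^+ 2 * p%:R^-1 ^+ 5 / (2 * r) +
        20 * Q ^+ 2 * (r / p%:R + lam * p%:R^-1 ^+ 2) * (4 + ln T%:R) +
        208 * Q ^+ 2 * lam * Num.sqrt (p%:R^-1 ^+ 5)) + 6 * G * r].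
Proof.
move=> T2 QT p2 pT lam1.
have /andP[rgt0 r1] := r01.
pose wt s : R := r / Num.sqrt s.+1%:R.
have w01 s : 0 <= wt s <= 1 by apply: learning_rate01; rewrite r0.
have Q0 : 0 <= Q := le_trans ler01 Q1.
have p0 : (0 < p)%N := ltnW p2.
have /andP[pT1 _] := pT.
have [Phib [iPhib lPhib nPhib]] := smoothed_mean.
have sl y x x' : `|smoothed r y x - smoothed r y x'| <= Q * enorm (x - x').
  by apply: lip_le; [exact: smoothed_lip|exact: enorm_ge0].
have bl x x' : `|Phib x - Phib x'| <= Q * enorm (x - x').
  by apply: lip_le; [exact: lPhib|exact: enorm_ge0].
have [A [Z [mA PA hA net]]] := grid_good_event Y T T./2 p (smoothed r) Phib
  (fun=> 0) Q wt uopt mY indep.1 (fun x => smoothed_measurable r x r0)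
  sl bl iPhib (fun t _ => (andP (w01 t)).1) Q0 T2 QT p0 pT1.
(* Off a null event every shift lies in the ball, where [smoothed] is the objective that the
   algorithm actually samples. *)
have out (t : 'I_T) := uniform_ball_out _ _ _ _ _ r0 (lawv t (ltn_ord t)).
have out0 (t : 'I_T) : (P [set w | (r < enorm (v t w))%R] <= 0%:E)%E by rewrite (out t).2.
have [A' [mA' hA'] PA'] := @measure_bigU_le _ _ _ P 'I_T
  (fun t => [set w | r < enorm (v t w)]) 0
  (fun t => (out t).1) out0.
exists (A `&` A'); split; first exact: measurableI.
  rewrite mulr0 in PA'.
  by have := probability_setI_ge A A' _ _ mA mA' PA PA'; rewrite addr0.
move=> om [Aom A'om].
have vr s : (s < T)%N -> enorm (v s om) <= r.
  by move=> sT; rewrite leNgt; apply/negP => h; exact: (hA' om (Ordinal sT) A'om).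
pose u := ssgd_iter u1 (fun s => r / Num.sqrt s%:R)
  (fun t x => dF (xi t om) x + (2 * G) *: dpsi x) (fun t => v t om).
pose gx s := dF (xi s om) (u s - v s om).
have uS s : u s.+1 = u s - wt s *: (gx s + (2 * G) *: dpsi (u s - v s om)) by [].
apply: le_trans (penalized_gap C proj G uopt cptC cvxC projP Copt G0 f df _ dfP df_le) _.
have := nPhib (u T); have := nPhib uopt; rewrite !ler_norml => /andP[_ n1] /andP[n2 _].
suff : Phib (u T) - Phib uopt <= 64 ^+ 2 * (Q ^+ 2 * p%:R^-1 ^+ 5 / (2 * r) +
        20 * Q ^+ 2 * (r / p%:R + lam * p%:R^-1 ^+ 2) * (4 + ln T%:R) +
        208 * Q ^+ 2 * lam * Num.sqrt (p%:R^-1 ^+ 5)).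
  move: n1 n2; rewrite -/u; lra.
apply: (@rate_rough _ _ wt u (fun s => gx s + (2 * G) *: dpsi (u s - v s om))
  (fun s => smoothed r (Y s om)) Phib (fun=> 0) Q _ r T p Z uopt) => //.
- by move=> s sT; apply: smoothed_subgrad; exact: vr.
- move=> s sT; apply: le_trans G3Q.
  by exact: (penalized_grad_le _ _ _ dpsiP G0 _ _ (dF_le _ _)).
- by move=> x; rewrite enorm0.
- exact: hA.
- move=> s sT; apply: (penalized_confined C proj dpsi G uopt cptC cvxC projP dpsiP Copt G0
    wt u (fun s => u s - v s om) gx T) => // s' s'T; first exact: dF_le.
  by rewrite opprB addrC subrK (le_trans (vr s' s'T)).
Qed.

End SmoothedNoise.

End Unsmoothed.

(** * Horizons beyond which the error terms are small *)

Section Thresholds.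
Context {R : realType}.
Variables (N : nat) (Q : R).
Hypothesis Q1 : 1 <= Q.

Let lam (T : nat) : R := Num.sqrt (8 * (4 * N%:R + 9) * ln T%:R).
Let kN : R := Num.sqrt (8 * (4 * N%:R + 9)).

Let kN0 : 0 <= kN. Proof. exact: sqrtr_ge0. Qed.

Let kN2 : 0 <= 8 * (4 * N%:R + 9) :> R.
Proof. by rewrite mulr_ge0 // addr_ge0 // mulr_ge0. Qed.

Let lamE T : lam T = kN * Num.sqrt (ln T%:R).
Proof. by rewrite /lam sqrtrM. Qed.

Lemma large_horizon : exists Y0 : R, forall T, (0 < T)%N -> Y0 <= ln T%:R ->
  [/\ (2 ^ 10 <= T)%N, 2 * Q * N.+1%:R < T%:R, 1 <= lam T &
   forall p, (0 < p)%N -> (p ^ 10 <= T < p.+1 ^ 10)%N -> 30 * lam T / p%:R <= 1].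
Proof.
have c0 : 0 < 2 * Q * N.+1%:R by rewrite !mulr_gt0 ?ltr0n // (lt_le_trans ltr01).
(* One summand for each requirement. The product [150 * 160] is [60 * 400], with [60 = 30 * 2] from
   the bound on [1 / p] and 400 from [(1 + y) ^+ 2 <= 400 * expR (y / 10)]. *)
exists (1 + ln (2 ^ 10)%:R + `|ln (2 * Q * N.+1%:R)| + 150 * (160 * kN)) => T T0 hy.
have T0R : 0 < T%:R :> R by rewrite ltr0n.
have b0 : 0 <= ln (2 ^ 10)%:R :> R by rewrite ln_ge0 // ler1n.
have b1 := ler_norm (ln (2 * Q * N.+1%:R)).
have b2 : 0 <= `|ln (2 * Q * N.+1%:R)| by [].
have b3 : 0 <= 150 * (160 * kN) by exact: mulr_ge0 (ler0n _ 150) (mulr_ge0 (ler0n _ 160) kN0).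
set y : R := ln T%:R in hy *; have y1 : 1 <= y by move: hy b0 b2 b3; lra.
have y0 : 0 <= y by lra.
split.
- rewrite -(ler_nat R) -ler_ln ?posrE ?ltr0n ?expn_gt0 // -/y; move: hy b2 b3; lra.
- rewrite -ltr_ln ?posrE // -/y; move: hy b0 b1 b3; lra.
- rewrite /lam -/y -[leLHS]sqrtr1 ler_wsqrtr //.
  have n0 : 0 <= N%:R :> R by [].
  have : 8 * (4 * N%:R + 9) * 1 <= 8 * (4 * N%:R + 9) * y by rewrite ler_wpM2l.
  lra.
move=> p p0 pT; rewrite lamE -/y.
have xp := inv_tenth_root_le T p p0 pT; rewrite -/y in xp.
have sy := sqrt_le1D y y0.
have e2 : (1 + y) ^+ 2 <= 400 * expR (y / 10).
  have h : 1 + y / 20 <= expR (y / 20) := expR_ge1Dx _.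
  have h2 : (1 + y / 20) ^+ 2 <= expR (y / 20) ^+ 2.
    by rewrite ler_pXn2r ?nnegrE ?expR_ge0 // addr_ge0 // divr_ge0.
  rewrite -expRM_natl (_ : 2%:R * (y / 20) = y / 10) in h2; last by field.
  have : (1 + y) ^+ 2 <= 400 * (1 + y / 20) ^+ 2 by have := sqr_ge0 y; lra.
  by move: h2; lra.
have ex0 : 0 < expR (y / 10) by apply: expR_gt0.
have k1 : kN * Num.sqrt y / p%:R <= kN * (1 + y) * (2 * expR (- (y / 10))).
  apply: ler_pM; [by rewrite mulr_ge0 ?sqrtr_ge0|by rewrite invr_ge0| |exact: xp].
  by rewrite ler_wpM2l.
have k2 : 60 * (kN * (1 + y)) <= expR (y / 10).
  have h : 150 * (160 * kN) * (1 + y) <= (1 + y) * (1 + y).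
    by rewrite ler_wpM2r ?addr_ge0 //; move: hy b0 b2; lra.
  by move: h e2; rewrite expr2; lra.
have k3 : 60 * (kN * (1 + y)) * expR (- (y / 10)) <= 1.
  by rewrite expRN ler_pdivrMr // mul1r.
by move: k1 k3; lra.
Qed.

Let horizon b : exists l0 : R, 0 < l0 /\ forall (c l : R) T, l0 <= l -> 4 <= c -> (0 < T)%N ->
  c * l + b <= ln T%:R ->
  [/\ (2 ^ 10 <= T)%N, 2 * Q * N.+1%:R < T%:R, 1 <= lam T, T%:R^-1 <= expR (- l) &
   forall p, (0 < p)%N -> (p ^ 10 <= T < p.+1 ^ 10)%N -> 30 * lam T / p%:R <= 1].
Proof.
have [Y0 hY] := large_horizon.
have n1 := ler_norm Y0; have n2 := ler_norm (- b); have n3 := normr_ge0 Y0.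
have n4 := normr_ge0 (- b).
exists (1 + `|Y0| + `|- b|); split => [|c l T ll c4 T0 hT]; first by lra.
have l0 : 0 <= l by move: ll; lra.
have cl := ler_wpM2r l0 c4.
have [|h1 h2 h3 h4] := hY T T0; first by move: hT cl ll; lra.
split => //; rewrite -[T%:R]lnK ?posrE ?ltr0n // -expRN ler_expR lerN2.
by move: hT cl ll; lra.
Qed.

Lemma fine_horizon (b g : R) : 0 < g -> exists l0 : R, 0 < l0 /\ forall (l : R) T, l0 <= l -> (0 < T)%N ->
  4 * l + b <= ln T%:R ->
  [/\ (2 <= T)%N, 2 * Q * N.+1%:R < T%:R, 1 <= lam T, T%:R^-1 <= expR (- l) &
   exists p, [/\ (1 < p)%N, (p ^ 10 <= T < p.+1 ^ 10)%N, 30 * lam T / p%:R <= 1 &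
     64 ^+ 2 * (Q ^+ 2 * p%:R^-1 ^+ 5 / (2 * 1) +
        257 * Q ^+ 2 * lam T ^+ 2 * p%:R^-1 ^+ 3 * (4 + ln T%:R) +
        208 * Q ^+ 2 * lam T * Num.sqrt (p%:R^-1 ^+ 5)) <= g * expR (- l) * l]].
Proof.
move=> g0; have [la [la0 hla]] := horizon b.
have Q0 : 0 <= Q := le_trans ler01 Q1.
have pos (a : R) : 0 <= a -> 0 <= 64 ^+ 2 * a by move=> a0; rewrite mulr_ge0 // exprn_ge0.
have half : 0 <= Q ^+ 2 / 2 by rewrite divr_ge0 ?exprn_ge0.
have [lb hlb] := @fine_rate_small R (64 ^+ 2 * (Q ^+ 2 / 2))
  (64 ^+ 2 * (257 * Q ^+ 2 * (8 * (4 * N%:R + 9)))) (64 ^+ 2 * (208 * Q ^+ 2 * kN)) b g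
  (pos _ half) (pos _ (mulr_ge0 (mulr_ge0 (ler0n R 257) (exprn_ge0 2 Q0)) kN2))
  (pos _ (mulr_ge0 (mulr_ge0 (ler0n R 208) (exprn_ge0 2 Q0)) kN0)) g0.
exists (Num.max la lb); split => [|l T]; first by rewrite lt_max la0.
rewrite ge_max => /andP[ll1 ll2] T0 hT.
have [h1 h2 h3 h4 h5] := hla 4 l T ll1 (lexx _) T0 hT.
have [p p1 pT] := tenth_root T h1; have p0 := ltnW p1.
split => //; first exact: leq_trans h1.
exists p; split => //; first exact: h5.
have y0 : 0 <= ln T%:R :> R by rewrite ln_ge0 // ler1n.
have x0 : 0 <= (p%:R^-1 : R) <= 2 * expR (- (ln T%:R / 10)).
  by rewrite invr_ge0 ler0n /= inv_tenth_root_le.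
have := hlb l _ _ ll2 hT y0 x0; apply: le_trans.
rewrite lamE exprMn !sqr_sqrtr // le_eqVlt; apply/orP; left; apply/eqP.
by set x := p%:R^-1; field.
Qed.

Lemma rough_horizon (b g H : R) : 0 < g -> 0 <= H ->
  exists l0 : R, 0 < l0 /\ forall (l : R) T, l0 <= l -> (0 < T)%N ->
  6 * l + b <= ln T%:R ->
  [/\ (2 <= T)%N, 2 * Q * N.+1%:R < T%:R, 1 <= lam T, T%:R^-1 <= expR (- l) &
   exists p, [/\ (1 < p)%N, (p ^ 10 <= T < p.+1 ^ 10)%N &
     64 ^+ 2 * (Q ^+ 2 * p%:R^-1 ^+ 5 / (2 * expR (- l)) +
        20 * Q ^+ 2 * (expR (- l) / p%:R + lam T * p%:R^-1 ^+ 2) * (4 + ln T%:R) +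
        208 * Q ^+ 2 * lam T * Num.sqrt (p%:R^-1 ^+ 5)) + H * expR (- l) <=
     g * expR (- l) * l]].
Proof.
move=> g0 H0; have [la [la0 hla]] := horizon b.
have Q0 : 0 <= Q := le_trans ler01 Q1.
have pos (a : R) : 0 <= a -> 0 <= 64 ^+ 2 * a by move=> a0; rewrite mulr_ge0 // exprn_ge0.
have half : 0 <= Q ^+ 2 / 2 by rewrite divr_ge0 ?exprn_ge0.
pose k1 := 1 + kN.
have k10 : 0 <= k1 by rewrite addr_ge0.
have [lb hlb] := @rough_rate_small R (64 ^+ 2 * (Q ^+ 2 / 2))
  (64 ^+ 2 * (20 * Q ^+ 2 * k1)) (64 ^+ 2 * (208 * Q ^+ 2 * kN)) H b g
  (pos _ half) (pos _ (mulr_ge0 (mulr_ge0 (ler0n R 20) (exprn_ge0 2 Q0)) k10))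
  (pos _ (mulr_ge0 (mulr_ge0 (ler0n R 208) (exprn_ge0 2 Q0)) kN0)) H0 g0.
exists (Num.max la lb); split => [|l T]; first by rewrite lt_max la0.
rewrite ge_max => /andP[ll1 ll2] T0 hT.
have [h1 h2 h3 h4 _] := hla 6 l T ll1 ltac:(lra) T0 hT.
have [p p1 pT] := tenth_root T h1; have p0 := ltnW p1.
split => //; first exact: leq_trans h1.
exists p; split => //.
have y0 : 0 <= ln T%:R :> R by rewrite ln_ge0 // ler1n.
have x0 : 0 <= (p%:R^-1 : R) <= 2 * expR (- (ln T%:R / 10)).
  by rewrite invr_ge0 ler0n /= inv_tenth_root_le.
have := hlb l _ _ ll2 hT y0 x0; apply: le_trans.
have e0 := expR_gt0 (- l); rewrite lamE.
have x1 : 0 <= p%:R^-1 :> R by rewrite invr_ge0.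
set x := p%:R^-1 in x1 *; set e := expR _ in e0 *; set y := ln _ in y0 *.
have s0 := sqrtr_ge0 y.
have m : (e * x + kN * Num.sqrt y * x ^+ 2) * (4 + y) <=
    k1 * ((e * x + Num.sqrt y * x ^+ 2) * (4 + y)).
  rewrite mulrA ler_wpM2r ?addr_ge0 //.
  have a1 : 0 <= e * x by rewrite mulr_ge0 // ltW.
  have a2 : 0 <= Num.sqrt y * x ^+ 2 by rewrite mulr_ge0 ?exprn_ge0.
  have a3 := mulr_ge0 kN0 a1.
  by rewrite /k1; move: a1 a2 a3; lra.
have c0 : 0 <= 64 ^+ 2 * (20 * Q ^+ 2) by rewrite !mulr_ge0 ?exprn_ge0.
have := ler_wpM2l c0 m.
have -> : Q ^+ 2 * x ^+ 5 / (2 * e) = Q ^+ 2 / 2 * (x ^+ 5 / e) by field; rewrite gt_eqF.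
lra.
Qed.

End Thresholds.

(** The prescribed horizon enters the nondegenerate case in this logarithmic form. The slope [2 * m]
    is 6 with smoothing and 4 without, as the two asymptotic estimates require. *)
Lemma log_horizon (R : realType) (k e : R) (m T : nat) : 0 < k -> 0 < e ->
  (Num.ceil (k / (2 * e ^+ m) + 1))%:~R ^+ 2 - 1 <= (T%:R : R) ->
  (0 < T)%N /\ (2 * m)%:R * ln e^-1 + 2 * ln (k / 2) <= ln T%:R.
Proof.
move=> k0 e0 h; have a0 : 0 < k / (2 * e ^+ m) by rewrite divr_gt0 ?mulr_gt0 ?exprn_gt0.
have aT := sqr_le_ceil _ _ (ltW a0) h.
have T0 : 0 < T%:R :> R by apply: lt_le_trans aT; rewrite exprn_gt0.
split; first by rewrite -(ltr0n R).
move: aT; rewrite -ler_ln ?posrE ?exprn_gt0 // lnXn //.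
rewrite (_ : k / (2 * e ^+ m) = k / 2 * e^-1 ^+ m); last first.
  by rewrite invfM exprVn mulrA.
rewrite lnM ?posrE ?exprn_gt0 ?divr_gt0 ?invr_gt0 // lnXn ?invr_gt0 //.
rewrite -[_ *+ m]mulr_natl; apply: le_trans.
by rewrite natrM mulr2n le_eqVlt; apply/orP; left; apply/eqP; ring.
Qed.

Theorem theorem3p7 (R : realType) (N : nat) (C : set 'rV[R]_N)
  (pi : 'rV[R]_N -> 'rV[R]_N)
  (dD : measure_display) (Xi : measurableType dD) (PD : probability Xi R)
  (F : Xi -> 'rV[R]_N -> R) (dF : Xi -> 'rV[R]_N -> 'rV[R]_N)
  (f : 'rV[R]_N -> R) (df : 'rV[R]_N -> 'rV[R]_N)
  (G : R) (uopt u1 : 'rV[R]_N) (dpsi : 'rV[R]_N -> 'rV[R]_N) :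
  C !=set0 -> compact C -> convex_set C -> is_proj C pi ->
  (forall xi, convex_fun (F xi)) ->
  (forall xi x, subgrad (F xi) (dF xi x) x) ->
  (forall x, PD.-integrable setT (fun xi => (F xi x)%:E)) ->
  (forall x (i : 'I_N), PD.-integrable setT (fun xi => (dF xi x 0 i)%:E)) ->
  (forall x, (f x)%:E = (\int[PD]_xi (F xi x)%:E)%E) ->
  (forall x (i : 'I_N), (df x 0 i)%:E = (\int[PD]_xi (dF xi x 0 i)%:E)%E) ->
  convex_fun f -> (forall x, subgrad f (df x) x) ->
  (forall xi x, enorm (dF xi x) <= G) -> (forall x, enorm (df x) <= G) ->
  C uopt -> (forall x, C x -> f uopt <= f x) ->
  C u1 ->
  (forall y, subgrad (psiC C) (dpsi y) y /\ enorm (dpsi y) <= 1) ->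
  (* smoothed SSGD, eps_sm = eps, learning rates eps / sqrt s *)
  (forall delta : R, 0 < delta -> exists eps0 : R, 0 < eps0 /\
    forall eps : R, 0 < eps < eps0 ->
    forall T : nat,
      (Num.ceil (3 * G * diam C / (2 * eps ^+ 3) + 1))%:~R ^+ 2 - 1 <= (T%:R : R) ->
    forall (dO : measure_display) (Om : measurableType dO) (P : probability Om R)
      (xi : nat -> Om -> Xi) (v : nat -> Om -> 'rV[R]_N),
      (forall t, (t < T)%N -> has_law P PD (xi t)) ->
      (forall t, (t < T)%N -> uniform_ball_law P (v t) eps) ->
      indep_family2 P xi (fun t w => rv2t (v t w)) T ->
    exists A : set Om, [/\ measurable A,
      ((1 - (1 + delta) * (2 * eps))%:E <= P A)%E &
      forall w, A w ->
        f (pi (ssgd_iter u1 (fun s => eps / Num.sqrt s%:R)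
                 (fun t x => dF (xi t w) x + (2 * G) *: dpsi x)
                 (fun t => v t w) T)) - f uopt
        <= (1 + delta) * (128 * G ^+ 2 * eps * ln eps^-1)])
  /\
  (* L-Lipschitz mean subgradient: no smoothing, learning rates 1 / sqrt s *)
  (forall L : R, 0 <= L -> (forall x y, enorm (df x - df y) <= L * enorm (x - y)) ->
   forall delta : R, 0 < delta -> exists eps0 : R, 0 < eps0 /\
    forall eps : R, 0 < eps < eps0 ->
    forall T : nat,
      (Num.ceil (3 * G * diam C / (2 * eps ^+ 2) + 1))%:~R ^+ 2 - 1 <= (T%:R : R) ->
    forall (dO : measure_display) (Om : measurableType dO) (P : probability Om R)
      (xi : nat -> Om -> Xi),
      (forall t, (t < T)%N -> has_law P PD (xi t)) ->
      indep_family P xi T ->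
    exists A : set Om, [/\ measurable A,
      ((1 - (1 + delta) * (2 * eps))%:E <= P A)%E &
      forall w, A w ->
        f (pi (ssgd_iter u1 (fun s => 1 / Num.sqrt s%:R)
                 (fun t x => dF (xi t w) x + (2 * G) *: dpsi x)
                 (fun _ => 0) T)) - f uopt
        <= (1 + delta) * (128 * G ^+ 2 * eps * ln eps^-1)]).
Proof.
move=> _ cptC cvxC projP _ dFP F_int _ f_mean _ _ dfP dF_le df_le Copt _ Cu1 dpsiP.
have G0 : 0 <= G := le_trans (enorm_ge0 _) (df_le 0).
have D0 : 0 <= diam C := diam_ge0 C uopt cptC Copt.
have prob_le (e del p : R) : 0 < e -> 0 < del -> p <= e -> 1 - (1 + del) * (2 * e) <= 1 - p.
  by move=> e0 del0 pe; have := mulr_gt0 del0 e0; lra.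
(* If [G * diam C] vanishes, the condition on [T] reads [0 <= T] and gives no control. But then
   every point of [C] is optimal, and the projection ends in [C]. *)
have [GD|GD] := eqVneq (G * diam C) 0.
  have trivial_event (d : measure_display) (Om : measurableType d) (P : probability Om R)
      (out : Om -> 'rV[R]_N) (e del : R) : 0 < e < 1 -> 0 < del ->
      exists A : set Om, [/\ measurable A, ((1 - (1 + del) * (2 * e))%:E <= P A)%E &
        forall w, A w -> f (pi (out w)) - f uopt <= (1 + del) * (128 * G ^+ 2 * e * ln e^-1)].
    move=> /andP[e0 e1] del0; exists setT; split => //.
      by rewrite probability_setT lee_fin; have := prob_le e del 0 e0 del0 (ltW e0); lra.
    move=> w _; apply: le_trans (degenerate_gap C pi G uopt cptC projP Copt G0 f df _ dfP df_le GD) _.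
    have l0 : 0 <= ln e^-1 by rewrite ln_ge0 // invf_ge1 // ltW.
    by rewrite !mulr_ge0 ?exprn_ge0 ?(ltW e0) // addr_ge0 // ltW.
  split => [del del0|L _ _ del del0]; exists 1; split => // eps eps1 T _ dO Om P xi *.
    exact: (trivial_event _ _ _ (fun w => ssgd_iter u1 _ (fun t x => _) (fun t => _) T)).
  exact: (trivial_event _ _ _ (fun w => ssgd_iter u1 _ (fun t x => _) (fun t => _) T)).
have Gp : 0 < G by rewrite lt_neqAle G0 andbT eq_sym; apply: contraNneq GD => ->; rewrite mul0r.
have Dp : 0 < diam C.
  by rewrite lt_neqAle D0 andbT eq_sym; apply: contraNneq GD => ->; rewrite mulr0.
have kp : 0 < 3 * G * diam C by rewrite !mulr_gt0.
have Q1 := confinement_radius_ge1 C G uopt cptC Copt G0.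
(* The error is [o(eps * ln (1/eps))], so any positive slope could be prescribed; this one is
   positive because [G] is. *)
have gp : 0 < 128 * G ^+ 2 by rewrite mulr_gt0 ?exprn_gt0.
pose b := 2 * ln (3 * G * diam C / 2).
have logE (e l0 : R) : 0 < l0 -> 0 < e < expR (- l0) ->
    [/\ 0 < e, e <= 1, l0 <= ln e^-1 & expR (- ln e^-1) = e].
  move=> l00 /andP[e0 el]; have le : l0 <= ln e^-1.
    by rewrite lnV ?posrE // lerNr -[leRHS]expRK ler_ln ?posrE ?expR_gt0 // ltW.
  split => //; last by rewrite lnV ?posrE // opprK lnK.
  by apply: (le_trans (ltW el)); rewrite expR_le1 oppr_le0 ltW.
have final (e del t : R) : 0 < e -> e <= 1 -> 0 < del ->
    t <= 128 * G ^+ 2 * e * ln e^-1 -> t <= (1 + del) * (128 * G ^+ 2 * e * ln e^-1).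
  move=> e0 e1 del0 h; apply: (le_trans h); rewrite ler_peMl //; last by rewrite lerDl ltW.
  by rewrite !mulr_ge0 ?exprn_ge0 ?(ltW e0) // ln_ge0 // invf_ge1.
split => [del del0|L _ _ del del0].
- have G6 : 0 <= 6 * G by rewrite mulr_ge0.
  have [l0 [l00 hl0]] := rough_horizon N (confinement_radius C G) Q1 b _ (6 * G) gp G6.
  exists (expR (- l0)); split => [|eps eps_lt T hT dO Om P xi v law lawv ind]; first exact: expR_gt0.
  have [e0 e1 ll eE] := logE eps l0 l00 eps_lt.
  have [T0 yT] := log_horizon _ _ _ 3 T kp e0 hT.
  have [T2 QT lam1 PT [p [p1 pT bnd]]] := hl0 _ T ll T0 yT.
  rewrite eE in PT bnd.
  have [|A [mA PA hA]] := smoothed_bound C pi dpsi F dF f df G uopt u1 cptC cvxC projP dFP F_int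
    f_mean dfP dF_le df_le Copt Cu1 dpsiP xi v T eps _ law lawv ind p T2 QT p1 pT lam1.
    by rewrite e0.
  exists A; split => //.
    by apply: le_trans PA; rewrite lee_fin prob_le.
  by move=> w /hA h; apply: final => //; exact: le_trans h bnd.
- have [l0 [l00 hl0]] := fine_horizon N (confinement_radius C G) Q1 b _ gp.
  exists (expR (- l0)); split => [|eps eps_lt T hT dO Om P xi law ind]; first exact: expR_gt0.
  have [e0 e1 ll eE] := logE eps l0 l00 eps_lt.
  have [T0 yT] := log_horizon _ _ _ 2 T kp e0 hT.
  have [T2 QT lam1 PT [p [p1 pT lamp bnd]]] := hl0 _ T ll T0 yT.
  rewrite eE in PT bnd.
  have [A [mA PA hA]] := unsmoothed_bound C pi dpsi F dF f df G uopt u1 cptC cvxC projP dFP F_int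
    f_mean dfP dF_le df_le Copt Cu1 dpsiP T p _ _ P xi law ind T2 QT p1 pT lam1 lamp.
  exists A; split => //.
    by apply: le_trans PA; rewrite lee_fin prob_le.
  by move=> w /hA h; apply: final => //; exact: le_trans h bnd.
Qed.
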